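(* Let $\Sigma_{g,1}$ be a compact connected oriented surface of genus $g$ with one boundary component, $\pi=\pi_1(\Sigma_{g,1})$ and $H=H_1(\Sigma_{g,1};\mathbb{Q})$. Let $\widehat{\mathbb{Q}\pi}=\varprojlim_n \mathbb{Q}\pi/I^n$ be the completion of the group ring $\mathbb{Q}\pi$ with respect to the augmentation ideal $I$. Then the group $K_1(\widehat{\mathbb{Q}\pi})$ is isomorphic to $$\mathbb{Q}^\times\oplus\prod_{n=1}^\infty (H^{\otimes n})_{\mathbb{Z}_n}.$$
   Context: The cyclic group $\mathbb{Z}_n=\mathbb{Z}/n\mathbb{Z}$ acts on $H^{\otimes n}$ by cyclic permutation of the tensor factors, and $(H^{\otimes n})_{\mathbb{Z}_n}$ denotes the space of coinvariants, regarded as an additive group. $\mathbb{Q}^\times$ is the multiplicative group of nonzero rationals. $K_1(R)=\mathrm{GL}(R)_{\mathrm{ab}}$ is the usual algebraic $K_1$-group of a ring $R$ (as an abstract ring). *)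

(* Defs.v *)
From HB Require Import structures.
From mathcomp Require Import all_boot all_order all_algebra lra.
From mathcomp.multinomials Require Import -(notations) monalg.
From mathcomp Require Import finmap all_classical reals topology normedtype
  homotopy.

Set Implicit Arguments.
Unset Strict Implicit.
Unset Printing Implicit Defensive.

Import Order.TTheory GRing.Theory Num.Theory numFieldNormedType.Exports.

Local Open Scope classical_set_scope.
Local Open Scope ring_scope.
Local Open Scope quotient_scope.

Definition group_isomorphic (G H : groupType) : Prop :=
  exists f : G -> H, {morph f : x y / (x * y)%g} /\ bijective f.

Definition is_subgroup (G : groupType) (S : set G) : Prop :=
  S 1%g /\ forall x y, S x -> S y -> S (x * y^-1)%g.

Definition commutator_subgroup (G : groupType) : set G :=
  [set x | forall S : set G,
     is_subgroup S -> (forall a b : G, S [~ a, b]%g) -> S x].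

Section Abelianization.
Variable G : groupType.
Local Notation D := (@commutator_subgroup G).

Lemma commutator_subgroupP : is_subgroup D.
Proof.
split=> [S [S1 _] _ //|x y Dx Dy S SS SC].
by apply: SS.2; [exact: Dx|exact: Dy].
Qed.

Lemma commutator_subgroup_comm (a b : G) : D [~ a, b]%g.
Proof. by move=> S _; apply. Qed.

Lemma commutator_subgroup_inv x : D x -> D (x^-1)%g.
Proof.
by move=> Dx; rewrite -[(x^-1)%g]mul1g; apply: commutator_subgroupP.2;
  [exact: commutator_subgroupP.1|].
Qed.

Lemma commutator_subgroup_mul x y : D x -> D y -> D (x * y)%g.
Proof.
move=> Dx Dy; rewrite -[y]invgK; apply: commutator_subgroupP.2 => //.
exact: commutator_subgroup_inv.
Qed.

Lemma commutator_subgroup_conj x y : D x -> D (x ^ y)%g.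
Proof.
move=> Dx; have -> : (x ^ y = x * [~ x, y])%g by rewrite commgEl mulgA mulgV mul1g.
exact: commutator_subgroup_mul (commutator_subgroup_comm _ _).
Qed.

Definition ab_equiv : rel G := fun x y => `[< D (x^-1 * y)%g >].

Lemma ab_equiv_is_equiv : equiv_class_of ab_equiv.
Proof.
split=> [x|x y|y x z]; rewrite /ab_equiv.
- by rewrite mulVg; apply/asboolP; exact: commutator_subgroupP.1.
- by apply: asbool_equiv_eq; split=> /commutator_subgroup_inv;
    rewrite invgM invgK.
- move=> /asboolP xy /asboolP yz; apply/asboolP.
  have := commutator_subgroup_mul xy yz.
  by rewrite mulgA -(mulgA _ y) mulgV mulg1.
Qed.

Canonical ab_equivR := EquivRelPack ab_equiv_is_equiv.

Definition abelianization := {eq_quot ab_equivR}.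
HB.instance Definition _ := EqQuotient.on abelianization.
HB.instance Definition _ := Choice.on abelianization.

Definition ab_mul := lift_op2 abelianization (fun x y : G => x * y)%g.
Definition ab_inv := lift_op1 abelianization (fun x : G => x^-1)%g.
Definition ab_one : abelianization := lift_cst abelianization 1%g.

Lemma pi_ab_mul : {morph \pi_abelianization : x y / (x * y)%g >-> ab_mul x y}.
Proof.
move=> x y; unlock ab_mul; apply/eqP; rewrite eqmodE /= /ab_equiv.
have /eqmodP/asboolP Hx := esym (reprK (\pi_abelianization x)).
have /eqmodP/asboolP Hy := esym (reprK (\pi_abelianization y)).
apply/asboolP; set x' := repr _ in Hx *; set y' := repr _ in Hy *.
have -> : ((x * y)^-1 * (x' * y') = (x^-1 * x') ^ y * (y^-1 * y'))%g.
  by rewrite invgM /conjg !mulgA mulgK.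
by apply: commutator_subgroup_mul => //; exact: commutator_subgroup_conj.
Qed.
Canonical pi_ab_mul_morph := PiMorph2 pi_ab_mul.

Lemma pi_ab_inv : {morph \pi_abelianization : x / (x^-1)%g >-> ab_inv x}.
Proof.
move=> x; unlock ab_inv; apply/eqP; rewrite eqmodE /= /ab_equiv.
have /eqmodP/asboolP Hx := esym (reprK (\pi_abelianization x)).
apply/asboolP; set x' := repr _ in Hx *.
have -> : (x^-1^-1 * x'^-1 = ((x^-1 * x')^-1) ^ (x^-1))%g.
  by rewrite invgM /conjg !invgK -(mulgA _ x) mulgV mulg1.
by apply: commutator_subgroup_conj; exact: commutator_subgroup_inv.
Qed.
Canonical pi_ab_inv_morph := PiMorph1 pi_ab_inv.
Canonical pi_ab_one_morph := PiConst ab_one.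

Lemma ab_mulA : associative ab_mul.
Proof. by elim/quotW=> x; elim/quotW=> y; elim/quotW=> z; rewrite !piE mulgA. Qed.
Lemma ab_mul1 : left_id ab_one ab_mul.
Proof. by elim/quotW=> x; rewrite !piE mul1g. Qed.
Lemma ab_mulg1 : right_id ab_one ab_mul.
Proof. by elim/quotW=> x; rewrite !piE mulg1. Qed.
Lemma ab_mulV : left_inverse ab_one ab_inv ab_mul.
Proof. by elim/quotW=> x; rewrite !piE mulVg. Qed.
Lemma ab_mulgV : right_inverse ab_one ab_inv ab_mul.
Proof. by elim/quotW=> x; rewrite !piE mulgV. Qed.

HB.instance Definition _ := isGroup.Build abelianization
  ab_mulA ab_mul1 ab_mulg1 ab_mulV ab_mulgV.
End Abelianization.

(* Units of a monoid, each stored with its two-sided inverse. *)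
Section UnitGroup.
Variable M : monoidType.

Definition unit_pred : pred (M * M) :=
  fun p => ((p.1 * p.2)%g == 1%g) && ((p.2 * p.1)%g == 1%g).

Definition unit_group := {p : M * M | unit_pred p}.
HB.instance Definition _ := [isSub of unit_group for val].
HB.instance Definition _ := [Choice of unit_group by <:].

Implicit Types u v w : unit_group.

Lemma unit_group_mulV u : ((val u).1 * (val u).2 = 1)%g.
Proof. by case: u => p /= /andP[/eqP]. Qed.
Lemma unit_group_mulVl u : ((val u).2 * (val u).1 = 1)%g.
Proof. by case: u => p /= /andP[_ /eqP]. Qed.

Fact ug_one_subproof : unit_pred (1, 1)%g.
Proof. by rewrite /unit_pred /= mul1g eqxx. Qed.
Fact ug_inv_subproof u : unit_pred ((val u).2, (val u).1).
Proof. by case: u => p /=; rewrite /unit_pred andbC. Qed.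
Fact ug_mul_subproof u v :
  unit_pred ((val u).1 * (val v).1, (val v).2 * (val u).2)%g.
Proof.
rewrite /unit_pred /= !mulgA.
rewrite -[(_ * _ * (val v).2)%g]mulgA unit_group_mulV mulg1 unit_group_mulV.
by rewrite -[(_ * _ * (val u).1)%g]mulgA unit_group_mulVl mulg1
           unit_group_mulVl eqxx.
Qed.

Definition ug_one : unit_group := Sub _ ug_one_subproof.
Definition ug_inv u : unit_group := Sub _ (ug_inv_subproof u).
Definition ug_mul u v : unit_group := Sub _ (ug_mul_subproof u v).

Lemma ug_mulA : associative ug_mul.
Proof. by move=> u v w; apply/val_inj; rewrite /= !mulgA. Qed.
Lemma ug_mul1 : left_id ug_one ug_mul.
Proof. by move=> u; apply/val_inj; rewrite /= mul1g mulg1; case: (val u). Qed.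
Lemma ug_mulg1 : right_id ug_one ug_mul.
Proof. by move=> u; apply/val_inj; rewrite /= mul1g mulg1; case: (val u). Qed.
Lemma ug_mulV : left_inverse ug_one ug_inv ug_mul.
Proof. by move=> u; apply/val_inj; rewrite /= unit_group_mulVl. Qed.
Lemma ug_mulgV : right_inverse ug_one ug_inv ug_mul.
Proof. by move=> u; apply/val_inj; rewrite /= unit_group_mulV. Qed.

HB.instance Definition _ := isGroup.Build unit_group
  ug_mulA ug_mul1 ug_mulg1 ug_mulV ug_mulgV.
End UnitGroup.

Definition additive_group (V : zmodType) : Type := V.
Section AdditiveGroup.
Variable V : zmodType.
HB.instance Definition _ := Choice.on (additive_group V).
HB.instance Definition _ := isGroup.Build (additive_group V)
  (@addrA V) (@add0r V) (@addr0 V) (@addNr V) (@addrN V).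
End AdditiveGroup.

Definition nonzero (F : fieldType) := {x : F | x != 0}.
Section Nonzero.
Variable F : fieldType.
HB.instance Definition _ := [isSub of nonzero F for val].
HB.instance Definition _ := [Choice of nonzero F by <:].
Implicit Types x y z : nonzero F.

Fact nz_mul_subproof x y : val x * val y != 0.
Proof. by rewrite mulf_neq0 ?(valP x) ?(valP y). Qed.
Fact nz_inv_subproof x : (val x)^-1 != 0.
Proof. by rewrite invr_eq0 (valP x). Qed.
Definition nz_one : nonzero F := exist (fun x : F => x != 0) 1 (oner_neq0 F).
Definition nz_mul x y : nonzero F := exist (fun x : F => x != 0) _ (nz_mul_subproof x y).
Definition nz_inv x : nonzero F := exist (fun x : F => x != 0) _ (nz_inv_subproof x).

Lemma nz_mulA : associative nz_mul.
Proof. by move=> x y z; apply/val_inj; rewrite /= mulrA. Qed.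
Lemma nz_mul1 : left_id nz_one nz_mul.
Proof. by move=> x; apply/val_inj; rewrite /= mul1r. Qed.
Lemma nz_mulr1 : right_id nz_one nz_mul.
Proof. by move=> x; apply/val_inj; rewrite /= mulr1. Qed.
Lemma nz_mulV : left_inverse nz_one nz_inv nz_mul.
Proof. by move=> x; apply/val_inj; rewrite /= mulVf ?(valP x). Qed.
Lemma nz_mulrV : right_inverse nz_one nz_inv nz_mul.
Proof. by move=> x; apply/val_inj; rewrite /= mulfV ?(valP x). Qed.

HB.instance Definition _ := isGroup.Build (nonzero F)
  nz_mulA nz_mul1 nz_mulr1 nz_mulV nz_mulrV.
End Nonzero.

(* GL(R) = \bigcup_n GL_n(R) is realised as the unit group of the monoid of
   infinite matrices that agree with the identity outside a finite block. *)
Section StableMatrices.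
Variable R : pzRingType.
Implicit Types A B C : nat -> nat -> R.

Definition stable_above (N : nat) A : Prop :=
  forall i j, (N <= i)%N || (N <= j)%N -> A i j = (i == j)%:R.

Definition stable_pred : pred (nat -> nat -> R) :=
  fun A => `[< exists N, stable_above N A >].

Definition stable_mx := {A : nat -> nat -> R | stable_pred A}.
HB.instance Definition _ := [isSub of stable_mx for val].
HB.instance Definition _ := [Choice of stable_mx by <:].

(* A row of a stable matrix has finite support, so the sum is finite. *)
Definition infmx_mul A B : nat -> nat -> R :=
  fun i j => \sum_(k \in [set: nat]) A i k * B k j.
Definition infmx_one : nat -> nat -> R := fun i j => (i == j)%:R.

Lemma infmx_mulE (N M : nat) A B i j : stable_above N A ->
  (N <= M)%N -> (i < M)%N ->
  infmx_mul A B i j = \sum_(k < M) A i k * B k j.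
Proof.
move=> HA NM iM; rewrite /infmx_mul.
rewrite (fsbig_ord _ _ (fun k => A i k * B k j)); apply: esym.
apply: fsbig_widen => // k /= [_ /negP]; rewrite -leqNgt => Mk.
rewrite HA ?(leq_trans NM Mk) ?orbT //.
by rewrite ltn_eqF ?(leq_trans iM Mk) // mul0r.
Qed.

Lemma stable_aboveW N M A : (N <= M)%N -> stable_above N A -> stable_above M A.
Proof.
move=> NM HA i j /orP[] H; apply: HA; first by rewrite (leq_trans NM H).
by rewrite (leq_trans NM H) orbT.
Qed.

Lemma sum_delta_l (M i : nat) (F : nat -> R) : (i < M)%N ->
  \sum_(k < M) (i == k)%:R * F k = F i.
Proof.
move=> iM; rewrite (bigD1 (Ordinal iM)) //= eqxx mul1r big1 ?addr0 // => k.
rewrite -val_eqE /= eq_sym => /negPf ->; exact: mul0r.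
Qed.

Lemma sum_delta_r (M j : nat) (F : nat -> R) : (j < M)%N ->
  \sum_(k < M) F k * ((k : nat) == j)%:R = F j.
Proof.
move=> jM; rewrite (bigD1 (Ordinal jM)) //= eqxx mulr1 big1 ?addr0 // => k.
by rewrite -val_eqE /= => /negPf ->; rewrite mulr0.
Qed.

Lemma infmx_mul_stable N A B : stable_above N A -> stable_above N B ->
  stable_above N (infmx_mul A B).
Proof.
move=> HA HB i j Hij.
pose M := maxn N (maxn i j).+1.
have NM : (N <= M)%N by rewrite leq_maxl.
have iM : (i < M)%N by rewrite leq_max ltnS leq_maxl orbT.
have jM : (j < M)%N by rewrite leq_max ltnS leq_maxr orbT.
rewrite (infmx_mulE _ _ HA NM iM); case/orP: Hij => [Ni|Nj].
  rewrite -[RHS](HB i j) ?Ni //.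
  under eq_bigr do rewrite HA ?Ni //.
  exact: (sum_delta_l (fun k => B k j)).
case: (leqP N i) => [Ni|iN].
  under eq_bigr do rewrite HA ?Ni //.
  by rewrite (sum_delta_l (fun k => B k j)) // HB // Ni.
rewrite -[RHS](HA i j) ?Nj ?orbT //.
under eq_bigr do rewrite HB ?Nj ?orbT //.
exact: (sum_delta_r (fun k => A i k)).
Qed.

Fact stable_mul_subproof (A B : stable_mx) :
  stable_pred (infmx_mul (val A) (val B)).
Proof.
case: A B => A /= /asboolP [n HA] [B /= /asboolP [m HB]]; apply/asboolP.
exists (maxn n m); apply: infmx_mul_stable.
  exact: stable_aboveW (leq_maxl _ _) HA.
exact: stable_aboveW (leq_maxr _ _) HB.
Qed.

Fact stable_one_subproof : stable_pred infmx_one.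
Proof. by apply/asboolP; exists 0%N. Qed.

Definition stable_mul (A B : stable_mx) : stable_mx :=
  Sub _ (stable_mul_subproof A B).
Definition stable_one : stable_mx := Sub _ stable_one_subproof.

Lemma stable_mulA : associative stable_mul.
Proof.
move=> [A hA] [B hB] [C hC]; apply/val_inj; rewrite /=.
move/asboolP: (hA) => [n HA]; move/asboolP: (hB) => [m HB].
pose N := maxn n m.
have {}HA : stable_above N A by apply: stable_aboveW HA; rewrite leq_maxl.
have {}HB : stable_above N B by apply: stable_aboveW HB; rewrite leq_maxr.
apply/funext => i; apply/funext => j.
pose M := maxn N i.+1.
have NM : (N <= M)%N by rewrite leq_maxl.
have iM : (i < M)%N by rewrite leq_max ltnSn orbT.
have HAB := infmx_mul_stable HA HB.
rewrite (infmx_mulE _ _ HA NM iM) (infmx_mulE _ _ HAB NM iM).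
under eq_bigr do rewrite (infmx_mulE _ _ HB NM (ltn_ord _)) mulr_sumr.
under [RHS]eq_bigr do rewrite (infmx_mulE _ _ HA NM iM) mulr_suml.
rewrite exchange_big; apply: eq_bigr => k _; apply: eq_bigr => l _.
by rewrite mulrA.
Qed.

Lemma stable_mul1 : left_id stable_one stable_mul.
Proof.
move=> [A hA]; apply/val_inj => /=; apply/funext => i; apply/funext => j.
have H1 : stable_above 0 infmx_one by [].
rewrite (infmx_mulE _ _ H1 (leq0n _) (ltnSn i)).
exact: (sum_delta_l (fun k => A k j)).
Qed.

Lemma stable_mulm1 : right_id stable_one stable_mul.
Proof.
move=> [A hA]; apply/val_inj => /=; apply/funext => i; apply/funext => j.
move/asboolP: (hA) => [n HA].
pose M := maxn n (maxn i j).+1.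
have NM : (n <= M)%N by rewrite leq_maxl.
have iM : (i < M)%N by rewrite leq_max ltnS leq_maxl orbT.
have jM : (j < M)%N by rewrite leq_max ltnS leq_maxr orbT.
rewrite (infmx_mulE _ _ HA NM iM); exact: (sum_delta_r (fun k => A i k)).
Qed.

HB.instance Definition _ := isMonoid.Build stable_mx
  stable_mulA stable_mul1 stable_mulm1.
End StableMatrices.

Definition stable_GL (R : pzRingType) : groupType := unit_group (stable_mx R).

Definition K1 (R : pzRingType) : groupType := abelianization (stable_GL R).

HB.mixin Record isTwoSidedIdeal (R : pzRingType) (S : R -> bool) := {
  ideal_mull : forall a x : R, x \in (S : {pred R}) -> a * x \in (S : {pred R});
  ideal_mulr : forall a x : R, x \in (S : {pred R}) -> x * a \in (S : {pred R})
}.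

#[short(type="twoSidedIdeal")]
HB.structure Definition TwoSidedIdeal (R : pzRingType) :=
  {S of GRing.ZmodClosed R S & isTwoSidedIdeal R S}.

Section RingQuotient.
Variables (R : pzRingType) (J : twoSidedIdeal R).

Definition ring_quot := Quotient.quot J.
HB.instance Definition _ := GRing.Zmodule.on ring_quot.
HB.instance Definition _ := EqQuotient.on ring_quot.

Definition rq_mul := lift_op2 ring_quot (fun x y : R => x * y).
Definition rq_one : ring_quot := lift_cst ring_quot 1.

Lemma rq_eqP (x y : R) : reflect (\pi_ring_quot x = \pi_ring_quot y) (x - y \in J).
Proof. rewrite Quotient.idealrBE; exact: eqP. Qed.

Lemma pi_rq_mul : {morph \pi_ring_quot : x y / x * y >-> rq_mul x y}.
Proof.
move=> x y; unlock rq_mul; apply/rq_eqP.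
have /rq_eqP Hx := esym (reprK (\pi_ring_quot x)).
have /rq_eqP Hy := esym (reprK (\pi_ring_quot y)).
set x' := repr _ in Hx *; set y' := repr _ in Hy *.
have -> : x * y - x' * y' = (x - x') * y + x' * (y - y').
  by rewrite mulrBl mulrBr addrA subrK.
by apply: rpredD; [exact: ideal_mulr|exact: ideal_mull].
Qed.
Canonical pi_rq_mul_morph := PiMorph2 pi_rq_mul.
Canonical pi_rq_one_morph := PiConst rq_one.

Lemma pi_rqD : {morph \pi_ring_quot : x y / x + y >-> x + y}.
Proof. by move=> x y; exact: (@Quotient.pi_add R J). Qed.

Lemma rq_mulA : associative rq_mul.
Proof. by elim/quotW=> x; elim/quotW=> y; elim/quotW=> z; rewrite !piE mulrA. Qed.
Lemma rq_mul1 : left_id rq_one rq_mul.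
Proof. by elim/quotW=> x; rewrite !piE mul1r. Qed.
Lemma rq_mulr1 : right_id rq_one rq_mul.
Proof. by elim/quotW=> x; rewrite !piE mulr1. Qed.
Lemma rq_mulDl : left_distributive rq_mul +%R.
Proof.
elim/quotW=> x; elim/quotW=> y; elim/quotW=> z.
by rewrite -pi_rqD -!pi_rq_mul -pi_rqD mulrDl.
Qed.
Lemma rq_mulDr : right_distributive rq_mul +%R.
Proof.
elim/quotW=> x; elim/quotW=> y; elim/quotW=> z.
by rewrite -pi_rqD -!pi_rq_mul -pi_rqD mulrDr.
Qed.

HB.instance Definition _ := GRing.Zmodule_isPzRing.Build ring_quot
  rq_mulA rq_mul1 rq_mulr1 rq_mulDl rq_mulDr.

Lemma pi_rqM : {morph \pi_ring_quot : x y / x * y >-> x * y}.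
Proof. exact: pi_rq_mul. Qed.
Lemma pi_rq1 : \pi_ring_quot 1 = 1.
Proof. by rewrite piE. Qed.
End RingQuotient.

Definition seq_prod (T : nat -> Type) : Type := forall n, T n.

Section ProductZmod.
Variable T : nat -> zmodType.
Local Notation P := (seq_prod T).
HB.instance Definition _ := gen_eqMixin P.
HB.instance Definition _ := gen_choiceMixin P.
Let add (f g : P) : P := fun n => f n + g n.
Let opp (f : P) : P := fun n => - f n.
Let zero : P := fun n => 0.
Let addA : associative add.
Proof. by move=> f g h; apply: functional_extensionality_dep => n; exact: addrA. Qed.
Let addC : commutative add.
Proof. by move=> f g; apply: functional_extensionality_dep => n; exact: addrC. Qed.
Let add0 : left_id zero add.
Proof. by move=> f; apply: functional_extensionality_dep => n; exact: add0r. Qed.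
Let addN : left_inverse zero opp add.
Proof. by move=> f; apply: functional_extensionality_dep => n; exact: addNr. Qed.
HB.instance Definition _ := GRing.isZmodule.Build P addA addC add0 addN.
End ProductZmod.

Section ProductRing.
Variable T : nat -> pzRingType.
Local Notation P := (seq_prod T).
HB.instance Definition _ := GRing.Zmodule.on P.
Let mul (f g : P) : P := fun n => f n * g n.
Let one : P := fun n => 1.
Let mulA : associative mul.
Proof. by move=> f g h; apply: functional_extensionality_dep => n; exact: mulrA. Qed.
Let mul1 : left_id one mul.
Proof. by move=> f; apply: functional_extensionality_dep => n; exact: mul1r. Qed.
Let mulr1' : right_id one mul.
Proof. by move=> f; apply: functional_extensionality_dep => n; exact: mulr1. Qed.
Let mulDl : left_distributive mul +%R.
Proof. by move=> f g h; apply: functional_extensionality_dep => n; exact: mulrDl. Qed.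
Let mulDr : right_distributive mul +%R.
Proof. by move=> f g h; apply: functional_extensionality_dep => n; exact: mulrDr. Qed.
HB.instance Definition _ := GRing.Zmodule_isPzRing.Build P
  mulA mul1 mulr1' mulDl mulDr.
End ProductRing.

Section FreeModule.
Variable K : choiceType.

Definition basis_elt (k : K) : malg K rat := mkmalgU k 1.

Variables (V : lmodType rat) (f : K -> V).

Definition free_ext (x : malg K rat) : V :=
  \sum_(k <- msupp x) mcoeff k x *: f k.

Lemma free_extw (d : {fset K}) (x : malg K rat) : (msupp x `<=` d)%fset ->
  free_ext x = \sum_(k <- d) mcoeff k x *: f k.
Proof.
move=> xd; rewrite /free_ext (big_fset_incl _ xd) //= => k _ /mcoeff_outdom ->.
by rewrite scale0r.
Qed.

Lemma free_ext_is_linear : linear free_ext.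
Proof.
move=> a x y.
pose d := (msupp x `|` msupp y)%fset.
have hx : (msupp x `<=` d)%fset by rewrite fsubsetUl.
have hy : (msupp y `<=` d)%fset by rewrite fsubsetUr.
have hxy : (msupp (a *: x + y) `<=` d)%fset.
  apply: fsubset_trans (msuppD_le _ _) _.
  by rewrite fsubUset hy (fsubset_trans (msuppZ_le _ _) hx).
rewrite (free_extw hx) (free_extw hy) (free_extw hxy) scaler_sumr -big_split /=.
by apply: eq_bigr => k _; rewrite mcoeffD mcoeffZ scalerDl scalerA.
Qed.

HB.instance Definition _ :=
  GRing.isLinear.Build rat (malg K rat) V *:%R free_ext free_ext_is_linear.

Lemma free_ext_basis k : free_ext (basis_elt k) = f k.
Proof. by rewrite (free_extw msuppU_le) big_seq_fset1 mcoeffUU scale1r. Qed.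
End FreeModule.

Definition group_ring (G : groupType) : Type := malg G rat.

Section GroupRing.
Variable G : groupType.
HB.instance Definition _ := GRing.Lmodule.on (group_ring G).
Implicit Types x y z : group_ring G.

Definition gr_one : group_ring G := basis_elt 1%g.
Definition gr_mul x y : group_ring G :=
  \sum_(g <- msupp x) \sum_(h <- msupp y)
    (mcoeff g x * mcoeff h y) *: basis_elt (g * h)%g.

Lemma gr_mulE x y : gr_mul x y =
  free_ext (fun g => free_ext (fun h => basis_elt (g * h)%g) y) x.
Proof.
apply: eq_bigr => g _; rewrite /free_ext scaler_sumr.
by apply: eq_bigr => h _; rewrite scalerA.
Qed.

Lemma gr_mulEr x y : gr_mul x y =
  free_ext (fun h => free_ext (fun g => basis_elt (g * h)%g) x) y.
Proof.
rewrite /gr_mul exchange_big; apply: eq_bigr => h _; rewrite /free_ext scaler_sumr.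
by apply: eq_bigr => g _; rewrite scalerA mulrC.
Qed.

Lemma gr_mulDl : left_distributive gr_mul +%R.
Proof. by move=> x y z; rewrite !gr_mulE linearD. Qed.
Lemma gr_mulDr : right_distributive gr_mul +%R.
Proof. by move=> x y z; rewrite !gr_mulEr linearD. Qed.
Lemma gr_mulZl a x y : gr_mul (a *: x) y = a *: gr_mul x y.
Proof. by rewrite !gr_mulE linearZ. Qed.
Lemma gr_mulZr a x y : gr_mul x (a *: y) = a *: gr_mul x y.
Proof. by rewrite !gr_mulEr linearZ. Qed.
Lemma gr_mul_basis g h :
  gr_mul (basis_elt g) (basis_elt h) = basis_elt (g * h)%g.
Proof. by rewrite gr_mulE !free_ext_basis. Qed.

Lemma free_modE x : x = \sum_(g <- msupp x) mcoeff g x *: (basis_elt g : group_ring G).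
Proof.
rewrite {1}[x](monalgE x); apply: eq_bigr => g _.
by apply/malgP => k; rewrite mcoeffZ !mcoeffU mulrnAr mulr1.
Qed.

Lemma free_mod_ind (P : group_ring G -> Prop) :
  (forall a x y, P x -> P y -> P (a *: x + y)) -> P 0 ->
  (forall g, P (basis_elt g)) -> forall x, P x.
Proof.
move=> PL P0 PB x; rewrite [x]free_modE; elim: (msupp x : seq _) => [|g s IH].
  by rewrite big_nil.
by rewrite big_cons; apply: PL.
Qed.

Lemma gr_mul0l x : gr_mul 0 x = 0.
Proof. by rewrite gr_mulE linear0. Qed.
Lemma gr_mul0r x : gr_mul x 0 = 0.
Proof. by rewrite gr_mulEr linear0. Qed.

Lemma gr_mulA : associative gr_mul.
Proof.
move=> x y z.
elim/free_mod_ind: x => [a x x' Hx Hx'||g].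
- by rewrite !(gr_mulDl, gr_mulZl) Hx Hx'.
- by rewrite !gr_mul0l.
elim/free_mod_ind: y => [a x x' Hx Hx'||h].
- by rewrite !(gr_mulDl, gr_mulZl, gr_mulDr, gr_mulZr) Hx Hx'.
- by rewrite !(gr_mul0l, gr_mul0r).
elim/free_mod_ind: z => [a x x' Hx Hx'||k].
- by rewrite !(gr_mulDr, gr_mulZr) Hx Hx'.
- by rewrite !gr_mul0r.
by rewrite !gr_mul_basis mulgA.
Qed.

Lemma gr_mul1 : left_id gr_one gr_mul.
Proof.
move=> x; elim/free_mod_ind: x => [a x x' Hx Hx'||g].
- by rewrite !(gr_mulDr, gr_mulZr) Hx Hx'.
- by rewrite gr_mul0r.
by rewrite gr_mul_basis mul1g.
Qed.

Lemma gr_mulr1 : right_id gr_one gr_mul.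
Proof.
move=> x; elim/free_mod_ind: x => [a x x' Hx Hx'||g].
- by rewrite !(gr_mulDl, gr_mulZl) Hx Hx'.
- by rewrite gr_mul0l.
by rewrite gr_mul_basis mulg1.
Qed.

Lemma gr_one_neq0 : gr_one != 0.
Proof.
apply/eqP => /malgP/(_ 1%g)/eqP.
by rewrite mcoeffUU mcoeff0 oner_eq0.
Qed.

HB.instance Definition _ := GRing.Zmodule_isNzRing.Build (group_ring G)
  gr_mulA gr_mul1 gr_mulr1 gr_mulDl gr_mulDr gr_one_neq0.

Definition augmentation (x : group_ring G) : rat :=
  \sum_(g <- msupp x) mcoeff g x.

Lemma augmentationE x : augmentation x = free_ext (fun=> 1 : rat^o) x.
Proof.
by rewrite /augmentation /free_ext; apply: eq_bigr => g _; rewrite /GRing.scale /= mulr1.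
Qed.

Lemma augmentation_linear a x y :
  augmentation (a *: x + y) = a * augmentation x + augmentation y.
Proof. by rewrite !augmentationE linearP. Qed.

Lemma augmentation0 : augmentation 0 = 0.
Proof. by rewrite !augmentationE linear0. Qed.

Lemma augmentation_basis g : augmentation (basis_elt g) = 1.
Proof. by rewrite augmentationE free_ext_basis. Qed.

Lemma augmentationM x y : augmentation (x * y) = augmentation x * augmentation y.
Proof.
elim/free_mod_ind: x => [a x x' Hx Hx'||g].
- have -> : (a *: x + x') * y = a *: (x * y) + x' * y.
    by rewrite mulrDl; congr (_ + _); exact: gr_mulZl.
  by rewrite !augmentation_linear Hx Hx' mulrDl mulrA.
- by rewrite mul0r augmentation0 mul0r.
elim/free_mod_ind: y => [a x x' Hx Hx'||h].
- have -> : (basis_elt g : group_ring G) * (a *: x + x') =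
      a *: ((basis_elt g : group_ring G) * x) + (basis_elt g : group_ring G) * x'.
    by rewrite mulrDr; congr (_ + _); exact: gr_mulZr.
  by rewrite !augmentation_linear Hx Hx' mulrDr mulrCA.
- by rewrite mulr0 augmentation0 mulr0.
by rewrite [_ * _ in LHS]gr_mul_basis !augmentation_basis mulr1.
Qed.
End GroupRing.

(* Powers of a subset I of a ring: I^0 = R, and I^(n+1) consists of the finite
   sums of products a * b with a in I and b in I^n. *)
Fixpoint ideal_power (R : pzRingType) (I : set R) (n : nat) : set R :=
  if n is m.+1 then
    [set x | exists s : seq (R * R),
       (forall p, p \in s -> I p.1 /\ ideal_power I m p.2) /\
       x = \sum_(p <- s) p.1 * p.2]
  else setT.

Section AugmentationPowers.
Variable G : groupType.
Local Notation R := (group_ring G).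

Definition augmentation_ideal : set R := [set x | augmentation x = 0].
Local Notation I := augmentation_ideal.

Lemma aug_idealMl (a x : R) : I x -> I (a * x).
Proof. by move=> Ix; rewrite /augmentation_ideal /= augmentationM Ix mulr0. Qed.
Lemma aug_idealMr (a x : R) : I x -> I (x * a).
Proof. by move=> Ix; rewrite /augmentation_ideal /= augmentationM Ix mul0r. Qed.
Lemma aug_idealN (x : R) : I x -> I (- x).
Proof. by move=> Ix; rewrite -mulN1r; exact: aug_idealMl. Qed.

Definition augmentation_power (n : nat) : {pred R} :=
  fun x => `[< ideal_power I n x >].

Lemma augmentation_powerP n (x : R) :
  reflect (ideal_power I n x) (x \in augmentation_power n).
Proof. exact: asboolP. Qed.

Lemma augmentation_power_zmod n : zmod_closed (augmentation_power n).
Proof.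
case: n => [|n]; first by split=> [|x y _ _]; exact/augmentation_powerP.
split; first by apply/augmentation_powerP; exists [::]; rewrite big_nil.
move=> x y /augmentation_powerP [s [Hs ->]] /augmentation_powerP [t [Ht ->]]; apply/augmentation_powerP.
exists (s ++ [seq (- p.1, p.2) | p <- t]); split=> [p|].
  rewrite mem_cat => /orP[/Hs //|/mapP [q /Ht [q1 q2] ->]] /=.
  by split=> //; exact: aug_idealN.
rewrite big_cat big_map /= -sumrN; congr (_ + _).
by apply: eq_bigr => p _; rewrite mulNr.
Qed.

Lemma augmentation_power_mull n (a x : R) :
  x \in augmentation_power n -> a * x \in augmentation_power n.
Proof.
case: n => [|n]; first by move=> _; apply/augmentation_powerP.
move=> /augmentation_powerP [s [Hs ->]]; apply/augmentation_powerP.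
exists [seq (a * p.1, p.2) | p <- s]; split=> [p /mapP [q /Hs [q1 q2] ->]|].
  by split=> //; exact: aug_idealMl.
by rewrite big_map mulr_sumr; apply: eq_bigr => p _; rewrite mulrA.
Qed.

Lemma augmentation_power_mulr n (a x : R) :
  x \in augmentation_power n -> x * a \in augmentation_power n.
Proof.
elim: n a x => [|n IH] a x; first by move=> _; apply/augmentation_powerP.
move=> /augmentation_powerP [s [Hs ->]]; apply/augmentation_powerP.
exists [seq (p.1, p.2 * a) | p <- s]; split=> [p /mapP [q /Hs [q1 q2] ->]|].
  split=> //=; apply/augmentation_powerP/IH; exact/augmentation_powerP.
by rewrite big_map mulr_suml; apply: eq_bigr => p _; rewrite mulrA.
Qed.

HB.instance Definition _ n := GRing.isZmodClosed.Build R (augmentation_power n)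
  (augmentation_power_zmod n).
HB.instance Definition _ n := isTwoSidedIdeal.Build R (augmentation_power n)
  (@augmentation_power_mull n) (@augmentation_power_mulr n).

Lemma augmentation_power_anti n (x : R) :
  x \in augmentation_power n.+1 -> x \in augmentation_power n.
Proof.
elim: n x => [|n IH] x; first by move=> _; apply/augmentation_powerP.
move=> /augmentation_powerP [s [Hs ->]]; apply/augmentation_powerP.
exists s; split=> // p /Hs [p1 p2]; split=> //.
apply/augmentation_powerP/IH; exact/augmentation_powerP.
Qed.

Definition trunc_ring (n : nat) : pzRingType :=
  ring_quot (augmentation_power n).

Definition trunc_proj (n : nat) (x : R) : trunc_ring n :=
  \pi_(ring_quot (augmentation_power n)) x.

Definition transition (n : nat) (x : trunc_ring n.+1) : trunc_ring n :=
  trunc_proj n (repr (x : ring_quot (augmentation_power n.+1))).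

Lemma transition_proj n (x : R) : transition (trunc_proj n.+1 x) = trunc_proj n x.
Proof.
apply/rq_eqP/augmentation_power_anti/rq_eqP; exact: reprK.
Qed.

Lemma trunc_projD n x y : trunc_proj n (x + y) = trunc_proj n x + trunc_proj n y.
Proof. exact: pi_rqD. Qed.
Lemma trunc_projM n x y : trunc_proj n (x * y) = trunc_proj n x * trunc_proj n y.
Proof. exact: pi_rqM. Qed.
Lemma trunc_proj1 n : trunc_proj n 1 = 1.
Proof. exact: pi_rq1. Qed.
Lemma trunc_projN n x : trunc_proj n (- x) = - trunc_proj n x.
Proof. exact: (@Quotient.pi_opp R (augmentation_power n)). Qed.

Lemma trunc_projW n (P : trunc_ring n -> Prop) :
  (forall x, P (trunc_proj n x)) -> forall x, P x.
Proof. by move=> H x; rewrite -[x]reprK; exact: H. Qed.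

Definition compatible : {pred seq_prod trunc_ring} :=
  fun x => `[< forall n, transition (x n.+1) = x n >].

Lemma compatible_subring : subring_closed compatible.
Proof.
split.
- apply/asboolP => n; rewrite -[X in transition X]trunc_proj1 transition_proj.
  exact: trunc_proj1.
- move=> x y /asboolP Hx /asboolP Hy; apply/asboolP => n.
  rewrite /GRing.add /= /GRing.opp /= -(Hx n) -(Hy n).
  elim/trunc_projW: (x n.+1) => a; elim/trunc_projW: (y n.+1) => b.
  by rewrite -trunc_projN -trunc_projD !transition_proj trunc_projD trunc_projN.
- move=> x y /asboolP Hx /asboolP Hy; apply/asboolP => n.
  rewrite /GRing.mul /= -(Hx n) -(Hy n).
  elim/trunc_projW: (x n.+1) => a; elim/trunc_projW: (y n.+1) => b.
  by rewrite -trunc_projM !transition_proj trunc_projM.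
Qed.
HB.instance Definition _ :=
  GRing.isSubringClosed.Build _ compatible compatible_subring.

Definition completed_group_ring := {x : seq_prod trunc_ring | x \in compatible}.
HB.instance Definition _ := [isSub of completed_group_ring for val].
HB.instance Definition _ := [Choice of completed_group_ring by <:].
HB.instance Definition _ := GRing.SubChoice_isSubPzRing.Build
  (seq_prod trunc_ring) compatible completed_group_ring compatible_subring.
End AugmentationPowers.

Section QuotientModule.
Variables (V : lmodType rat) (S : set V).

Definition submod_gen : {pred V} := fun v =>
  `[< forall W : {pred V}, submod_closed W -> (forall s, S s -> s \in W) ->
        v \in W >].

Lemma submod_genP v :
  reflect (forall W : {pred V}, submod_closed W ->
             (forall s, S s -> s \in W) -> v \in W) (v \in submod_gen).
Proof. exact: asboolP. Qed.

Lemma submod_gen_closed : submod_closed submod_gen.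
Proof.
split; first by apply/submod_genP => W [].
move=> a x y /submod_genP Hx /submod_genP Hy; apply/submod_genP => W HW HS.
by apply: HW.2; [exact: Hx|exact: Hy].
Qed.

Lemma submod_gen_mem s : S s -> s \in submod_gen.
Proof. by move=> Ss; apply/submod_genP => W _; apply. Qed.

HB.instance Definition _ := GRing.isZmodClosed.Build V submod_gen
  (GRing.submod_closedB submod_gen_closed).

Definition lmod_quot := Quotient.quot submod_gen.
HB.instance Definition _ := GRing.Zmodule.on lmod_quot.
HB.instance Definition _ := EqQuotient.on lmod_quot.

Definition lmod_proj (v : V) : lmod_quot := \pi_lmod_quot v.

Lemma lmod_projP (x y : V) :
  reflect (lmod_proj x = lmod_proj y) (x - y \in submod_gen).
Proof. rewrite Quotient.idealrBE; exact: eqP. Qed.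

Definition lq_scale (a : rat) (x : lmod_quot) : lmod_quot :=
  lmod_proj (a *: repr x).

Lemma lmod_projD x y : lmod_proj (x + y) = lmod_proj x + lmod_proj y.
Proof. exact: (@Quotient.pi_add V submod_gen). Qed.

Lemma lmod_projZ_def a x : lmod_proj (a *: x) = lq_scale a (lmod_proj x).
Proof.
apply/lmod_projP; rewrite -scalerBr -[_ *: _]addr0.
apply: submod_gen_closed.2; last exact: submod_gen_closed.1.
by apply/lmod_projP; rewrite /lmod_proj reprK.
Qed.

Lemma lmod_projW (P : lmod_quot -> Prop) :
  (forall x, P (lmod_proj x)) -> forall x, P x.
Proof. by move=> H x; rewrite -[x]reprK; exact: H. Qed.

Lemma lq_scaleA a b x : lq_scale a (lq_scale b x) = lq_scale (a * b) x.
Proof. by elim/lmod_projW: x => x; rewrite -!lmod_projZ_def scalerA. Qed.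
Lemma lq_scale1 : left_id 1 lq_scale.
Proof. by elim/lmod_projW => x; rewrite -!lmod_projZ_def scale1r. Qed.
Lemma lq_scaleDr : right_distributive lq_scale +%R.
Proof.
move=> a; elim/lmod_projW => x; elim/lmod_projW => y.
by rewrite -lmod_projD -!lmod_projZ_def -lmod_projD scalerDr.
Qed.
Lemma lq_scaleDl x : {morph lq_scale^~ x : a b / a + b}.
Proof.
move=> a b; elim/lmod_projW: x => x.
by rewrite -!lmod_projZ_def -lmod_projD scalerDl.
Qed.

HB.instance Definition _ := GRing.Zmodule_isLmodule.Build rat lmod_quot
  lq_scaleA lq_scale1 lq_scaleDr lq_scaleDl.

Lemma lmod_proj_is_linear : linear lmod_proj.
Proof. by move=> a x y; rewrite lmod_projD lmod_projZ_def. Qed.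
HB.instance Definition _ :=
  GRing.isLinear.Build rat V lmod_quot *:%R lmod_proj lmod_proj_is_linear.

Lemma lmod_proj_lift (W : lmodType rat) (f : {linear V -> W}) :
  (forall s, S s -> f s = 0) ->
  forall x y, lmod_proj x = lmod_proj y -> f x = f y.
Proof.
move=> fS x y /lmod_projP/submod_genP/(_ (fun v => f v == 0)) H.
apply/eqP; rewrite -subr_eq0 -linearB; apply: H => [|s /fS fs].
  split=> [|a v w]; rewrite !unfold_in ?linear0 // linearP => /eqP -> /eqP ->.
  by rewrite scaler0 addr0.
by rewrite unfold_in fs.
Qed.
End QuotientModule.

Section TensorPower.
Variables (H : lmodType rat) (n : nat).

Definition subst_at (u : {ffun 'I_n -> H}) (i : 'I_n) (h : H) :
  {ffun 'I_n -> H} := [ffun j => if j == i then h else u j].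

(* The tensor power of H over Q is the free Q-vector space on n-tuples u of
   elements of H, modulo the relations making u 0 (x) ... (x) u (n-1)
   multilinear. *)
Definition multilinear_relations : set (malg {ffun 'I_n -> H} rat) :=
  [set x | exists (u : {ffun 'I_n -> H}) (i : 'I_n) (a : rat) (h k : H),
     x = basis_elt (subst_at u i (a *: h + k))
         - a *: basis_elt (subst_at u i h) - basis_elt (subst_at u i k)].

Definition tensor_power : lmodType rat := lmod_quot multilinear_relations.

Definition pure_tensor (u : {ffun 'I_n -> H}) : tensor_power :=
  lmod_proj multilinear_relations (basis_elt u).

(* The linear endomorphism u_0 (x) ... (x) u_(n-1) |->
   u_1 (x) ... (x) u_(n-1) (x) u_0; it is computed on representatives, and
   [cyclic_shift_pure] shows that this is well defined. *)
Definition rotate (u : {ffun 'I_n -> H}) : {ffun 'I_n -> H} :=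
  [ffun j => u (ordS j)].

Definition cyclic_shift (t : tensor_power) : tensor_power :=
  free_ext (fun u => pure_tensor (rotate u))
    (repr (t : lmod_quot multilinear_relations)).

Lemma rotate_subst u i h :
  rotate (subst_at u i h) = subst_at (rotate u) (ord_pred i) h.
Proof.
apply/ffunP => j; rewrite !ffunE; congr (if _ then _ else _).
exact: (can2_eq (@ordSK n) (@ord_predK n)).
Qed.

Lemma pure_tensorP u i a h k : pure_tensor (subst_at u i (a *: h + k)) =
  a *: pure_tensor (subst_at u i h) + pure_tensor (subst_at u i k).
Proof.
rewrite /pure_tensor -linearP; apply/lmod_projP/submod_gen_mem.
by exists u, i, a, h, k; rewrite opprD addrA.
Qed.

Lemma cyclic_shift_proj x :
  cyclic_shift (lmod_proj multilinear_relations x) =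
  free_ext (fun u => pure_tensor (rotate u)) x.
Proof.
apply: lmod_proj_lift; last exact: reprK.
move=> _ [u [i [a [h [k ->]]]]]; rewrite !linearB linearZ /=.
by rewrite !free_ext_basis !rotate_subst pure_tensorP addrAC addrK subrr.
Qed.

Lemma cyclic_shift_is_linear : linear cyclic_shift.
Proof.
move=> a; elim/lmod_projW => x; elim/lmod_projW => y.
by rewrite -linearP !cyclic_shift_proj linearP.
Qed.

Lemma cyclic_shift_pure u : cyclic_shift (pure_tensor u) = pure_tensor (rotate u).
Proof. by rewrite /pure_tensor cyclic_shift_proj free_ext_basis. Qed.

(* (H^(x)n)_(Z_n): the class of k in Z_n acts as the k-th iterate of the
   cyclic shift. *)
Definition coinvariant_relations : set tensor_power :=
  [set x | exists (k : nat) (t : tensor_power), x = iter k cyclic_shift t - t].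

Definition cyclic_coinvariants : lmodType rat :=
  lmod_quot coinvariant_relations.
End TensorPower.

Section SingularHomology.
Variables (R : realType) (X : topologicalType).

Definition std_simplex (n : nat) : set 'rV[R]_n.+1 :=
  [set v | (forall i, 0 <= v 0 i) /\ \sum_i v 0 i = 1].

Arguments std_simplex : clear implicits.

Definition singular_simplex (n : nat) : Type :=
  continuousType (std_simplex n) X.
HB.instance Definition _ n := Choice.on (singular_simplex n).

(* The i-th face inclusion inserts a coordinate 0 at position i. *)
Definition insert0 n (i : 'I_n.+2) (v : 'rV[R]_n.+1) : 'rV[R]_n.+2 :=
  \row_j (if unlift i j is Some k then v 0 k else 0).

Fact insert0_simplex n (i : 'I_n.+2) (v : std_simplex n) :
  insert0 i (val v) \in std_simplex n.+1.
Proof.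
case: v => v /= /set_mem [v0 v1]; apply/mem_set; split=> [j|].
  by rewrite mxE; case: unlift.
rewrite -v1 (bigD1_ord i) //= mxE unlift_none add0r.
by apply: eq_bigr => j _; rewrite mxE liftK.
Qed.

Definition face n (i : 'I_n.+2) (v : std_simplex n) : std_simplex n.+1 :=
  exist _ (insert0 i (val v)) (insert0_simplex i v).

Lemma insert0_continuous n (i : 'I_n.+2) : continuous (@insert0 n i).
Proof.
move=> v A [P vP PA].
exists (fun a k => P a (lift i k)) => [a k|w /= wP].
  by have := vP a (lift i k); rewrite mxE liftK (ord1 a).
apply: PA => a j; rewrite mxE; case: unliftP => [k ->|->].
  by have := wP a k; rewrite (ord1 a).
by have := nbhs_singleton (vP a i); rewrite mxE unlift_none.
Qed.

Lemma face_continuous n (i : 'I_n.+2) : continuous (@face n i).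
Proof.
apply: continuous_comp_initial.
suff : continuous (@insert0 n i \o (set_val : std_simplex n -> _)) by [].
move=> v; apply: continuous_comp; last exact: insert0_continuous.
exact: initial_continuous.
Qed.

HB.instance Definition _ n i :=
  isContinuous.Build _ _ (@face n i) (@face_continuous n i).

Definition simplex_face n (s : singular_simplex n.+1) (i : 'I_n.+2) :
  singular_simplex n := s \o @face n i.

Definition boundary n (c : malg (singular_simplex n.+1) rat) :
    malg (singular_simplex n) rat :=
  free_ext (fun s => \sum_(i < n.+2) (-1) ^+ i *: basis_elt (simplex_face s i)) c.

Lemma boundary_is_linear n : linear (@boundary n).
Proof. exact: free_ext_is_linear. Qed.
HB.instance Definition _ n := GRing.isLinear.Build rat
  (malg (singular_simplex n.+1) rat) (malg (singular_simplex n) rat) *:%R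
  (@boundary n) (@boundary_is_linear n).

(* Beware of the shift: [cycles n], [cycle_module n] and [homology_succ n] are in
   homological degree n.+1. *)
Definition cycles n : {pred malg (singular_simplex n.+1) rat} :=
  fun c => boundary c == 0.

Lemma cycles_submod n : GRing.subsemimod_closed (@cycles n).
Proof.
apply: GRing.submod_closed_semi; split=> [|a x y]; rewrite !unfold_in.
  by rewrite linear0.
by move=> /eqP x0 /eqP y0; rewrite linearP /= x0 y0 scaler0 addr0.
Qed.

Definition cycle_module n :=
  {c : malg (singular_simplex n.+1) rat | c \in @cycles n}.
HB.instance Definition _ n := [isSub of cycle_module n for val].
HB.instance Definition _ n := [Choice of cycle_module n by <:].
HB.instance Definition _ n := GRing.SubChoice_isSubLmodule.Build
  rat (malg (singular_simplex n.+1) rat) (@cycles n) (cycle_module n)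
  (@cycles_submod n).

Definition homology_succ n : lmodType rat :=
  lmod_quot [set z : cycle_module n | exists c, val z = boundary c].

Definition H1 : lmodType rat := homology_succ 0.
End SingularHomology.

Lemma paste_continuous (R : realType) (T Y : topologicalType) (u : T -> R)
    (c : R) (a b : T -> Y) :
  continuous u -> continuous a -> continuous b ->
  (forall t, u t = c -> a t = b t) ->
  continuous (fun t => if u t <= c then a t else b t).
Proof.
move=> cu ca cb ab t U /=; case: (ltgtP (u t) c) => utc tU.
- have H : nbhs (u t) [set x | x < c].
    by apply: open_nbhs_nbhs; split=> //; exact: open_lt.
  by move: (ca t _ tU) (cu t _ H); apply: (@filterS2 _ (nbhs t) _) => s /= ? /ltW ->.
- have H : nbhs (u t) [set x | x > c].
    by apply: open_nbhs_nbhs; split=> //; exact: open_gt.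
  by move: (cb t _ tU) (cu t _ H); apply: (@filterS2 _ (nbhs t) _) => s /= ? /lt_geF ->.
- have tU' : nbhs (b t) U by rewrite -ab.
  by move: (ca t _ tU) (cb t _ tU'); apply: (@filterS2 _ (nbhs t) _) => s /=; case: ifP.
Qed.

Section UnitInterval.
Variable R : realType.

Definition unit_interval : Type := `[0, 1]%classic : set R.
HB.instance Definition _ := Topological.on unit_interval.

Fact mem_unit_interval (x : R) : 0 <= x <= 1 -> x \in `[0, 1]%classic.
Proof. by move=> ?; apply/mem_set; rewrite /= in_itv. Qed.

Definition to_interval (x : R) (h : 0 <= x <= 1) : unit_interval :=
  exist _ x (mem_unit_interval h).

Definition real_of (t : unit_interval) : R := set_val t.

Lemma real_ofP (t : unit_interval) : 0 <= real_of t <= 1.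
Proof. by have := set_mem (valP t); rewrite /= in_itv. Qed.

Lemma real_of_inj : injective real_of.
Proof. exact: val_inj. Qed.

Fact clamp_subproof (x : R) : 0 <= Num.max 0 (Num.min 1 x) <= 1.
Proof. by rewrite le_max lexx ge_max ler01 ge_min lexx. Qed.

Definition clamp (x : R) : unit_interval := to_interval (clamp_subproof x).

Lemma real_of_clampE x : real_of (clamp x) = Num.max 0 (Num.min 1 x).
Proof. by []. Qed.

Lemma clampK t : clamp (real_of t) = t.
Proof.
apply: real_of_inj; rewrite real_of_clampE.
case/andP: (real_ofP t) => t0 t1.
by rewrite (min_idPr t1) (max_idPr t0).
Qed.

Lemma real_of_clamp x : 0 <= x <= 1 -> real_of (clamp x) = x.
Proof.
case/andP=> x0 x1; rewrite real_of_clampE.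
by rewrite (min_idPr x1) (max_idPr x0).
Qed.

Lemma clamp_le0 x : x <= 0 -> clamp x = clamp 0.
Proof.
move=> x0; apply: real_of_inj; rewrite !real_of_clampE.
by rewrite (min_idPr (le_trans x0 ler01)) (min_idPr ler01) maxxx (max_idPl x0).
Qed.

Lemma clamp_ge1 x : 1 <= x -> clamp x = clamp 1.
Proof.
move=> x1; apply: real_of_inj; rewrite !real_of_clampE.
by rewrite (min_idPl x1) minxx.
Qed.

Fact zero_one_neq_subproof : clamp 0 != clamp 1.
Proof.
apply/eqP => /(congr1 real_of).
by rewrite !real_of_clamp ?lexx ?ler01 // => /esym/eqP; rewrite oner_eq0.
Qed.

HB.instance Definition _ := isBiPointed.Build unit_interval zero_one_neq_subproof.

Lemma real_of0 : real_of zero = 0.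
Proof. by rewrite real_of_clamp // lexx ler01. Qed.
Lemma real_of1 : real_of one = 1.
Proof. by rewrite real_of_clamp // lexx ler01. Qed.

Lemma real_of_continuous : continuous real_of.
Proof. exact: initial_continuous. Qed.

Lemma clamp_continuous : continuous clamp.
Proof.
apply: continuous_comp_initial => x.
apply: (@continuous_max R R (fun=> 0) (fun x => Num.min 1 x)).
  exact: cst_continuous.
apply: (@continuous_min R R (fun=> 1) id); [exact: cst_continuous|exact: cvg_id].
Qed.
End UnitInterval.

Section FundamentalGroup.
Variables (R : realType) (X : topologicalType) (x0 : X).
Local Notation I := (unit_interval R).

Definition loop := {path I from x0 to x0}.
HB.instance Definition _ := Choice.on loop.
Implicit Types p q r : loop.

(* Homotopy relative to the endpoints; the first variable is the homotopy
   parameter. *)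
Definition homotopic p q : Prop := exists F : I * I -> X,
  [/\ continuous F,
      forall t, F (zero, t) = p t, forall t, F (one, t) = q t &
      forall s, F (s, zero) = x0 /\ F (s, one) = x0].

Definition ext p (x : R) : X := p (clamp x).

Lemma ext_continuous p : continuous (ext p).
Proof.
move=> x; apply: continuous_comp; first exact: clamp_continuous.
exact: cts_fun.
Qed.

Lemma ext_comp_continuous (T : topologicalType) p (f : T -> R) :
  continuous f -> continuous (fun t => ext p (f t)).
Proof.
move=> cf t; apply: (@continuous_comp _ _ _ f (ext p)); first exact: cf.
exact: ext_continuous.
Qed.

Lemma extE p t : ext p (real_of t) = p t.
Proof. by rewrite /ext clampK. Qed.
Lemma ext_le0 p x : x <= 0 -> ext p x = x0.
Proof. by move=> ?; rewrite /ext clamp_le0 // -[clamp 0]/(zero) path_zero. Qed.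
Lemma ext_ge1 p x : 1 <= x -> ext p x = x0.
Proof. by move=> ?; rewrite /ext clamp_ge1 // -[clamp 1]/(one) path_one. Qed.

Definition concat_fun p q (t : I) : X :=
  if real_of t <= 2^-1 then ext p (2 * real_of t)
  else ext q (2 * real_of t - 1).

Definition reverse_fun p (t : I) : X := ext p (1 - real_of t).

Lemma contD (T : topologicalType) (f g : T -> R) :
  continuous f -> continuous g -> continuous (fun t => f t + g t).
Proof. by move=> cf cg t; exact: (@continuousD R R^o T f g t (cf t) (cg t)). Qed.
Lemma contM (T : topologicalType) (f g : T -> R) :
  continuous f -> continuous g -> continuous (fun t => f t * g t).
Proof. by move=> cf cg t; exact: (@continuousM R T f g t (cf t) (cg t)). Qed.
Lemma contB (T : topologicalType) (f g : T -> R) :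
  continuous f -> continuous g -> continuous (fun t => f t - g t).
Proof. by move=> cf cg t; exact: (@continuousB R R^o T f g t (cf t) (cg t)). Qed.
Lemma cont_comp (T U V : topologicalType) (f : T -> U) (g : U -> V) :
  continuous f -> continuous g -> continuous (fun t => g (f t)).
Proof. by move=> cf cg t; exact: (@continuous_comp _ _ _ f g t (cf t) (cg _)). Qed.
Lemma cont_cst (T U : topologicalType) (a : U) : continuous (fun _ : T => a).
Proof. exact: cst_continuous. Qed.
Lemma cont_pair (T U V : topologicalType) (f : T -> U) (g : T -> V) :
  continuous f -> continuous g -> continuous (fun t => (f t, g t)).
Proof. by move=> cf cg t; apply: cvg_pair; [exact: cf|exact: cg]. Qed.

Lemma affine_continuous (T : topologicalType) (f : T -> R) (a b : R) :
  continuous f -> continuous (fun t => a * f t + b).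
Proof.
move=> cf t; apply: (@continuousD R R^o T (fun t => a * f t) (fun=> b)); last first.
  exact: cst_continuous.
by apply: (@continuousM R T (fun=> a) f); [exact: cst_continuous|exact: cf].
Qed.

Lemma continuous_ext (T Y : topologicalType) (f g : T -> Y) :
  f =1 g -> continuous f -> continuous g.
Proof. by move=> /funext ->. Qed.

Lemma concat_continuous p q : continuous (concat_fun p q).
Proof.
apply: paste_continuous.
- exact: real_of_continuous.
- apply: ext_comp_continuous.
  have := affine_continuous (a := 2) (b := 0) (@real_of_continuous R).
  by apply: continuous_ext => t; rewrite addr0.
- apply: ext_comp_continuous.
  exact: (affine_continuous (a := 2) (b := -1) (@real_of_continuous R)).
- move=> t ->; rewrite mulfV ?pnatr_eq0 // subrr ext_ge1 // ext_le0 //.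
Qed.

Lemma concat_zero p q : concat_fun p q zero = x0.
Proof. by rewrite /concat_fun real_of0 invr_ge0 ler0n mulr0 ext_le0. Qed.
Lemma concat_one p q : concat_fun p q one = x0.
Proof.
rewrite /concat_fun real_of1 ifF; first by rewrite ext_ge1 //; lra.
by apply/negbTE; rewrite -ltNge; lra.
Qed.

Lemma reverse_continuous p : continuous (reverse_fun p).
Proof.
apply: ext_comp_continuous.
have := affine_continuous (a := -1) (b := 1) (@real_of_continuous R).
by apply: continuous_ext => t; rewrite mulN1r addrC.
Qed.
Lemma reverse_zero p : reverse_fun p zero = x0.
Proof. by rewrite /reverse_fun real_of0 subr0 ext_ge1. Qed.
Lemma reverse_one p : reverse_fun p one = x0.
Proof. by rewrite /reverse_fun real_of1 subrr ext_le0. Qed.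

Definition concat p q : loop :=
  mk_path (@concat_continuous p q) (concat_zero p q) (concat_one p q).
Definition reverse p : loop :=
  mk_path (@reverse_continuous p) (reverse_zero p) (reverse_one p).
Definition const_loop : loop := cst x0.

Lemma real_of1_continuous : continuous (fun z : I * I => real_of z.1).
Proof.
move=> z; apply: continuous_comp; [exact: cvg_fst|exact: real_of_continuous].
Qed.
Lemma real_of2_continuous : continuous (fun z : I * I => real_of z.2).
Proof.
move=> z; apply: continuous_comp; [exact: cvg_snd|exact: real_of_continuous].
Qed.

Lemma reparam_homotopic (f : loop) p q (phi psi : R -> R) :
  continuous phi -> continuous psi ->
  phi 0 = psi 0 -> phi 1 = psi 1 ->
  (forall t, p t = ext f (phi (real_of t))) ->
  (forall t, q t = ext f (psi (real_of t))) -> homotopic p q.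
Proof.
move=> cphi cpsi e0 e1 Hp Hq.
exists (fun z => ext f ((1 - real_of z.1) * phi (real_of z.2)
                        + real_of z.1 * psi (real_of z.2))); split.
- apply: ext_comp_continuous; apply: contD; apply: contM.
  + by apply: contB; [exact: cont_cst|exact: real_of1_continuous].
  + exact: cont_comp real_of2_continuous cphi.
  + exact: real_of1_continuous.
  + exact: cont_comp real_of2_continuous cpsi.
- by move=> t; rewrite /= real_of0 subr0 mul1r mul0r addr0 Hp.
- by move=> t; rewrite /= real_of1 subrr mul1r mul0r add0r Hq.
- move=> s; rewrite /= real_of0 real_of1 -e0 -e1 -!mulrDl subrK !mul1r.
  by rewrite -{1}real_of0 -real_of1 -!Hp path_zero path_one.
Qed.

Lemma homotopic_refl p : homotopic p p.
Proof.
by apply: (@reparam_homotopic p p p id id) => //; try (by move=> ?; exact: cvg_id);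
  move=> t; rewrite extE.
Qed.

Lemma homotopic_sym p q : homotopic p q -> homotopic q p.
Proof.
move=> [F [cF F0 F1 Fe]].
exists (fun z => F (clamp (1 - real_of z.1), z.2)); split.
- apply: (cont_comp _ cF); apply: cont_pair; last by move=> z; exact: cvg_snd.
  apply: (cont_comp _ (@clamp_continuous R)).
  by apply: contB; [exact: cont_cst|exact: real_of1_continuous].
- by move=> t; rewrite /= real_of0 subr0 -[clamp 1]/(one) F1.
- by move=> t; rewrite /= real_of1 subrr -[clamp 0]/(zero) F0.
- by move=> s /=; exact: Fe.
Qed.

Lemma continuous_affine2 (u : I * I -> R) a b :
  continuous u -> continuous (fun z => clamp (a * u z + b)).
Proof.
move=> cu; apply: (cont_comp _ (@clamp_continuous R)).
exact: affine_continuous.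
Qed.

Lemma homotopic_trans p q r : homotopic p q -> homotopic q r -> homotopic p r.
Proof.
move=> [F [cF F0 F1 Fe]] [G [cG G0 G1 Ge]].
exists (fun z => if real_of z.1 <= 2^-1 then F (clamp (2 * real_of z.1 + 0), z.2)
                 else G (clamp (2 * real_of z.1 + -1), z.2)); split.
- apply: paste_continuous.
  + exact: real_of1_continuous.
  + apply: (cont_comp _ cF); apply: cont_pair; last by move=> z; exact: cvg_snd.
    exact: (continuous_affine2 real_of1_continuous).
  + apply: (cont_comp _ cG); apply: cont_pair; last by move=> z; exact: cvg_snd.
    exact: (continuous_affine2 real_of1_continuous).
  + move=> z ->; rewrite mulfV ?pnatr_eq0 // addr0 subrr.
    by rewrite -[clamp 1]/(one) -[clamp 0]/(zero) F1 G0.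
- move=> t; rewrite /= real_of0 invr_ge0 ler0n mulr0 addr0.
  by rewrite -[clamp 0]/(zero) F0.
- move=> t; rewrite /= real_of1 ifF; last by apply/negbTE; rewrite -ltNge; lra.
  by have -> : 2 * 1 + -1 = 1 :> R by [lra]; rewrite -[clamp 1]/(one) G1.
- by move=> s /=; case: ifP => _; [exact: Fe|exact: Ge].
Qed.

Lemma homotopic_concat p p' q q' :
  homotopic p p' -> homotopic q q' -> homotopic (concat p q) (concat p' q').
Proof.
move=> [F [cF F0 F1 Fe]] [G [cG G0 G1 Ge]].
exists (fun z => if real_of z.2 <= 2^-1 then F (z.1, clamp (2 * real_of z.2 + 0))
                 else G (z.1, clamp (2 * real_of z.2 + -1))); split.
- apply: paste_continuous.
  + exact: real_of2_continuous.
  + apply: (cont_comp _ cF); apply: cont_pair; first by move=> z; exact: cvg_fst.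
    exact: (continuous_affine2 real_of2_continuous).
  + apply: (cont_comp _ cG); apply: cont_pair; first by move=> z; exact: cvg_fst.
    exact: (continuous_affine2 real_of2_continuous).
  + move=> z ->; rewrite mulfV ?pnatr_eq0 // addr0 subrr.
    by rewrite -[clamp 1]/(one) -[clamp 0]/(zero) (Fe _).2 (Ge _).1.
- by move=> t; rewrite /= /concat_fun addr0 F0 G0.
- by move=> t; rewrite /= /concat_fun addr0 F1 G1.
- move=> s /=; rewrite real_of0 real_of1 invr_ge0 ler0n mulr0 addr0; split.
    by rewrite -[clamp 0]/(zero) (Fe _).1.
  rewrite ifF; last by apply/negbTE; rewrite -ltNge; lra.
  by have -> : 2 * 1 + -1 = 1 :> R by [lra]; rewrite -[clamp 1]/(one) (Ge _).2.
Qed.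

Lemma homotopic_reverse p q : homotopic p q -> homotopic (reverse p) (reverse q).
Proof.
move=> [F [cF F0 F1 Fe]].
exists (fun z => F (z.1, clamp (1 - real_of z.2))); split.
- apply: (cont_comp _ cF); apply: cont_pair; first by move=> z; exact: cvg_fst.
  apply: (cont_comp _ (@clamp_continuous R)).
  by apply: contB; [exact: cont_cst|exact: real_of2_continuous].
- by move=> t; rewrite F0.
- by move=> t; rewrite F1.
- move=> s; rewrite /= real_of0 real_of1 subr0 subrr.
  by rewrite -[clamp 1]/(one) -[clamp 0]/(zero) (Fe _).1 (Fe _).2.
Qed.

Lemma continuous_affine (a b : R) : continuous (fun x : R => a * x + b).
Proof. by apply: (@affine_continuous R id) => x; exact: cvg_id. Qed.

Lemma cont_max (f g : R -> R) :
  continuous f -> continuous g -> continuous (fun t => Num.max (f t) (g t)).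
Proof. by move=> cf cg t; exact: (@continuous_max R R f g t (cf t) (cg t)). Qed.

Lemma ext_concat p q x : ext (concat p q) x =
  if x <= 2^-1 then ext p (2 * x) else ext q (2 * x - 1).
Proof.
have [x0'|x0'] := lerP x 0.
  by rewrite ext_le0 // ifT; [rewrite ext_le0 //|]; lra.
have [x1'|x1'] := lerP 1 x.
  by rewrite ext_ge1 // ifF; [rewrite ext_ge1 //; lra|apply/negbTE; rewrite -ltNge; lra].
by rewrite /ext /= /mk_path /= /concat_fun real_of_clamp //; lra.
Qed.

Lemma ext_reverse p x : ext (reverse p) x = ext p (1 - x).
Proof.
have [x0'|x0'] := lerP x 0; first by rewrite ext_le0 // ext_ge1 //; lra.
have [x1'|x1'] := lerP 1 x; first by rewrite ext_ge1 // ext_le0 //; lra.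
by rewrite /ext /= /mk_path /= /reverse_fun real_of_clamp //; lra.
Qed.

Lemma ext_const x : ext const_loop x = x0.
Proof. by []. Qed.

Lemma max3_spec (a b c M : R) : M = Num.max a (Num.max b c) ->
  [\/ [/\ M = a, b <= a & c <= a], [/\ M = b, a <= b & c <= b]
    | [/\ M = c, a <= c & b <= c]].
Proof.
move=> ->; rewrite /Num.max; case: (ltP b c) => h; case: ltP => h'.
- by constructor 3; split=> //; lra.
- by constructor 1; split=> //; lra.
- by constructor 2; split=> //; lra.
- by constructor 1; split=> //; lra.
Qed.

Lemma homotopic_assoc p q r :
  homotopic (concat p (concat q r)) (concat (concat p q) r).
Proof.
pose m (x : R) := Num.max (2^-1 * x + 0) (Num.max (1 * x + - 4^-1) (2 * x + -1)).
apply: (@reparam_homotopic (concat (concat p q) r) _ _ m id).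
- apply: cont_max; first exact: continuous_affine.
  by apply: cont_max; exact: continuous_affine.
- by move=> x; exact: cvg_id.
- by case: (max3_spec (erefl (m 0))) => -[-> ? ?] /=; lra.
- by case: (max3_spec (erefl (m 1))) => -[-> ? ?] /=; lra.
- move=> t; rewrite -[LHS]extE !ext_concat; set x := real_of t.
  have mE : m x = if x <= 2^-1 then 2^-1 * x else
                  if x <= 3 / 4 then x - 4^-1 else 2 * x - 1.
    by case: (max3_spec (erefl (m x))) => -[-> ? ?];
      (case: lerP => ?; [|case: lerP => ?]); lra.
  rewrite mE; have [h1|h1] := lerP x 2^-1.
    by rewrite !ifT; [congr (ext p _)|..]; lra.
  have [h2|h2] := lerP x (3 / 4).
    have -> : 2 * x - 1 <= 2^-1 by lra.
    have -> : x - 4^-1 <= 2^-1 by lra.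
    have /lt_geF -> : 2^-1 < 2 * (x - 4^-1) by lra.
    by congr (ext q _); lra.
  have /lt_geF -> : 2^-1 < 2 * x - 1 by lra.
  by [].
- by move=> t; rewrite extE.
Qed.

Lemma homotopic_concat1 p : homotopic (concat const_loop p) p.
Proof.
apply: (@reparam_homotopic p _ _ (fun x => Num.max 0 (2 * x + -1)) id).
- by apply: cont_max; [exact: cont_cst|exact: continuous_affine].
- by move=> x; exact: cvg_id.
- by rewrite /Num.max; case: ltP => ?; lra.
- by rewrite /Num.max; case: ltP => ?; lra.
- move=> t; rewrite -[LHS]extE ext_concat; set x := real_of t.
  have [h|h] := lerP x 2^-1.
    by rewrite ext_const ext_le0 // /Num.max; case: ltP; lra.
  by congr (ext p _); rewrite /Num.max; case: ltP => ?; lra.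
- by move=> t; rewrite extE.
Qed.

Lemma homotopic_concatr1 p : homotopic (concat p const_loop) p.
Proof.
apply: (@reparam_homotopic p _ _ (fun x => Num.min 1 (2 * x + 0)) id).
- move=> x; apply: (@continuous_min R R (fun=> 1) (fun x => 2 * x + 0)).
    exact: cont_cst.
  exact: continuous_affine.
- by move=> x; exact: cvg_id.
- by rewrite /Num.min; case: ltP => ?; lra.
- by rewrite /Num.min; case: ltP => ?; lra.
- move=> t; rewrite -[LHS]extE ext_concat; set x := real_of t.
  have [h|h] := lerP x 2^-1.
    by congr (ext p _); rewrite /Num.min; case: ltP => ?; lra.
  by rewrite ext_const ext_ge1 // /Num.min; case: ltP => ?; lra.
- by move=> t; rewrite extE.
Qed.

Lemma homotopic_concatV p : homotopic (concat (reverse p) p) const_loop.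
Proof.
apply: (@reparam_homotopic p _ _ (fun x => Num.max (1 + -2 * x) (2 * x + -1)) (fun=> 1)).
- by apply: cont_max; [|exact: continuous_affine]; apply: contD;
    [exact: cont_cst|apply: contM; [exact: cont_cst|move=> x; exact: cvg_id]].
- exact: cont_cst.
- by rewrite /Num.max; case: ltP => ?; lra.
- by rewrite /Num.max; case: ltP => ?; lra.
- move=> t; rewrite -[LHS]extE ext_concat ext_reverse; set x := real_of t.
  by have [h|h] := lerP x 2^-1; congr (ext p _); rewrite /Num.max; case: ltP => ?; lra.
- by move=> t; rewrite ext_ge1.
Qed.

Lemma homotopic_concatrV p : homotopic (concat p (reverse p)) const_loop.
Proof.
apply: (@reparam_homotopic p _ _ (fun x => Num.min (2 * x + 0) (-2 * x + 2)) (fun=> 0)).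
- move=> x; apply: (@continuous_min R R (fun x => 2 * x + 0) (fun x => -2 * x + 2));
    exact: continuous_affine.
- exact: cont_cst.
- by rewrite /Num.min; case: ltP => ?; lra.
- by rewrite /Num.min; case: ltP => ?; lra.
- move=> t; rewrite -[LHS]extE ext_concat ext_reverse; set x := real_of t.
  by have [h|h] := lerP x 2^-1; congr (ext p _); rewrite /Num.min; case: ltP => ?; lra.
- by move=> t; rewrite ext_le0.
Qed.

Definition homotopicb : rel loop := fun p q => `[< homotopic p q >].

Lemma homotopicb_equiv : equiv_class_of homotopicb.
Proof.
split=> [p|p q|q p r]; rewrite /homotopicb.
- by apply/asboolP; exact: homotopic_refl.
- by apply: asbool_equiv_eq; split; exact: homotopic_sym.
- by move=> /asboolP pq /asboolP qr; apply/asboolP; exact: homotopic_trans pq qr.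
Qed.

Canonical homotopic_equiv := EquivRelPack homotopicb_equiv.

Definition pi1 := {eq_quot homotopic_equiv}.
HB.instance Definition _ := EqQuotient.on pi1.
HB.instance Definition _ := Choice.on pi1.

Definition pi1_mul := lift_op2 pi1 concat.
Definition pi1_inv := lift_op1 pi1 reverse.
Definition pi1_one : pi1 := lift_cst pi1 const_loop.

Lemma pi1_eqP p q : homotopic p q -> \pi_pi1 p = \pi_pi1 q.
Proof. by move=> pq; apply/eqmodP; apply/asboolP. Qed.
Lemma homotopic_repr p : homotopic p (repr (\pi_pi1 p)).
Proof. by have /eqmodP/asboolP := esym (reprK (\pi_pi1 p)). Qed.

Lemma pi_pi1_mul : {morph \pi_pi1 : p q / concat p q >-> pi1_mul p q}.
Proof.
move=> p q; unlock pi1_mul; apply: pi1_eqP.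
by apply: homotopic_concat; exact: homotopic_repr.
Qed.
Lemma pi_pi1_inv : {morph \pi_pi1 : p / reverse p >-> pi1_inv p}.
Proof.
move=> p; unlock pi1_inv; apply: pi1_eqP.
by apply: homotopic_reverse; exact: homotopic_repr.
Qed.
Canonical pi_pi1_mul_morph := PiMorph2 pi_pi1_mul.
Canonical pi_pi1_inv_morph := PiMorph1 pi_pi1_inv.
Canonical pi_pi1_one_morph := PiConst pi1_one.

Lemma pi1_mulA : associative pi1_mul.
Proof.
elim/quotW=> p; elim/quotW=> q; elim/quotW=> r; rewrite !piE.
by apply: pi1_eqP; exact: homotopic_assoc.
Qed.
Lemma pi1_mul1 : left_id pi1_one pi1_mul.
Proof.
by elim/quotW=> p; rewrite !piE; apply: pi1_eqP; exact: homotopic_concat1.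
Qed.
Lemma pi1_mulg1 : right_id pi1_one pi1_mul.
Proof.
by elim/quotW=> p; rewrite !piE; apply: pi1_eqP; exact: homotopic_concatr1.
Qed.
Lemma pi1_mulV : left_inverse pi1_one pi1_inv pi1_mul.
Proof.
by elim/quotW=> p; rewrite !piE; apply: pi1_eqP; exact: homotopic_concatV.
Qed.
Lemma pi1_mulgV : right_inverse pi1_one pi1_inv pi1_mul.
Proof.
by elim/quotW=> p; rewrite !piE; apply: pi1_eqP; exact: homotopic_concatrV.
Qed.

HB.instance Definition _ := isGroup.Build pi1
  pi1_mulA pi1_mul1 pi1_mulg1 pi1_mulV pi1_mulgV.
End FundamentalGroup.

Definition homeomorphic (X Y : topologicalType) : Prop :=
  exists (f : X -> Y) (g : Y -> X),
    [/\ continuous f, continuous g, cancel f g & cancel g f].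

Section SurfaceModel.
Variables (R : realType) (g : nat).

(* A rectangle whose bottom edge [0, 4g+1] x {0} is divided into the 4g+1
   segments [k, k+1] x {0}. *)
Definition polygon : set (R * R) :=
  [set p | 0 <= p.1 <= (4 * g + 1)%:R /\ 0 <= p.2 <= 1].

(* The segments are read as the word
     a_0 b_0 a_0^-1 b_0^-1 ... a_(g-1) b_(g-1) a_(g-1)^-1 b_(g-1)^-1 c :
   segment 4i is glued to segment 4i+2, and 4i+1 to 4i+3, with orientation
   reversed.  The last segment c and the three other edges of the rectangle
   are free; together they form the boundary circle. *)
Definition side_pairing (p q : R * R) : Prop :=
  exists (i : nat) (t : R), [/\ (i < g)%N, 0 <= t <= 1 &
    (p = ((4 * i)%:R + t, 0) /\ q = ((4 * i + 2)%:R + (1 - t), 0)) \/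
    (p = ((4 * i + 1)%:R + t, 0) /\ q = ((4 * i + 3)%:R + (1 - t), 0))].

Inductive glued : polygon -> polygon -> Prop :=
| glued_pair p q of side_pairing (set_val p) (set_val q) : glued p q
| glued_refl p : glued p p
| glued_sym p q of glued p q : glued q p
| glued_trans p q r of glued p q & glued q r : glued p r.

Definition gluedb : rel polygon := fun p q => `[< glued p q >].

Lemma gluedb_equiv : equiv_class_of gluedb.
Proof.
split=> [p|p q|q p r]; rewrite /gluedb.
- by apply/asboolP; exact: glued_refl.
- by apply: asbool_equiv_eq; split; exact: glued_sym.
- by move=> /asboolP pq /asboolP qr; apply/asboolP; exact: glued_trans pq qr.
Qed.
Canonical glued_equiv := EquivRelPack gluedb_equiv.

Definition surface_model : topologicalType :=
  quotient_topology {eq_quot glued_equiv}.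
End SurfaceModel.

(* The polygonal normal form with word [a_0, b_0] ... [a_(g-1), b_(g-1)] c is a
   connected sum of g tori minus an open disc; a compact connected oriented
   surface of genus g with one boundary component is a space homeomorphic to it
   (for g = 0, a closed disc).  No choice of orientation enters the data. *)
Definition is_surface_genus_one_boundary (R : realType) (g : nat)
    (S : topologicalType) : Prop :=
  homeomorphic S (surface_model R g).

(* Main.v *)
(* By polygonal gluing the surface deforms onto a wedge of 2g circles, so pi_1 is free on
   J = {a_i, b_i} and H_1 has basis J: both follow from the holonomy of paths with values in
   a group G, which is defined by a locally constant cocycle on a cover and is homotopy
   invariant.  The Magnus expansion g_j |-> 1 + X_j then identifies the completed group ring
   with the ring N of noncommutative power series over Q in the letters J.

   For N, Gaussian elimination over the local ring N reduces every class in K_1 to a 1 x 1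
   unit.  The invariants of A are det A(0) in Q^* and, in each degree n >= 1, the cyclic class
   of tr (A^-1 E(A)), where E is the Euler derivation multiplying words by their length: this
   replaces log det and is additive.  Surjectivity follows by solving E(u) = u e.  For
   injectivity, a unit u with u(0) = 1 whose invariants vanish is a product over j of
   commutators [1 + X_j, 1 + z_j]: a series whose cyclic classes vanish is a sum of
   additive commutators [X_j, z_j], and a contracting fixpoint removes the higher order
   error. *)
Require Import Defs.
From HB Require Import structures.
From mathcomp Require Import all_boot all_order all_algebra zify ring lra.
From mathcomp.multinomials Require Import -(notations) monalg.
From mathcomp Require Import finmap all_classical reals interval_inference topology
  normedtype homotopy.
From Stdlib Require Setoid Morphisms.

Set Implicit Arguments.
Unset Strict Implicit.
Unset Printing Implicit Defensive.

Import Order.TTheory GRing.Theory Num.Theory numFieldNormedType.Exports.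

Local Open Scope classical_set_scope.
Local Open Scope ring_scope.

(** * Noncommutative power series *)

(** [K1] is taken of the abstract ring, so a mere limit of products of commutators need not be
    trivial in it. Correcting degree by degree would produce an infinite product; instead one
    product with a single commutator per letter has to realise every unit with trivial invariants.
    The corrections of all degrees are therefore absorbed at once into the arguments [z j], and
    these come from one contraction for the degree filtration. The Leibniz rule makes u^-1 E(u)
    additive under any trace, and since E multiplies degree n by n, which is invertible in Q for n
    >= 1, no information is lost. On the topological side freeness splits into two halves:
    generation comes from cutting loops into pieces, and extension from a holonomy that takes
    arbitrary prescribed values on the circles. The same holonomy with values in Q gives the
    coordinates on H_1. The delicate point is the vertex, where all half edges meet: the deformation
    flattens the outer thirds of every circle, so that a whole open neighbourhood of the vertex is
    sent to one point. *)

Definition ncps (J : finType) : Type := seq J -> rat.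

Section PowerSeries.
Variable J : finType.
Local Notation N := (ncps J).
Implicit Types (f g h : N) (w : seq J).

HB.instance Definition _ := gen_eqMixin N.
HB.instance Definition _ := gen_choiceMixin N.

Lemma ncpsP f g : (forall w, f w = g w) -> f = g.
Proof. exact: functional_extensionality_dep. Qed.

Let add f g : N := fun w => f w + g w.
Let opp f : N := fun w => - f w.
Let zero : N := fun _ => 0.
Let addA : associative add.
Proof. by move=> f g h; apply: ncpsP => w; exact: addrA. Qed.
Let addC : commutative add.
Proof. by move=> f g; apply: ncpsP => w; exact: addrC. Qed.
Let add0 : left_id zero add.
Proof. by move=> f; apply: ncpsP => w; exact: add0r. Qed.
Let addN : left_inverse zero opp add.
Proof. by move=> f; apply: ncpsP => w; exact: addNr. Qed.
HB.instance Definition _ := GRing.isZmodule.Build N addA addC add0 addN.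

Let scale (a : rat) f : N := fun w => a * f w.
Let scaleA a b f : scale a (scale b f) = scale (a * b) f.
Proof. by apply: ncpsP => w; exact: mulrA. Qed.
Let scale1 : left_id 1 scale.
Proof. by move=> f; apply: ncpsP => w; exact: mul1r. Qed.
Let scaleDr : right_distributive scale +%R.
Proof. by move=> a f g; apply: ncpsP => w; exact: mulrDr. Qed.
Let scaleDl f : {morph scale^~ f : a b / a + b}.
Proof. by move=> a b; apply: ncpsP => w; exact: mulrDl. Qed.
HB.instance Definition _ := GRing.Zmodule_isLmodule.Build rat N
  scaleA scale1 scaleDr scaleDl.

Lemma ncpsDE f g w : (f + g) w = f w + g w. Proof. by []. Qed.
Lemma ncpsNE f w : (- f) w = - f w. Proof. by []. Qed.
Lemma ncpsZE a f w : (a *: f) w = a * f w. Proof. by []. Qed.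
Lemma ncps_sumE (I : Type) (r : seq I) (P : pred I) (F : I -> N) w :
  (\sum_(i <- r | P i) F i) w = \sum_(i <- r | P i) F i w.
Proof. by elim/big_rec2: _ => // i x y _ <-. Qed.

(** The left derivative by the letter [j]: a series is its constant term plus the sum over [j] of
    X_j times these. It supports inductions on the first letter of a word. *)
Definition coef_at j f : N := fun w => f (j :: w).

Definition conv f g : N := fun w =>
  \sum_(k < (size w).+1) f (take k w) * g (drop k w).

Lemma conv_nil f g : conv f g [::] = f [::] * g [::].
Proof. by rewrite /conv big_ord1. Qed.
Lemma conv_cons f g j w :
  conv f g (j :: w) = f [::] * g (j :: w) + conv (coef_at j f) g w.
Proof. by rewrite /conv /= big_ord_recl. Qed.

Lemma convDl : left_distributive conv +%R.
Proof.
move=> f g h; apply: ncpsP => w; rewrite ncpsDE /conv -big_split /=.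
by apply: eq_bigr => k _; exact: mulrDl.
Qed.
Lemma convDr : right_distributive conv +%R.
Proof.
move=> f g h; apply: ncpsP => w; rewrite ncpsDE /conv -big_split /=.
by apply: eq_bigr => k _; exact: mulrDr.
Qed.
Lemma convZl a f g : conv (a *: f) g = a *: conv f g.
Proof.
apply: ncpsP => w; rewrite ncpsZE /conv mulr_sumr /=.
by apply: eq_bigr => k _; rewrite mulrA.
Qed.
Lemma convZr a f g : conv f (a *: g) = a *: conv f g.
Proof.
apply: ncpsP => w; rewrite ncpsZE /conv mulr_sumr /=.
by apply: eq_bigr => k _; rewrite mulrCA.
Qed.

Lemma coef_at_conv j f g :
  coef_at j (conv f g) = f [::] *: coef_at j g + conv (coef_at j f) g.
Proof. by apply: ncpsP => w; rewrite /coef_at conv_cons. Qed.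

Lemma convA : associative conv.
Proof.
move=> f g h; apply: ncpsP => w.
elim: w f g => [|j w IH] f g; first by rewrite !conv_nil mulrA.
rewrite !conv_cons IH coef_at_conv convDl convZl conv_nil.
by rewrite ncpsDE ncpsZE mulrDr -!addrA mulrA.
Qed.

Definition nc_one : N := fun w => (w == [::])%:R.
Lemma conv1 : left_id nc_one conv.
Proof.
move=> f; apply: ncpsP => -[|j w]; rewrite ?conv_nil ?conv_cons /nc_one ?eqxx !mul1r //.
by rewrite -[RHS]addr0; congr (_ + _); rewrite /conv big1 // => k _; exact: mul0r.
Qed.
Lemma convr1 : right_id nc_one conv.
Proof.
move=> f; apply: ncpsP => w; elim: w f => [|j w IH] f.
  by rewrite conv_nil /nc_one eqxx mulr1.
by rewrite conv_cons IH /nc_one mulr0 add0r.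
Qed.
Lemma nc_one_neq0 : nc_one != 0.
Proof. by apply/eqP => /(congr1 (fun f : N => f [::])). Qed.

HB.instance Definition _ := GRing.Zmodule_isNzRing.Build N
  convA conv1 convr1 convDl convDr nc_one_neq0.
Lemma nc_scaleAl (a : rat) f g : a *: (f * g) = (a *: f) * g.
Proof. exact: (esym (convZl a f g)). Qed.
HB.instance Definition _ := GRing.Lmodule_isLalgebra.Build rat N nc_scaleAl.
Lemma nc_scaleAr (a : rat) f g : a *: (f * g) = f * (a *: g).
Proof. exact: (esym (convZr a f g)). Qed.
HB.instance Definition _ := GRing.Lalgebra_isAlgebra.Build rat N nc_scaleAr.

Lemma ncpsME f g w :
  (f * g) w = \sum_(k < (size w).+1) f (take k w) * g (drop k w).
Proof. by []. Qed.
Lemma ncps1E w : (1 : N) w = (w == [::])%:R. Proof. by []. Qed.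
Lemma ncpsM_nil f g : (f * g) [::] = f [::] * g [::].
Proof. exact: conv_nil. Qed.
Lemma ncpsM_cons f g j w :
  (f * g) (j :: w) = f [::] * g (j :: w) + (coef_at j f * g) w.
Proof. exact: conv_cons. Qed.

Definition nc_var j : N := fun w => (w == [:: j])%:R.
Lemma nc_varM_nil j f : (nc_var j * f) [::] = 0.
Proof. by rewrite ncpsM_nil mul0r. Qed.
Lemma nc_varM_cons j f i w : (nc_var j * f) (i :: w) = (i == j)%:R * f w.
Proof.
rewrite ncpsM_cons mul0r add0r.
have -> : coef_at i (nc_var j) = (i == j)%:R *: 1.
  apply: ncpsP => v; rewrite /coef_at /nc_var ncpsZE ncps1E eqseq_cons.
  by rewrite -natrM mulnb.
by rewrite -scalerAl mul1r ncpsZE.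
Qed.
Lemma ncM_var_rcons j f i w : (f * nc_var j) (rcons w i) = (i == j)%:R * f w.
Proof.
elim: w f => [|a w IH] f.
  rewrite /= ncpsM_cons ncpsM_nil mulr0 addr0 /nc_var eqseq_cons eqxx andbT.
  by rewrite mulrC.
rewrite rcons_cons ncpsM_cons IH /nc_var.
by rewrite eqseq_cons -cats1; case: w {IH} => [|? ?]; rewrite andbF mulr0 add0r.
Qed.

(* [vanish n f]: f lies in the n-th power of the ideal of series without
   constant term. *)
Definition vanish n f : Prop := forall w, (size w < n)%N -> f w = 0.

Lemma vanish_all f : vanish 0 f. Proof. by []. Qed.
Lemma vanishW m n f : (m <= n)%N -> vanish n f -> vanish m f.
Proof. by move=> mn Hf w wm; apply: Hf; exact: leq_trans mn. Qed.
Lemma vanish1 f : f [::] = 0 -> vanish 1 f.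
Proof. by move=> f0 [|? ?]. Qed.
Lemma vanishD n f g : vanish n f -> vanish n g -> vanish n (f + g).
Proof. by move=> Hf Hg w wn; rewrite ncpsDE Hf // Hg // addr0. Qed.
Lemma vanishN n f : vanish n f -> vanish n (- f).
Proof. by move=> Hf w wn; rewrite ncpsNE Hf // oppr0. Qed.
Lemma vanishB n f g : vanish n f -> vanish n g -> vanish n (f - g).
Proof. by move=> Hf Hg; apply: vanishD => //; exact: vanishN. Qed.
Lemma vanish_sum n (I : Type) (r : seq I) (F : I -> N) :
  (forall i, vanish n (F i)) -> vanish n (\sum_(i <- r) F i).
Proof. by move=> HF; apply: big_ind => //; exact: vanishD. Qed.
Lemma vanishM m n f g : vanish m f -> vanish n g -> vanish (m + n) (f * g).
Proof.
move=> Hf Hg w wmn; rewrite ncpsME big1 // => k _.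
have [km|mk] := ltnP k m.
  by rewrite Hf ?mul0r // size_take; case: ifP => // /negbT; rewrite -leqNgt => /leq_ltn_trans; apply.
rewrite Hg ?mulr0 // size_drop ltn_subLR; last by rewrite -ltnS.
exact: leq_trans wmn (leq_add _ _).
Qed.
Lemma vanishMl n f g : vanish n g -> vanish n (f * g).
Proof. by move=> /(vanishM (vanish_all f)). Qed.
Lemma vanishMr n f g : vanish n f -> vanish n (f * g).
Proof. by move=> /vanishM/(_ (vanish_all g)); rewrite addn0. Qed.
Lemma vanish_eq0 f : (forall n, vanish n f) -> f = 0.
Proof. by move=> Hf; apply: ncpsP => w; apply: (Hf (size w).+1). Qed.
Lemma vanish_subC n f g : vanish n (f - g) -> vanish n (g - f).
Proof. by move=> H; rewrite -opprB; exact: vanishN. Qed.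
Lemma vanish_trans n f g h : vanish n (f - g) -> vanish n (g - h) -> vanish n (f - h).
Proof. by move=> H1 H2; have -> : f - h = (f - g) + (g - h) by [rewrite addrA subrK]; exact: vanishD. Qed.
Lemma vanish_subE n f g w : vanish n (f - g) -> (size w < n)%N -> f w = g w.
Proof. by move=> H wn; apply/eqP; rewrite -subr_eq0; apply/eqP; exact: H. Qed.

Definition contracting (F : N -> N) : Prop :=
  forall n f g, vanish n (f - g) -> vanish n.+1 (F f - F g).

(** Completeness for the degree filtration. All iterates from the n-th on agree below degree n,
    because [vanish 0] always holds; so the coefficient at [w] is settled after [(size w).+1]
    iterations. *)
Lemma contracting_fixpoint F : contracting F -> exists f, F f = f.
Proof.
move=> cF; pose u : N := fun w => iter (size w).+1 F 0 w; exists u.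
have H n k : vanish n (iter (n + k) F 0 - iter n F 0).
  by elim: n => //= n IH; exact: cF.
have Hu n : vanish n (u - iter n F 0).
  move=> w wn; rewrite ncpsDE ncpsNE; apply/eqP; rewrite subr_eq0; apply/eqP.
  rewrite /u -(subnK wn) addnC; apply/esym/vanish_subE; [exact: H|exact: ltnSn].
apply/eqP; rewrite -subr_eq0; apply/eqP/vanish_eq0 => n.
apply: (@vanishW _ n.+1) => //; apply: (@vanish_trans _ _ (iter n.+1 F 0)).
  by apply: cF; exact: Hu.
apply: vanish_subC; exact: Hu.
Qed.

(** A chosen two-sided inverse, with default value 0; [nc_invP] justifies it for constant term 1. *)
Definition nc_inv f : N := xget 0 [set g | f * g = 1 /\ g * f = 1].

Lemma nc_invP f : f [::] = 1 -> f * nc_inv f = 1 /\ nc_inv f * f = 1.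
Proof.
move=> f1; have v1f : vanish 1 (1 - f).
  by apply: vanish1; rewrite ncpsDE ncpsNE f1 ncps1E subrr.
(* The geometric series of 1 - f as a fixpoint: [g] is a right inverse of [f], [h] below a left
   inverse, hence they coincide. *)
have [g gE] : exists g, 1 + (1 - f) * g = g.
  apply: contracting_fixpoint => n g h gh.
  by rewrite opprD addrACA subrr add0r -mulrBr -add1n; exact: vanishM.
have [h hE] : exists h, 1 + h * (1 - f) = h.
  apply: contracting_fixpoint => n g' h gh.
  by rewrite opprD addrACA subrr add0r -mulrBl -addn1; exact: vanishM.
have fg : f * g = 1.
  by apply: (@addIr _ ((1 - f) * g)); rewrite -mulrDl addrC subrK mul1r gE.
have hf : h * f = 1.
  by apply: (@addIr _ (h * (1 - f))); rewrite -mulrDr addrC subrK mulr1 hE.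
have gh : g = h by rewrite -[g]mul1r -hf -mulrA fg mulr1.
by apply: (@xgetPex _ 0 [set g | f * g = 1 /\ g * f = 1]); exists g; split=> //; rewrite gh.
Qed.
Lemma nc_mulV f : f [::] = 1 -> f * nc_inv f = 1.
Proof. by move=> /nc_invP[]. Qed.
Lemma nc_mulVl f : f [::] = 1 -> nc_inv f * f = 1.
Proof. by move=> /nc_invP[]. Qed.
Lemma nc_inv_nil f : f [::] = 1 -> nc_inv f [::] = 1.
Proof.
move=> f1; have := congr1 (fun g : N => g [::]) (nc_mulV f1).
by rewrite ncpsM_nil f1 mul1r.
Qed.

Lemma nc_unit f : f [::] != 0 -> exists g, f * g = 1 /\ g * f = 1.
Proof.
move=> f0; pose c := f [::]; pose f' := c^-1 *: f.
have f'1 : f' [::] = 1 by rewrite /f' ncpsZE mulVf.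
have fE : f = c *: f' by rewrite /f' scalerA divff // scale1r.
exists (c^-1 *: nc_inv f'); rewrite fE.
by split; rewrite -scalerAl -scalerAr scalerA ?divff ?mulVf // scale1r ?nc_mulV ?nc_mulVl.
Qed.

Definition euler f : N := fun w => (size w)%:R * f w.
Lemma eulerD : {morph euler : f g / f + g}.
Proof. by move=> f g; apply: ncpsP => w; exact: mulrDr. Qed.
Lemma eulerM f g : euler (f * g) = euler f * g + f * euler g.
Proof.
apply: ncpsP => w; rewrite ncpsDE !ncpsME /euler ncpsME mulr_sumr -big_split /=.
apply: eq_bigr => k _; rewrite size_drop size_takel; last by rewrite -ltnS.
rewrite natrB; last by rewrite -ltnS.
by ring.
Qed.
Lemma euler1 : euler 1 = 0.
Proof. by apply: ncpsP => -[|j w]; rewrite /euler /= ?mul0r // mulr0. Qed.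
Lemma euler0 : euler 0 = 0.
Proof. by apply: ncpsP => w; exact: mulr0. Qed.
Lemma vanish_euler n f : vanish n f -> vanish n (euler f).
Proof. by move=> Hf w wn; rewrite /euler Hf // mulr0. Qed.

(* The logarithmic derivative u^-1 E(u), E the Euler derivation, can be prescribed. *)
Lemma euler_solve (s : N) : s [::] = 0 -> exists2 u : N, u [::] = 1 & euler u = u * s.
Proof.
move=> s0.
(* The equation E(u) = u s divided by the degree. On the empty word the inverse of 0 is 0, so only
   the constant 1 remains. As [s] has no constant term, multiplication by it raises the order by
   one. *)
pose F (u : N) := (1 : N) + ((fun w => (size w)%:R^-1 * (u * s) w) : N).
have cF : contracting F.
  move=> n f g fg; rewrite /F opprD addrACA subrr add0r => w wn.
  rewrite ncpsDE ncpsNE -mulrBr.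
  have := vanishM fg (vanish1 s0); rewrite mulrBl addn1 => /(_ w wn).
  by rewrite ncpsDE ncpsNE => ->; rewrite mulr0.
have [u uE] := contracting_fixpoint cF.
exists u; first by rewrite -uE /F ncpsDE /= invr0 mul0r addr0.
apply: ncpsP => -[|j w]; first by rewrite [RHS]ncpsM_nil s0 mulr0 /euler /= mul0r.
rewrite /euler -[in LHS]uE [F _ _]ncpsDE ncps1E add0r mulrA divff ?mul1r //.
by rewrite pnatr_eq0.
Qed.
End PowerSeries.

(** * Cyclic rotations of words and products of commutators *)

Section Rotations.
Variable J : finType.
Local Notation N := (ncps J).
Implicit Types (f g e u : N) (w : seq J) (z : J -> N) (j : J).

Definition rotsum f w : rat := \sum_(k < size w) f (rotr k w).

Lemma rotr_rotr1 k w : (k < size w)%N -> rotr k (rotr 1 w) = rotr k.+1 w.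
Proof.
move=> kw; rewrite /rotr size_rot.
rewrite rot_add_mod; [|exact: leq_subr..]; case: ifP => h; last by congr (rot _ _); lia.
have -> : (size w - k + (size w - 1) = size w)%N by lia.
by have -> : (size w - k.+1 = 0)%N by [lia]; rewrite rot0 rot_size.
Qed.

Lemma rotr_size w : rotr (size w) w = w.
Proof. by rewrite /rotr subnn rot0. Qed.

Lemma sum_rotrS f w : \sum_(k < size w) f (rotr k.+1 w) = rotsum f w.
Proof.
rewrite /rotsum; case E : (size w) => [|n]; first by rewrite !big_ord0.
by rewrite big_ord_recr big_ord_recl /= -E rotr_size addrC /rotr subn0 rot_size.
Qed.

Lemma rotsum_rotr1 f w : rotsum f (rotr 1 w) = rotsum f w.
Proof.
rewrite -[RHS]sum_rotrS /rotsum size_rotr; apply: eq_bigr => k _.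
by rewrite rotr_rotr1.
Qed.

Lemma rotsum_rotr f k w : (k <= size w)%N -> rotsum f (rotr k w) = rotsum f w.
Proof.
elim: k => [|k IH] kw; first by rewrite /rotr subn0 rot_size.
have -> : rotr k.+1 w = rotr 1 (rotr k w).
  rewrite /rotr size_rot rot_add_mod; [|exact: leq_subr..].
  case: ifP => h; last by congr (rot _ _); lia.
  have -> : (size w - 1 + (size w - k) = size w)%N by lia.
  by have -> : (size w - k.+1 = 0)%N by [lia]; rewrite rot0 rot_size.
by rewrite rotsum_rotr1 IH // ltnW.
Qed.

(* Up to sign, averaging the rotations of [e] with weights 0, 1, ..., n - 1 inverts
   the operator 1 - (cyclic shift) on words of length n. *)
Definition commutator_potential e j : N := fun w =>
  - (size w).+1%:R^-1 * \sum_(k < (size w).+1) k%:R * e (rotr k (j :: w)).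
Local Notation pot := commutator_potential.

Definition ad_sum z : N := \sum_j (nc_var j * z j - z j * nc_var j).

Lemma pot_nil e j : pot e j [::] = 0.
Proof. by rewrite /pot big_ord1 mul0r mulr0. Qed.

(** In the sum over [j] only the first letter of [w] contributes to X_j z_j and only the last one to
    z_j X_j, which leaves [Z w - Z (rotr 1 w)]. Shifting the index in the weighted sum then yields
    [e w] minus the mean of [e] over the rotations of [w]. *)
Lemma ad_sum_pot e w : w != [::] ->
  ad_sum (pot e) w = e w - (size w)%:R^-1 * rotsum e w.
Proof.
move=> w0.
pose Z v : rat := - (size v)%:R^-1 * \sum_(k < size v) k%:R * e (rotr k v).
have ZE j v : pot e j v = Z (j :: v) by [].
have adE : ad_sum (pot e) w = Z w - Z (rotr 1 w).
  rewrite /ad_sum ncps_sumE big_split /=; congr (_ + _).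
    case: w w0 => // j v _; rewrite (bigD1 j) //= nc_varM_cons eqxx mul1r ZE.
    by rewrite big1 ?addr0 // => i /negPf ij; rewrite nc_varM_cons eq_sym ij mul0r.
  case/lastP: w w0 => // v j _; rewrite rotr1_rcons (bigD1 j) //= ncpsNE.
  rewrite ncM_var_rcons eqxx mul1r ZE big1 ?addr0 // => i /negPf ij.
  by rewrite ncpsNE ncM_var_rcons eq_sym ij mul0r oppr0.
rewrite adE /Z size_rotr.
under [X in _ - _ * X]eq_bigr => k _ do rewrite rotr_rotr1 //.
set n := size w; set S := \sum_(k < n) _.
have nz : n%:R != 0 :> rat by rewrite pnatr_eq0 size_eq0.
have -> : \sum_(k < n) k%:R * e (rotr k.+1 w) = S + n%:R * e w - rotsum e w.
  have <- : \sum_(k < n) (k.+1)%:R * e (rotr k.+1 w) = S + n%:R * e w.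
    rewrite -[e w](congr1 e (rotr_size w)) -/n /S.
    rewrite -(big_ord_recr n (fun k => k%:R * e (rotr k w))) big_ord_recl /=.
    by rewrite mul0r add0r.
  rewrite -sum_rotrS -sumrB; apply: eq_bigr => k _.
  by rewrite -natr1 mulrDl mul1r addrK.
by field.
Qed.

(** One degree is lost because the potential at [w] reads [e] on words that are one letter
    longer. *)
Lemma vanish_pot n e e' j : vanish n (e - e') -> vanish n.-1 (pot e j - pot e' j).
Proof.
move=> H w wn; rewrite ncpsDE ncpsNE /pot; apply/eqP; rewrite subr_eq0; apply/eqP.
congr (_ * _); apply: eq_bigr => k _; congr (_ * _).
by apply: (vanish_subE H); rewrite size_rotr /=; case: n wn {H}.
Qed.

Definition nc_comm f g : N := f * g * nc_inv f * nc_inv g.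
Definition comm_prod z : N := \prod_j nc_comm (1 + nc_var j) (1 + z j).

Lemma add1_nil f : f [::] = 0 -> (1 + f : N) [::] = 1.
Proof. by move=> f0; rewrite ncpsDE f0 addr0. Qed.
Lemma var1_nil j : (1 + nc_var j : N) [::] = 1.
Proof. exact: add1_nil. Qed.

Lemma nc_commE f g : f [::] = 1 -> g [::] = 1 ->
  nc_comm f g = 1 + (f * g - g * f) * nc_inv f * nc_inv g.
Proof.
move=> f1 g1; rewrite !mulrBl /nc_comm -(mulrA g f) nc_mulV // mulr1 nc_mulV //.
by rewrite addrC subrK.
Qed.

Lemma ad_add1 f g : (1 + f : N) * (1 + g) - (1 + g) * (1 + f) = f * g - g * f.
Proof.
have H h k : (1 + h : N) * (1 + k) = 1 + h + k + h * k.
  by rewrite mulrDr mulr1 mulrDl mul1r addrA.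
by rewrite !H [1 + g + f]addrAC opprD addrACA subrr add0r.
Qed.

Local Ltac nc_zmod :=
  repeat match goal with
  | |- context [@GRing.mul ?R ?x ?y] => move: (@GRing.mul R x y) => ?
  | |- context [comm_prod ?z] => move: (comm_prod z) => ?
  | |- context [ad_sum ?z] => move: (ad_sum z) => ?
  end; apply: ncpsP => ?; rewrite ?(ncpsDE, ncpsNE); ring.

Lemma vanish_comm m n f g : vanish m f -> vanish n g -> vanish (m + n) (f * g - g * f).
Proof. by move=> Hf Hg; apply: vanishB; [|rewrite addnC]; exact: vanishM. Qed.

Lemma vanish_var j : vanish 1 (nc_var j).
Proof. exact: vanish1. Qed.

Lemma vanish_nc_inv n f g : f [::] = 1 -> g [::] = 1 ->
  vanish n (f - g) -> vanish n (nc_inv f - nc_inv g).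
Proof.
move=> f1 g1 H.
have -> : nc_inv f - nc_inv g = - (nc_inv f * (f - g) * nc_inv g).
  by rewrite mulrBr mulrBl nc_mulVl // mul1r -mulrA nc_mulV // mulr1 opprB.
by apply/vanishN/vanishMr/vanishMl.
Qed.

(** The group commutator linearises to the ring commutator with X_j. In f g f^-1 g^-1 = 1 + [f, g]
    f^-1 g^-1 both errors have order n + 2: the change of [X_j, y] has order n + 1 and meets a
    factor without constant term, and the change of the inverse has order n and meets [X_j, y], of
    order 2. *)
Lemma nc_comm_diff n j (y y' : N) : y [::] = 0 -> y' [::] = 0 -> vanish n (y' - y) ->
  vanish n.+2 (nc_comm (1 + nc_var j) (1 + y') - nc_comm (1 + nc_var j) (1 + y)
     - (nc_var j * (y' - y) - (y' - y) * nc_var j)).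
Proof.
move=> y0 y'0 H; have x1 := var1_nil j.
have [b1 b'1] := (add1_nil y0, add1_nil y'0).
rewrite !nc_commE // !ad_add1.
set a := nc_inv (1 + nc_var j); set b := nc_inv (1 + y); set b' := nc_inv (1 + y').
set x := nc_var j; set d := y' - y.
pose c := x * y - y * x; pose e := x * d - d * x.
have -> : x * y' - y' * x = c + e.
  rewrite /c /e addrACA -opprD -mulrDr -mulrDl.
  by have -> : y + d = y' by rewrite addrC subrK.
rewrite -/c -/e.
have -> : 1 + (c + e) * a * b' - (1 + c * a * b) - e = e * (a * b' - 1) + c * a * (b' - b).
  move: c e => c e; rewrite !mulrDl !mulrDr !mulrN mulr1 !mulrA; nc_zmod.
apply: vanishD.
  have : vanish (1 + n + 1) (e * (a * b' - 1)); last by rewrite addn1 add1n.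
  apply: vanishM; first exact: vanish_comm (vanish_var j) H.
  by apply: vanish1; rewrite ncpsDE ncpsM_nil /a /b' !nc_inv_nil // mulr1 subrr.
have : vanish (2 + n) (c * a * (b' - b)); last by rewrite add2n.
apply: vanishM; first by apply: vanishMr; apply: (@vanish_comm 1 1); exact: vanish1.
apply: vanish_nc_inv => //.
by have -> : (1 + y' : N) - (1 + y) = y' - y by rewrite opprD addrACA subrr add0r.
Qed.

(** A perturbation of order n + 1 of one factor passes through the others unchanged up to order n +
    2, because these are 1 plus terms of positive degree. So perturbations of a product add up. *)
Lemma prod_diff n (r : seq J) (p p' d : J -> N) :
  (forall j, p j [::] = 1) -> (forall j, p' j [::] = 1) ->
  (forall j, vanish n.+1 (d j)) -> (forall j, vanish n.+2 (p' j - p j - d j)) ->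
  vanish n.+2 (\prod_(j <- r) p' j - \prod_(j <- r) p j - \sum_(j <- r) d j).
Proof.
move=> p1 p'1 dn H; elim: r => [|j r IH]; first by rewrite !big_nil subrr subr0.
rewrite !big_cons; set P' := \prod_(i <- r) _ in IH *; set P := \prod_(i <- r) _ in IH *.
set D := \sum_(i <- r) _ in IH *.
have P'1 : P' [::] = 1.
  by apply: (big_ind (fun f : N => f [::] = 1)) => // f g f1 g1; rewrite ncpsM_nil f1 g1 mulr1.
have -> : p' j * P' - p j * P - (d j + D) =
  (p' j - p j - d j) * P' + p j * (P' - P - D) + (d j * (P' - 1) + (p j - 1) * D).
  rewrite !mulrBl !mulrBr mulr1 mul1r; nc_zmod.
apply: vanishD; apply: vanishD.
- exact: vanishMr.
- exact: vanishMl.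
- have : vanish (n.+1 + 1) (d j * (P' - 1)); last by rewrite addn1.
  by apply: vanishM => //; apply: vanish1; rewrite ncpsDE P'1 subrr.
have : vanish (1 + n.+1) ((p j - 1) * D); last by rewrite add1n.
apply: vanishM; last exact: vanish_sum.
by apply: vanish1; rewrite ncpsDE p1 subrr.
Qed.

Lemma nc_comm_nil f g : f [::] = 1 -> g [::] = 1 -> nc_comm f g [::] = 1.
Proof. by move=> f1 g1; rewrite /nc_comm !ncpsM_nil !nc_inv_nil // f1 g1 !mulr1. Qed.

Lemma comm_prod_nil z : (forall j, z j [::] = 0) -> comm_prod z [::] = 1.
Proof.
move=> z0; apply: (big_ind (fun f : N => f [::] = 1)) => //.
  by move=> f g f1 g1; rewrite ncpsM_nil f1 g1 mulr1.
by move=> j _; rewrite nc_comm_nil // ?var1_nil // add1_nil.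
Qed.

Lemma comm_prod_diff n z z' :
  (forall j, z j [::] = 0) -> (forall j, z' j [::] = 0) ->
  (forall j, vanish n (z' j - z j)) ->
  vanish n.+2 (comm_prod z' - comm_prod z - (ad_sum z' - ad_sum z)).
Proof.
move=> z0 z'0 H.
have -> : ad_sum z' - ad_sum z =
    \sum_j (nc_var j * (z' j - z j) - (z' j - z j) * nc_var j).
  rewrite /ad_sum -sumrB; apply: eq_bigr => j _.
  rewrite mulrBr mulrBl; nc_zmod.
apply: prod_diff => j.
- by rewrite nc_comm_nil // ?var1_nil // add1_nil.
- by rewrite nc_comm_nil // ?var1_nil // add1_nil.
- by rewrite -add1n; exact: vanish_comm (vanish_var j) _.
- exact: nc_comm_diff.
Qed.

(** [ad_sum] is the linear part of [comm_prod], and [pot] inverts it up to cyclic means. The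
    fixpoint equation [F e = e] puts the nonlinear rest of [comm_prod (pot e)] into [e] itself, so
    that what remains of [u] is exactly the cyclic mean of [e]. *)
Lemma comm_prod_approx u : u [::] = 1 -> exists2 z, (forall j, z j [::] = 0) &
  exists e, forall w, w != [::] -> (u - comm_prod z) w = (size w)%:R^-1 * rotsum e w.
Proof.
move=> u1; pose F e := u - (comm_prod (pot e) - ad_sum (pot e)).
have FE e e' : F e - F e' =
    - (comm_prod (pot e) - comm_prod (pot e') - (ad_sum (pot e) - ad_sum (pot e'))).
  rewrite /F; nc_zmod.
have cF : contracting F.
  move=> n f g fg; rewrite FE; apply: vanishN.
  (* [pot] costs one degree and the nonlinear rest gains two, so [F] gains one in total. *)
  apply: (@vanishW _ _ n.-1.+2); first by case: n {fg}.
  by apply: comm_prod_diff; [exact: pot_nil..|move=> j; exact: vanish_pot].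
have [e eE] := contracting_fixpoint cF.
exists (pot e); first exact: pot_nil.
exists e => w w0.
have -> : u - comm_prod (pot e) = F e - ad_sum (pot e) by rewrite /F; nc_zmod.
by rewrite eE ncpsDE ncpsNE ad_sum_pot //; ring.
Qed.
End Rotations.

(** * Classes in an abelianization *)

Section AbelianClasses.
Variable G : groupType.
Local Open Scope quotient_scope.

Definition abel (x : G) : abelianization G := \pi_(abelianization G) x.

Lemma abelM x y : abel (x * y)%g = (abel x * abel y)%g.
Proof. exact: pi_ab_mul. Qed.
Lemma abel1 : abel 1%g = 1%g.
Proof. by apply: (mulgI (abel 1%g)); rewrite -abelM !mulg1. Qed.
Lemma abelV x : abel x^-1%g = (abel x)^-1%g.
Proof. by apply: (mulgI (abel x)); rewrite -abelM !mulgV abel1. Qed.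
Lemma abel_eqP x y : abel x = abel y <-> commutator_subgroup (x^-1 * y)%g.
Proof.
split=> [/eqmodP/asboolP //|H]; apply/eqmodP; exact/asboolP.
Qed.
Lemma abel_eq1 x : abel x = 1%g <-> commutator_subgroup x.
Proof.
by rewrite -abel1; split=> [/esym/abel_eqP|H]; [|apply/esym/abel_eqP]; rewrite invg1 mul1g.
Qed.
Lemma abel_comm x y : abel [~ x, y]%g = 1%g.
Proof. by apply/abel_eq1; exact: commutator_subgroup_comm. Qed.
Lemma abelC x y : (abel x * abel y = abel y * abel x)%g.
Proof.
by rewrite -!abelM commgC abelM abel_comm mulg1.
Qed.
Lemma abel_commutator x y : abel (x * y * x^-1 * y^-1)%g = 1%g.
Proof. by rewrite !abelM !abelV (abelC x) mulgK mulgV. Qed.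
End AbelianClasses.

(** The kernel of [f] is a subgroup that contains all commutators, hence the whole commutator
    subgroup. *)
Lemma abel_factor (G H : groupType) (f : G -> H) :
  {morph f : x y / (x * y)%g} -> commutative (fun x y : H => x * y)%g ->
  forall x y, abel x = abel y -> f x = f y.
Proof.
move=> fM HC; have f1 : f 1%g = 1%g by apply: (mulgI (f 1%g)); rewrite -fM !mulg1.
have fV x : f x^-1%g = (f x)^-1%g.
  by apply: (mulgI (f x)); rewrite -fM !mulgV.
move=> x y /abel_eqP /(_ [set z | f z = 1%g]) H1.
suff : f (x^-1 * y)%g = 1%g.
  by rewrite fM fV => /mulg1_eq; rewrite invgK.
apply: H1 => [|a b] /=.
  by split=> //= a b /= fa fb; rewrite fM fV fa fb mulgV.
by rewrite commgEl conjgE !fM !fV (HC (f a) (f b)) mulKg mulVg.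
Qed.

Lemma abelianization_iso (G H : groupType) (f : G -> H) :
  {morph f : x y / (x * y)%g} -> commutative (fun x y : H => x * y)%g ->
  (forall y, exists x, f x = y) -> (forall x, f x = 1%g -> abel x = 1%g) ->
  group_isomorphic (abelianization G) H.
Proof.
move=> fM HC fS fK; pose F (q : abelianization G) : H := f (repr q).
have FE x : F (abel x) = f x.
  by apply: (abel_factor fM HC); rewrite /abel reprK.
have abelW (P : abelianization G -> Prop) : (forall x, P (abel x)) -> forall q, P q.
  by move=> HP q; rewrite -[q]reprK; exact: HP.
exists F; split.
  by apply: (abelW _) => x; apply: (abelW _) => y; rewrite -abelM !FE fM.
have [g gK] := choice fS.
exists (fun y => abel (g y)) => [|y]; last by rewrite FE gK.
apply: (abelW _) => x; rewrite FE.
have : abel ((g (f x))^-1 * x)%g = 1%g.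
  apply: fK; apply: (mulgI (f (g (f x)))).
  by rewrite -fM mulgA mulgV mul1g mulg1 gK.
by rewrite abelM abelV => /mulg1_eq; rewrite invgK.
Qed.

Lemma group_isomorphic_comp (G G' H : groupType) (f : G -> G') (f' : G' -> G) :
  {morph f : x y / (x * y)%g} -> cancel f f' -> cancel f' f ->
  group_isomorphic (abelianization G') H -> group_isomorphic (abelianization G) H.
Proof.
move=> fM fK f'K [h [hM hb]].
have [h' hK h'K] := hb.
have f'M : {morph f' : x y / (x * y)%g}.
  by move=> x y; apply: (can_inj fK); rewrite fM !f'K.
have aC (K : groupType) : commutative (fun x y : abelianization K => (x * y)%g).
  by move=> x y; rewrite -[x]reprK -[y]reprK; exact: abelC.
have HC : commutative (fun x y : H => (x * y)%g).
  by move=> x y; rewrite -[x]h'K -[y]h'K -!hM aC.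
apply: (@abelianization_iso G H (fun x => h (abel (f x)))) => //.
- by move=> x y; rewrite fM abelM hM.
- move=> y; exists (f' (repr (h' y))).
  by rewrite f'K /abel reprK h'K.
- have h1 : h 1%g = 1%g by apply: (mulgI (h 1%g)); rewrite -hM !mulg1.
  move=> x; rewrite -h1 => /(can_inj hK) H1.
  have f'1 : f' 1%g = 1%g by apply: (mulgI (f' 1%g)); rewrite -f'M !mulg1.
  rewrite -[x]fK -(abel1 G) -f'1; apply: (@abel_factor _ _ (fun z => abel (f' z))).
  + by move=> a b; rewrite f'M abelM.
  + exact: aC.
  by rewrite H1 -(abel1 G').
Qed.

(** * The stable general linear group *)

Section StableGroup.
Variable R : pzRingType.
Implicit Types (A B : nat -> nat -> R) (x y : stable_GL R).

Definition GLmx x : nat -> nat -> R := val (val x).1.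
Definition GLmxV x : nat -> nat -> R := val (val x).2.

Lemma GLmxM x y : GLmx (x * y)%g = infmx_mul (GLmx x) (GLmx y). Proof. by []. Qed.
Lemma GLmxVM x y : GLmxV (x * y)%g = infmx_mul (GLmxV y) (GLmxV x). Proof. by []. Qed.
Lemma GLmx1 : GLmx 1%g = @infmx_one R. Proof. by []. Qed.
Lemma GLmx_inv x : GLmx x^-1%g = GLmxV x. Proof. by []. Qed.
Lemma GLmx_mulV x : infmx_mul (GLmx x) (GLmxV x) = @infmx_one R.
Proof. exact: (congr1 val (unit_group_mulV x)). Qed.
Lemma GLmx_mulVl x : infmx_mul (GLmxV x) (GLmx x) = @infmx_one R.
Proof. exact: (congr1 val (unit_group_mulVl x)). Qed.

Lemma GLmx_inj x y : GLmx x = GLmx y -> x = y.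
Proof.
move=> /val_inj exy; apply: val_inj.
have := unit_group_mulVl x; rewrite exy => H.
have e2 : (val x).2 = (val y).2.
  by rewrite -[(val x).2]mulg1 -(unit_group_mulV y) mulgA H mul1g.
by rewrite [val x]surjective_pairing exy e2 -surjective_pairing.
Qed.

Lemma GLmx_stable x : exists n, stable_above n (GLmx x).
Proof. exact/asboolP/(valP (val x).1). Qed.
Lemma GLmxV_stable x : exists n, stable_above n (GLmxV x).
Proof. exact/asboolP/(valP (val x).2). Qed.

(** A row of [x] that agrees with the identity selects a row of the inverse in x x^-1 = 1, and a
    column of [x] does the same in x^-1 x = 1. So one block serves both matrices. *)
Lemma stable_above_GLmxV n x : stable_above n (GLmx x) -> stable_above n (GLmxV x).
Proof.
move=> Hn; have [m Hm] := GLmxV_stable x => i j.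
pose M := maxn (maxn n m) (maxn i j).+1.
have nM : (n <= M)%N by rewrite /M; lia.
have mM : (m <= M)%N by rewrite /M; lia.
have iM : (i < M)%N by rewrite /M; lia.
have jM : (j < M)%N by rewrite /M; lia.
case/orP=> H.
  have := congr1 (fun A => A i j) (GLmx_mulV x).
  rewrite (infmx_mulE _ _ Hn nM iM) => E; rewrite -[RHS]/(infmx_one R i j) -E.
  by under eq_bigr do rewrite Hn ?H //; rewrite (sum_delta_l (fun k => GLmxV x k j)).
have := congr1 (fun A => A i j) (GLmx_mulVl x).
rewrite (infmx_mulE _ _ Hm mM iM) => E; rewrite -[RHS]/(infmx_one R i j) -E.
under eq_bigr do rewrite Hn ?H ?orbT //.
by rewrite (sum_delta_r (fun k => GLmxV x i k)).
Qed.

(** Both uses of [insubd] fall back to the identity on data that are not stable or not mutually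
    inverse; this keeps proofs out of the constructions, and [mkGLE] gives the entries in the proper
    case. *)
Definition mkGL A B : stable_GL R :=
  insubd (ug_one (stable_mx R)) (insubd (stable_one R) A, insubd (stable_one R) B).

Lemma mkGLE n A B : stable_above n A -> stable_above n B ->
  infmx_mul A B = @infmx_one R -> infmx_mul B A = @infmx_one R ->
  GLmx (mkGL A B) = A /\ GLmxV (mkGL A B) = B.
Proof.
move=> HA HB AB BA; rewrite /GLmx /GLmxV /mkGL.
have sA : stable_pred A by apply/asboolP; exists n.
have sB : stable_pred B by apply/asboolP; exists n.
rewrite insubdK /=; first by rewrite !insubdK.
by rewrite unfold_in; apply/andP; split; apply/eqP/val_inj => /=; rewrite !insubdK.
Qed.

Definition elm i j (a : R) : nat -> nat -> R :=
  fun k l => (k == l)%:R + (if (k == i) && (l == j) then a else 0).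

Lemma elm_stable i j a n : (i < n)%N -> (j < n)%N -> stable_above n (elm i j a).
Proof.
move=> lin ljn k l H; rewrite /elm [(k == i) && _](_ : _ = false) ?addr0 //.
by apply/negP => /andP[/eqP ? /eqP ?]; lia.
Qed.

Lemma infmx_mul_elml i j a A k l :
  infmx_mul (elm i j a) A k l = A k l + (if k == i then a * A j l else 0).
Proof.
pose M := (maxn k (maxn i j)).+1.
have iM : (i < M)%N by rewrite /M; lia.
have jM : (j < M)%N by rewrite /M; lia.
have kM : (k < M)%N by rewrite /M; lia.
rewrite (infmx_mulE _ _ (elm_stable a iM jM) (leqnn _) kM).
under eq_bigr do rewrite mulrDl.
rewrite big_split /= (sum_delta_l (fun p => A p l)) //; congr (_ + _).
rewrite (bigD1 (Ordinal jM)) //= eqxx andbT big1 ?addr0; first by case: eqP; rewrite ?mul0r.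
by move=> p; rewrite -val_eqE /= => /negPf ->; rewrite andbF mul0r.
Qed.

Lemma infmx_mul_elmr n i j a A k l : stable_above n A ->
  infmx_mul A (elm i j a) k l = A k l + (if l == j then A k i * a else 0).
Proof.
move=> HA; pose M := maxn n (maxn k (maxn l i)).+1.
have iM : (i < M)%N by rewrite /M; lia.
have lM : (l < M)%N by rewrite /M; lia.
have kM : (k < M)%N by rewrite /M; lia.
have nM : (n <= M)%N by rewrite /M; lia.
rewrite (infmx_mulE _ _ HA nM kM).
under eq_bigr do rewrite mulrDr.
rewrite big_split /= (sum_delta_r (fun p => A k p)) //; congr (_ + _).
rewrite (bigD1 (Ordinal iM)) //= eqxx /= big1 ?addr0; first by case: eqP; rewrite ?mulr0.
by move=> p; rewrite -val_eqE /= => /negPf ->; rewrite mulr0.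
Qed.

Lemma elm_mul i j a b : i != j ->
  infmx_mul (elm i j a) (elm i j b) = elm i j (a + b).
Proof.
move=> /negPf ij; apply/funext => k; apply/funext => l.
rewrite infmx_mul_elml /elm [j == i]eq_sym ij /= addr0 -addrA; congr (_ + _).
have [_|_] := eqVneq k i; rewrite /= ?addr0 // [j == l]eq_sym.
by case: (l == j); rewrite ?mulr1 ?mulr0 ?addr0 // addrC.
Qed.

Lemma elm0 i j : elm i j 0 = @infmx_one R.
Proof. by apply/funext => k; apply/funext => l; rewrite /elm if_same addr0. Qed.

Definition elementary i j a := mkGL (elm i j a) (elm i j (- a)).

Lemma elementaryE i j a : i != j ->
  GLmx (elementary i j a) = elm i j a /\ GLmxV (elementary i j a) = elm i j (- a).
Proof.
move=> ij; apply: (@mkGLE (maxn i j).+1).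
- by apply: elm_stable; lia.
- by apply: elm_stable; lia.
- by rewrite elm_mul // subrr elm0.
- by rewrite elm_mul // addNr elm0.
Qed.

(** The Steinberg relation; in the stable group a third index [k] always exists, so elementary
    matrices die in [K1]. The signs compensate for the convention [~ x, y] = x^-1 y^-1 x y. *)
Lemma elementary_commutator i j k a : i != j -> i != k -> j != k ->
  elementary i j a = [~ elementary i k (- a), elementary k j (- 1)]%g.
Proof.
move=> ij ik jk.
have [ki kj] : k != i /\ k != j by rewrite ![k == _]eq_sym.
apply: GLmx_inj; rewrite commgEl conjgE.
rewrite !GLmxM !GLmx_inv !(elementaryE _ _).1 // !(elementaryE _ _).2 // !opprK.
apply/funext => p; apply/funext => q.
have ji : (j == i) = false by rewrite eq_sym (negPf ij).
rewrite !infmx_mul_elml /elm !eqxx (negPf jk) ji (negPf ki) /= !addr0 !mul1r [j == q]eq_sym.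
have [->|pi] := eqVneq p i.
  rewrite (negPf ik) /= !addr0 mulNr; set X := (k == q)%:R + _.
  rewrite (mulrDr a X) addrA subrK.
  by case: (q == j); rewrite ?mulr1 ?mulr0.
rewrite /= !addr0; case: (p == k) => /=; last by rewrite !addr0.
by case: (q == j); rewrite /= ?addr0 // subrK.
Qed.
End StableGroup.

(** * Gaussian elimination modulo commutators *)

Section Elimination.
Variable J : finType.
Local Notation N := (ncps J).
Implicit Types (x y z : stable_GL N) (f g : N).

Lemma abel_elementary (R : pzRingType) i j (a : R) : i != j -> abel (elementary i j a) = 1%g.
Proof.
move=> ij; have ik : i != (maxn i j).+1 by apply/eqP; lia.
have jk : j != (maxn i j).+1 by apply/eqP; lia.
by rewrite (elementary_commutator a ij ik jk) abel_comm.
Qed.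

Lemma row_op n x i j (a : N) : i != j -> (i < n)%N -> (j < n)%N ->
  stable_above n (GLmx x) -> exists y, [/\ abel y = abel x, stable_above n (GLmx y) &
    forall k l, GLmx y k l = GLmx x k l + (if k == i then a * GLmx x j l else 0)].
Proof.
move=> ij lin ljn Hx; exists (elementary i j a * x)%g.
have E : GLmx (elementary i j a * x)%g = infmx_mul (elm i j a) (GLmx x).
  by rewrite GLmxM (elementaryE _ ij).1.
split; first by rewrite abelM abel_elementary // mul1g.
- by rewrite E; apply: infmx_mul_stable => //; exact: elm_stable.
- by move=> k l; rewrite E infmx_mul_elml.
Qed.

Lemma col_op n x i j (a : N) : i != j -> (i < n)%N -> (j < n)%N ->
  stable_above n (GLmx x) -> exists y, [/\ abel y = abel x, stable_above n (GLmx y) &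
    forall k l, GLmx y k l = GLmx x k l + (if l == j then GLmx x k i * a else 0)].
Proof.
move=> ij lin ljn Hx; exists (x * elementary i j a)%g.
have E : GLmx (x * elementary i j a)%g = infmx_mul (GLmx x) (elm i j a).
  by rewrite GLmxM (elementaryE _ ij).1.
split; first by rewrite abelM abel_elementary // mulg1.
- by rewrite E; apply: infmx_mul_stable => //; exact: elm_stable.
- by move=> k l; rewrite E (infmx_mul_elmr _ _ _ _ _ Hx).
Qed.

(* The ring is local: an entry with nonzero constant term is invertible, and every
   column of an invertible matrix has such an entry. *)
Lemma unit_entry n x : stable_above n.+1 (GLmx x) ->
  exists2 k, (k <= n)%N & GLmx x k n [::] != 0.
Proof.
move=> Hx; apply: contrapT => H.
have HV := stable_above_GLmxV Hx.
have := congr1 (fun A : nat -> nat -> N => A n n [::]) (GLmx_mulVl x).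
rewrite (infmx_mulE _ _ HV (leqnn _) (ltnSn n)) ncps_sumE /infmx_one eqxx big1 //.
move=> k _; rewrite ncpsM_nil; have [->|kn] := eqVneq (GLmx x k n [::]) 0.
  by rewrite mulr0.
by case: H; exists k => //; rewrite -ltnS.
Qed.

(** A unit above the pivot in column n lets a multiple of its row turn the pivot into 1. If the
    pivot is the unit that was found and the entry of row 0 is not one, adding the last row to row 0
    creates a unit there; 0 < n makes these rows distinct. *)
Lemma normalize_pivot n x : (0 < n)%N -> stable_above n.+1 (GLmx x) ->
  exists y, [/\ abel y = abel x, stable_above n.+1 (GLmx y) & GLmx y n n = 1].
Proof.
move=> n0.
have main (z : stable_GL N) k : (k < n)%N -> stable_above n.+1 (GLmx z) -> GLmx z k n [::] != 0 ->
  exists y, [/\ abel y = abel z, stable_above n.+1 (GLmx y) & GLmx y n n = 1].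
  move=> kn Hz /nc_unit[h [_ hz]].
  have nk : n != k by apply/eqP; lia.
  have [y [yz Hy Ey]] := row_op ((1 - GLmx z n n) * h) nk (ltnSn n) (ltnW kn) Hz.
  by exists y; split=> //; rewrite Ey eqxx -mulrA hz mulr1 addrC subrK.
move=> Hx; have [k kn ku] := unit_entry Hx.
have [kn'|nk] := ltnP k n; first exact: main kn' Hx ku.
have kE : k = n by lia.
rewrite kE in ku.
have [u0|u0] := eqVneq (GLmx x 0%N n [::]) 0; last exact: main n0 Hx u0.
have nz : 0%N != n by apply/eqP; lia.
have [y [yx Hy Ey]] := row_op (1 : N) nz (ltn0Sn n) (ltnSn n) Hx.
have [|y' [y'y Hy' Ey']] := main _ _ n0 Hy.
  by rewrite Ey eqxx mul1r ncpsDE u0 add0r.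
by exists y'; rewrite y'y.
Qed.

Lemma clear_column n x : stable_above n.+1 (GLmx x) -> GLmx x n n = 1 ->
  exists y, [/\ abel y = abel x, stable_above n.+1 (GLmx y), GLmx y n n = 1 &
    forall k, (k < n)%N -> GLmx y k n = 0].
Proof.
move=> Hx x1.
have H m : (m <= n)%N -> exists y, [/\ abel y = abel x, stable_above n.+1 (GLmx y), GLmx y n n = 1 &
    forall k, (k < m)%N -> GLmx y k n = 0].
  elim: m => [|m IH] mn; first by exists x.
  have [y [yx Hy y1 y0]] := IH (ltnW mn).
  have mn' : m != n by apply/eqP; lia.
  have [y' [y'y Hy' Ey']] := row_op (- GLmx y m n) mn' (leqW mn) (ltnSn n) Hy.
  exists y'; split; [by rewrite y'y|by []|by rewrite Ey' eq_sym (negPf mn') addr0|].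
  move=> k; rewrite ltnS leq_eqVlt => /orP[/eqP ->|km].
    by rewrite Ey' eqxx y1 mulr1 subrr.
  by rewrite Ey' y0 // ltn_eqF // addr0.
exact: H.
Qed.

Lemma clear_row n x : stable_above n.+1 (GLmx x) -> GLmx x n n = 1 ->
  (forall k, (k < n)%N -> GLmx x k n = 0) ->
  exists y, [/\ abel y = abel x, stable_above n.+1 (GLmx y), GLmx y n n = 1,
    forall k, (k < n)%N -> GLmx y k n = 0 & forall k, (k < n)%N -> GLmx y n k = 0].
Proof.
move=> Hx x1 x0.
have H m : (m <= n)%N -> exists y, [/\ abel y = abel x, stable_above n.+1 (GLmx y), GLmx y n n = 1,
    forall k, (k < n)%N -> GLmx y k n = 0 & forall k, (k < m)%N -> GLmx y n k = 0].
  elim: m => [|m IH] mn; first by exists x.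
  have [y [yx Hy y1 y0 y0']] := IH (ltnW mn).
  have mn' : n != m by apply/eqP; lia.
  have [y' [y'y Hy' Ey']] := col_op (- GLmx y n m) mn' (ltnSn n) (leqW mn) Hy.
  exists y'; split; [by rewrite y'y|by []|by rewrite Ey' (negPf mn') addr0| |].
    by move=> k kn; rewrite Ey' y0 // (negPf mn') addr0.
  move=> k; rewrite ltnS leq_eqVlt => /orP[/eqP ->|km].
    by rewrite Ey' eqxx y1 mul1r subrr.
  by rewrite Ey' y0' // ltn_eqF // addr0.
exact: H.
Qed.

Lemma reduce_to_diagonal n x : stable_above n.+1 (GLmx x) ->
  exists2 y, abel y = abel x & stable_above 1 (GLmx y).
Proof.
elim: n x => [|n IH] x Hx; first by exists x.
have [y1 [E1 H1 P1]] := normalize_pivot (ltn0Sn n) Hx.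
have [y2 [E2 H2 P2 C2]] := clear_column H1 P1.
have [y3 [E3 H3 P3 C3 R3]] := clear_row H2 P2 C2.
have [|y yE Hy] := IH y3; last by exists y => //; rewrite yE E3 E2 E1.
move=> i j; have [iN|iN] := ltnP n.+1 i; first by move=> _; apply: H3; rewrite iN.
have [jN|jN] := ltnP n.+1 j; first by move=> _; apply: H3; rewrite jN orbT.
case/orP=> H.
  have -> : i = n.+1 by lia.
  have [->|jn] := eqVneq j n.+1; first by rewrite P3 ?eqxx.
  by rewrite R3 ?[n.+1 == j]eq_sym ?(negPf jn) //; move/eqP: jn; lia.
have -> : j = n.+1 by lia.
have [->|jn] := eqVneq i n.+1; first by rewrite P3 ?eqxx.
by rewrite C3 //; move/eqP: jn; lia.
Qed.

Definition diag1 f : nat -> nat -> N :=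
  fun i j => if (i == 0)%N && (j == 0)%N then f else (i == j)%:R.

Lemma diag1_stable f : stable_above 1 (diag1 f).
Proof. by move=> [|i] [|j]. Qed.

Lemma diag1_mul f g : infmx_mul (diag1 f) (diag1 g) = diag1 (f * g).
Proof.
apply/funext => i; apply/funext => j.
have H := infmx_mul_stable (@diag1_stable f) (@diag1_stable g).
case: i => [|i]; last by rewrite H.
case: j => [|j]; last by rewrite H // orbT.
by rewrite (infmx_mulE _ _ (@diag1_stable f) (leqnn 1) (ltnSn 0)) big_ord1.
Qed.

Lemma diag1_1 : diag1 1 = @infmx_one N.
Proof. by apply/funext => -[|i]; apply/funext => -[|j]. Qed.

Definition diagGL f g : stable_GL N := mkGL (diag1 f) (diag1 g).

Lemma diagGLE f g : f * g = 1 -> g * f = 1 ->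
  GLmx (diagGL f g) = diag1 f /\ GLmxV (diagGL f g) = diag1 g.
Proof.
move=> fg gf; apply: (@mkGLE _ 1); rewrite ?diag1_mul ?fg ?gf ?diag1_1 //;
  exact: diag1_stable.
Qed.

Definition diagU f : stable_GL N := diagGL f (nc_inv f).

Lemma diagUE f : f [::] = 1 -> GLmx (diagU f) = diag1 f /\ GLmxV (diagU f) = diag1 (nc_inv f).
Proof. by move=> f1; apply: diagGLE; rewrite ?nc_mulV ?nc_mulVl. Qed.

Lemma diagUM f g : f [::] = 1 -> g [::] = 1 -> diagU (f * g) = (diagU f * diagU g)%g.
Proof.
move=> f1 g1; apply: GLmx_inj; rewrite GLmxM !(diagUE _).1 ?diag1_mul //.
by rewrite ncpsM_nil f1 g1 mulr1.
Qed.

Lemma diagU_inv f : f [::] = 1 -> diagU (nc_inv f) = (diagU f)^-1%g.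
Proof.
move=> f1; apply: GLmx_inj; rewrite GLmx_inv (diagUE f1).2 (diagUE _).1 //.
exact: nc_inv_nil.
Qed.

Lemma abel_diagU_comm_prod (z : J -> N) : (forall j, z j [::] = 0) ->
  abel (diagU (comm_prod z)) = 1%g.
Proof.
move=> z0; rewrite /comm_prod.
pose P f := f [::] = 1 /\ abel (diagU f) = 1%g.
suff [] : P (\prod_j nc_comm (1 + nc_var j) (1 + z j)) by [].
apply: (big_ind P) => [|f g [f1 Ef] [g1 Eg]|j _].
- split=> //; have -> : diagU 1 = 1%g; last exact: abel1.
  by apply: GLmx_inj; rewrite (diagUE _).1 // diag1_1.
- split; first by rewrite ncpsM_nil f1 g1 mulr1.
  by rewrite diagUM // abelM Ef Eg mulg1.
have [] := (var1_nil j, add1_nil (z0 j)).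
move: (1 + nc_var j) (1 + z j) => f g x1 y1.
split; first exact: nc_comm_nil.
rewrite /nc_comm.
have [fi gi] := (nc_inv_nil x1, nc_inv_nil y1).
have fg1 : (f * g) [::] = 1 by rewrite ncpsM_nil x1 y1 mulr1.
have fgf : (f * g * nc_inv f) [::] = 1 by rewrite ncpsM_nil fg1 fi mulr1.
rewrite (diagUM fgf gi) (diagUM fg1 fi) (diagUM x1 y1) (diagU_inv x1) (diagU_inv y1).
exact: abel_commutator.
Qed.
End Elimination.

(** * The invariants of [K1], for abstract traces in each degree *)

Section LogTrace.
Variables (J : finType) (V : nat -> zmodType).
Local Notation N := (ncps J).
(** Index n stands for degree n + 1, and [tr_local] says that only words of that length count.
    [tr_rotsum] bounds the kernel from above: a series of trace 0 has vanishing rotation sums in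
    that degree. The instance supplied later is [cyc_trace], with values in the cyclic
    coinvariants. *)
Variable tr : forall n, {additive N -> V n}.
Hypothesis trC : forall n f g, tr n (f * g) = tr n (g * f).
Hypothesis tr_local : forall n (f : N), (forall w, size w = n.+1 -> f w = 0) -> tr n f = 0.
Hypothesis tr_rotsum : forall n f w, tr n f = 0 -> size w = n.+1 -> rotsum f w = 0.
Hypothesis tr_surj : forall n v, exists2 f : N, tr n f = v & forall w, size w <> n.+1 -> f w = 0.
Implicit Types (x y : stable_GL N) (f g u : N).

Definition block m (A : nat -> nat -> N) : 'M[N]_m := \matrix_(i, j) A i j.

Lemma block_mul m A B : stable_above m A -> block m (infmx_mul A B) = block m A *m block m B.
Proof.
move=> HA; apply/matrixP => i j; rewrite !mxE (infmx_mulE _ _ HA (leqnn _) (ltn_ord i)).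
by apply: eq_bigr => k _; rewrite !mxE.
Qed.

Lemma block1 m : block m (@infmx_one N) = 1%:M.
Proof. by apply/matrixP => i j; rewrite !mxE. Qed.

Definition mxtr n m (A : 'M[N]_m) : V n := tr n (\sum_i A i i).

Lemma mxtrC n m (A B : 'M[N]_m) : mxtr n (A *m B) = mxtr n (B *m A).
Proof.
rewrite /mxtr !raddf_sum /=.
under eq_bigr do rewrite mxE raddf_sum.
under [RHS]eq_bigr do rewrite mxE raddf_sum.
rewrite exchange_big /=; apply: eq_bigr => i _; apply: eq_bigr => j _; exact: trC.
Qed.

Lemma mxtrD n m (A B : 'M[N]_m) : mxtr n (A + B) = mxtr n A + mxtr n B.
Proof.
by rewrite /mxtr -raddfD -big_split /=; congr (tr n _); apply: eq_bigr => i _; rewrite mxE.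
Qed.

Lemma map_euler_mul m (A B : 'M[N]_m) :
  map_mx (@euler J) (A *m B) = map_mx (@euler J) A *m B + A *m map_mx (@euler J) B.
Proof.
apply/matrixP => i j; rewrite !mxE -big_split /=.
rewrite (big_morph _ (@eulerD J) (euler0 J)); apply: eq_bigr => k _.
by rewrite !mxE eulerM.
Qed.

(* Plays the role of log det: modulo commutators, A |-> tr (A^-1 E(A)) is additive. *)
Definition logtr m n x : V n :=
  mxtr n (block m (GLmxV x) *m map_mx (@euler J) (block m (GLmx x))).

(** The Leibniz rule splits (xy)^-1 E(xy) into y^-1 (x^-1 E(x)) y and y^-1 E(y); cyclicity of the
    trace removes the conjugation from the first term. *)
Lemma logtrM m n x y : stable_above m (GLmx x) -> stable_above m (GLmx y) ->
  logtr m n (x * y)%g = logtr m n x + logtr m n y.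
Proof.
move=> Hx Hy; have HVx := stable_above_GLmxV Hx; have HVy := stable_above_GLmxV Hy.
rewrite /logtr GLmxM GLmxVM !block_mul // map_euler_mul mulmxDr mxtrD; congr (_ + _).
  rewrite mulmxA mxtrC !mulmxA -block_mul // GLmx_mulV block1 mul1mx //.
rewrite -mulmxA; congr (mxtr n (_ *m _)).
by rewrite mulmxA -block_mul // GLmx_mulVl block1 mul1mx.
Qed.

(** E annihilates 0 and 1, so the added row and column contribute nothing and the value does not
    depend on the block. *)
Lemma logtrS m n x : stable_above m (GLmx x) -> logtr m.+1 n x = logtr m n x.
Proof.
move=> Hx; rewrite /logtr /mxtr; congr (tr n _).
have E p : \sum_i (block p (GLmxV x) *m map_mx (@euler J) (block p (GLmx x))) i i =
    \sum_(i < p) \sum_(k < p) GLmxV x i k * euler (GLmx x k i).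
  by apply: eq_bigr => i _; rewrite mxE; apply: eq_bigr => k _; rewrite !mxE.
have Z (i k : nat) : (m <= i)%N || (m <= k)%N -> GLmxV x i k * euler (GLmx x k i) = 0.
  move=> H; rewrite Hx 1?orbC //; case: eqP => _ /=; rewrite ?euler1 ?euler0 mulr0 //.
rewrite !E big_ord_recr /= [X in _ + X]big1 => [|k _]; last by apply: Z; rewrite leqnn.
rewrite addr0; apply: eq_bigr => i _; rewrite big_ord_recr /= [X in _ + X]Z ?addr0 //.
by rewrite leqnn orbT.
Qed.

Definition detr m x : rat := \det (map_mx (fun f : N => f [::]) (block m (GLmx x))).

Lemma detrM m x y : stable_above m (GLmx x) -> detr m (x * y)%g = detr m x * detr m y.
Proof.
move=> Hx; rewrite /detr GLmxM block_mul // -det_mulmx; congr (\det _).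
apply/matrixP => i j; rewrite !mxE ncps_sumE; apply: eq_bigr => k _.
by rewrite !mxE ncpsM_nil.
Qed.

Lemma detrS m x : stable_above m (GLmx x) -> detr m.+1 x = detr m x.
Proof.
move=> Hx; rewrite /detr (expand_det_row _ ord_max) (bigD1 ord_max) //= big1 ?addr0.
  rewrite !mxE Hx ?leqnn // eqxx mul1r /cofactor addnn -signr_odd odd_double mul1r.
  congr (\det _); apply/matrixP => i j; rewrite !mxE.
  by rewrite !lift_max.
move=> i im; rewrite !mxE Hx ?leqnn //=.
have /negPf -> : m != i by move: im; rewrite -val_eqE /= eq_sym.
by rewrite mul0r.
Qed.

Lemma detr1 m : detr m 1%g = 1.
Proof.
rewrite /detr GLmx1 block1 -[RHS](det1 _ m); congr (\det _).
by apply/matrixP => i j; rewrite !mxE; case: eqP.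
Qed.

Definition GLbound x : nat := projT1 (cid (GLmx_stable x)).
Lemma GLboundP x : stable_above (GLbound x) (GLmx x).
Proof. exact: projT2 (cid (GLmx_stable x)). Qed.

Lemma stable_invariant (T : Type) (F : nat -> T) x :
  (forall m, stable_above m (GLmx x) -> F m.+1 = F m) ->
  forall m, stable_above m (GLmx x) -> F m = F (GLbound x).
Proof.
move=> HF m Hm.
have H p k : stable_above p (GLmx x) -> F (k + p)%N = F p.
  move=> Hp; elim: k => // k IH; rewrite addSn HF // ?IH //.
  by apply: stable_aboveW Hp; rewrite leq_addl.
by rewrite -(H m (GLbound x)) // addnC H //; exact: GLboundP.
Qed.

Lemma detr_neq0 x : detr (GLbound x) x != 0.
Proof.
apply/eqP => H; have := @GLboundP x => Hx.
have := detrM (x^-1)%g Hx; rewrite mulgV detr1 H mul0r => /eqP; by rewrite oner_eq0.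
Qed.

Definition K1_invariant x : (nonzero rat * additive_group (seq_prod V))%type :=
  (exist (fun c : rat => c != 0) (detr (GLbound x) x) (detr_neq0 x),
   fun n => logtr (GLbound x) n x).

Lemma K1_invariantE m x : stable_above m (GLmx x) ->
  val (K1_invariant x).1 = detr m x /\ forall n, (K1_invariant x).2 n = logtr m n x.
Proof.
move=> Hm; split=> [|n].
  by apply/esym/(stable_invariant (F := fun m => detr m x)) => // p; exact: detrS.
by apply/esym/(stable_invariant (F := fun m => logtr m n x)) => // p; exact: logtrS.
Qed.

Lemma K1_invariantM : {morph K1_invariant : x y / (x * y)%g}.
Proof.
move=> x y; pose m := maxn (GLbound x) (GLbound y).
have Hx : stable_above m (GLmx x) by apply: stable_aboveW (@GLboundP x); rewrite leq_maxl.
have Hy : stable_above m (GLmx y) by apply: stable_aboveW (@GLboundP y); rewrite leq_maxr.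
have Hxy : stable_above m (GLmx (x * y)%g) by rewrite GLmxM; exact: infmx_mul_stable.
have [x1 x2] := K1_invariantE Hx; have [y1 y2] := K1_invariantE Hy.
have [xy1 xy2] := K1_invariantE Hxy.
rewrite [LHS]surjective_pairing [RHS]surjective_pairing; congr pair.
  by apply: val_inj; rewrite xy1 detrM // -x1 -y1.
by apply: functional_extensionality_dep => n; rewrite xy2 logtrM // -x2 -y2.
Qed.

Lemma K1_targetC : commutative (fun a b : (nonzero rat * additive_group (seq_prod V))%type => a * b)%g.
Proof.
move=> [a a'] [b b']; congr pair; last exact: (addrC (a' : seq_prod V)).
by apply: val_inj; exact: mulrC.
Qed.

Lemma K1_invariant_surj t : exists x, K1_invariant x = t.
Proof.
case: t => c s.
have [F FE] := choice (fun n => let: ex_intro2 f a b := @tr_surj n (s n) in ex_intro _ f (conj a b)).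
(* The prescribed traces concern distinct degrees, so a single series [S] carries them all. Its
   logarithmic primitive [u] is then rescaled by the prescribed determinant. *)
pose S : N := fun w => if size w is n.+1 then F n w else 0.
have trS n : tr n S = s n.
  rewrite -(FE n).1; apply/eqP; rewrite -subr_eq0 -raddfB; apply/eqP/tr_local => w wn.
  by rewrite ncpsDE ncpsNE /S wn subrr.
have [u u1 uS] := @euler_solve J S erefl.
pose a := val c; have a0 : a != 0 := valP c.
have [ui iu] := nc_invP u1.
have dE : GLmx (diagGL (a *: u) (a^-1 *: nc_inv u)) = diag1 (a *: u) /\
    GLmxV (diagGL (a *: u) (a^-1 *: nc_inv u)) = diag1 (a^-1 *: nc_inv u).
  by apply: diagGLE; rewrite -scalerAl -scalerAr scalerA ?ui ?iu ?mulfV ?mulVf // scale1r.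
exists (diagGL (a *: u) (a^-1 *: nc_inv u)).
set x := diagGL _ _ in dE *; have [x1 x2] := dE.
have Hx : stable_above 1 (GLmx x) by rewrite x1; exact: diag1_stable.
have [H1 H2] := K1_invariantE Hx.
rewrite [LHS]surjective_pairing; congr pair.
  apply: val_inj; rewrite H1 /detr det_mx11 !mxE x1 /diag1 /= ncpsZE u1 mulr1 //.
apply: functional_extensionality_dep => n; rewrite H2 /logtr /mxtr big_ord1 mxE big_ord1 !mxE.
rewrite x1 x2 /diag1 /=.
have -> : euler (a *: u) = a *: euler u.
  by apply: ncpsP => w; rewrite ncpsZE /euler ncpsZE mulrCA.
by rewrite uS -scalerAl -scalerAr scalerA mulVf // scale1r mulrA iu mul1r trS.
Qed.

Definition logtr1 n u : V n := tr n (nc_inv u * euler u).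

Lemma nc_inv_uniq u g : u [::] = 1 -> g * u = 1 -> nc_inv u = g.
Proof. by move=> u1 gu; rewrite -[LHS]mul1r -gu -mulrA nc_mulV // mulr1. Qed.

Lemma logtr1M n f g : f [::] = 1 -> g [::] = 1 -> logtr1 n (f * g) = logtr1 n f + logtr1 n g.
Proof.
move=> f1 g1; rewrite /logtr1.
have -> : nc_inv (f * g) = nc_inv g * nc_inv f.
  apply: nc_inv_uniq; first by rewrite ncpsM_nil f1 g1 mulr1.
  by rewrite mulrA -(mulrA (nc_inv g)) nc_mulVl // mulr1 nc_mulVl.
rewrite eulerM mulrDr raddfD; congr (_ + _).
  by rewrite mulrA trC !mulrA nc_mulV // mul1r.
by rewrite -mulrA (mulrA (nc_inv f)) nc_mulVl // mul1r.
Qed.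

Lemma logtr1_1 n : logtr1 n 1 = 0.
Proof. by rewrite /logtr1 euler1 mulr0 raddf0. Qed.

Lemma logtr1V n f : f [::] = 1 -> logtr1 n (nc_inv f) = - logtr1 n f.
Proof.
move=> f1; apply/eqP; rewrite -addr_eq0 -logtr1M ?nc_inv_nil // nc_mulVl //.
by rewrite logtr1_1.
Qed.

Lemma logtr1_comm_prod n (z : J -> N) : (forall j, z j [::] = 0) -> logtr1 n (comm_prod z) = 0.
Proof.
move=> z0; rewrite /comm_prod; pose P f := f [::] = 1 /\ logtr1 n f = 0.
suff [] : P (\prod_j nc_comm (1 + nc_var j) (1 + z j)) by [].
apply: (big_ind P) => [|f g [f1 Ef] [g1 Eg]|j _].
- by split=> //; exact: logtr1_1.
- split; first by rewrite ncpsM_nil f1 g1 mulr1.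
  by rewrite logtr1M // Ef Eg addr0.
have [] := (var1_nil j, add1_nil (z0 j)).
move: (1 + nc_var j) (1 + z j) => f g x1 y1.
split; first exact: nc_comm_nil.
rewrite /nc_comm.
have [fi gi] := (nc_inv_nil x1, nc_inv_nil y1).
have fg1 : (f * g) [::] = 1 by rewrite ncpsM_nil x1 y1 mulr1.
have fgf : (f * g * nc_inv f) [::] = 1 by rewrite ncpsM_nil fg1 fi mulr1.
rewrite (logtr1M _ fgf gi) (logtr1M _ fg1 fi) (logtr1M _ x1 y1) (logtr1V _ x1) (logtr1V _ y1).
by rewrite addrAC addrK subrr.
Qed.

(** By [comm_prod_approx] the error [u - K] is a cyclic mean in every positive degree, hence
    constant on rotation classes. Vanishing invariants force the rotation sums of its lowest term to
    be 0. Together these kill the lowest term, so the induction on the degree shows u = K with no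
    further correction. *)
Lemma logtr1_kernel u : u [::] = 1 -> (forall n, logtr1 n u = 0) ->
  exists2 z : J -> N, (forall j, z j [::] = 0) & u = comm_prod z.
Proof.
move=> u1 Hu; have [z z0 [e0 He0]] := comm_prod_approx u1; exists z => //.
set K := comm_prod z in He0 *; have K1 : K [::] = 1 by exact: comm_prod_nil.
apply/eqP; rewrite -subr_eq0; apply/eqP/vanish_eq0.
suff H n : vanish n.+1 (u - K) by case.
elim: n => [|n IH]; first by apply: vanish1; rewrite ncpsDE ncpsNE u1 K1 subrr.
(* [K] has trivial invariants, so [v] has those of [u]; and v^-1 E(v) agrees with E(e) below degree
   n + 2, one degree beyond the known vanishing of [e]. *)
set e := u - K in IH He0 *; pose v := 1 + nc_inv K * e.
have Ke : vanish n.+1 (nc_inv K * e) by exact: vanishMl.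
have v1 : v [::] = 1 by rewrite /v ncpsDE ncps1E Ke // addr0.
have uE : u = K * v by rewrite /v mulrDr mulr1 mulrA nc_mulV // mul1r addrC subrK.
have trv : tr n (nc_inv v * euler v) = 0.
  have := Hu n; rewrite uE logtr1M // logtr1_comm_prod // add0r; exact.
have ev : euler v = euler (nc_inv K * e) by rewrite /v eulerD euler1 add0r.
have vi1 : vanish 1 (nc_inv v - 1).
  by apply: vanish1; rewrite ncpsDE ncpsNE nc_inv_nil // subrr.
have Ki1 : vanish 1 (nc_inv K - 1).
  by apply: vanish1; rewrite ncpsDE ncpsNE nc_inv_nil // subrr.
have D : vanish n.+2 (nc_inv v * euler v - euler e).
  apply: (@vanish_trans _ _ _ (euler v)).
    have -> : nc_inv v * euler v - euler v = (nc_inv v - 1) * euler v by rewrite mulrBl mul1r.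
    by rewrite -add1n; apply: vanishM => //; rewrite ev; exact: vanish_euler.
  rewrite ev; have -> : euler (nc_inv K * e) - euler e = euler ((nc_inv K - 1) * e).
    apply/eqP; rewrite subr_eq -eulerD mulrBl mul1r subrK //.
  by apply: vanish_euler; rewrite -add1n; exact: vanishM.
have tre : tr n (euler e) = 0.
  rewrite -trv; apply/eqP; rewrite eq_sym -subr_eq0 -raddfB; apply/eqP/tr_local => w wn.
  by apply: D; rewrite wn.
move=> w; rewrite ltnS leq_eqVlt => /orP[/eqP wn|]; last exact: IH.
have w0 : w != [::] by rewrite -size_eq0 wn.
have nz : (n.+1)%:R != 0 :> rat by rewrite pnatr_eq0.
have rot_e : rotsum e w = 0.
  have := tr_rotsum tre wn; rewrite /rotsum.
  have -> : \sum_(k < size w) euler e (rotr k w) = n.+1%:R * \sum_(k < size w) e (rotr k w).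
    by rewrite mulr_sumr; apply: eq_bigr => k _; rewrite /euler size_rotr -wn.
  by move/eqP; rewrite mulf_eq0 (negPf nz) => /eqP.
(* On the n + 1 rotations of [w] the error takes the single value [rotsum e0 w] divided by n + 1;
   summing cancels the denominator. *)
have : rotsum e w = rotsum e0 w.
  rewrite {1}/rotsum.
  under eq_bigr => k _.
    rewrite He0 -?size_eq0 ?size_rotr ?size_eq0 // rotsum_rotr; last exact: ltnW.
    over.
  by rewrite sumr_const card_ord wn -[LHS]mulr_natr mulrAC mulVf // mul1r.
by rewrite He0 // rot_e => <-; rewrite mulr0.
Qed.

Theorem K1_ncps :
  group_isomorphic (K1 N) (nonzero rat * additive_group (seq_prod V))%type.
Proof.
apply: (abelianization_iso K1_invariantM K1_targetC K1_invariant_surj) => x Hx.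
have [y yx Hy] : exists2 y, abel y = abel x & stable_above 1 (GLmx y).
  apply: (@reduce_to_diagonal _ (GLbound x)).
  by apply: stable_aboveW (@GLboundP x); exact: leqnSn.
have {Hx} Hy1 : K1_invariant y = 1%g.
  by rewrite -Hx; apply: (abel_factor K1_invariantM K1_targetC).
have [H1 H2] := K1_invariantE Hy; rewrite Hy1 in H1 H2.
pose u := GLmx y 0 0.
have yu : GLmx y = diag1 u.
  apply/funext => -[|i]; apply/funext => -[|j] //=; by rewrite Hy.
have u1 : u [::] = 1 by move: H1; rewrite /detr det_mx11 !mxE.
have yE : y = diagU u by apply: GLmx_inj; rewrite yu (diagUE u1).1.
have [z z0 uz] : exists2 z : J -> N, (forall j, z j [::] = 0) & u = comm_prod z.
  apply: logtr1_kernel => // n; have := H2 n.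
  rewrite /logtr /mxtr big_ord1 mxE big_ord1 !mxE yE (diagUE u1).1 (diagUE u1).2 /diag1 /=.
  by move=> /esym.
by rewrite -yx yE uz abel_diagU_comm_prod.
Qed.
End LogTrace.

(** * Cyclic coinvariants *)

Lemma malg_basis_ind (K : choiceType) (P : malg K rat -> Prop) : P 0 ->
  (forall a k x, P x -> P (a *: basis_elt k + x)) -> forall x, P x.
Proof.
move=> P0 PD x; rewrite [x]monalgE; elim: (msupp x : seq _) => [|u s IH]; first by rewrite big_nil.
rewrite big_cons; have -> : mkmalgU u (mcoeff u x) = mcoeff u x *: (basis_elt u).
  by apply/malgP => k; rewrite mcoeffZ !mcoeffU mulrnAr mulr1.
exact: PD.
Qed.

Section QuotientLift.
Variables (V W : lmodType rat) (S : set V) (f : {linear V -> W}).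
Hypothesis fS : forall s, S s -> f s = 0.

Definition quot_lift of (forall s, S s -> f s = 0) := fun q : lmod_quot S => f (repr q).
Lemma quot_liftE x : quot_lift fS (lmod_proj S x) = f x.
Proof. by apply: (lmod_proj_lift fS); exact: reprK. Qed.
Lemma quot_lift_is_linear : linear (quot_lift fS).
Proof.
move=> a; elim/lmod_projW => x; elim/lmod_projW => y.
by rewrite -linearP !quot_liftE linearP.
Qed.
HB.instance Definition _ := GRing.isLinear.Build rat (lmod_quot S) W *:%R
  (quot_lift fS) quot_lift_is_linear.
End QuotientLift.

Section RotateFfun.
Variables (T : Type) (n : nat).
Implicit Types u : {ffun 'I_n.+1 -> T}.

Definition rotate_ffun u : {ffun 'I_n.+1 -> T} := [ffun j => u (ordS j)].

Lemma iter_ordS k (j : 'I_n.+1) : (iter k (@ordS _) j : nat) = ((j + k) %% n.+1)%N.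
Proof.
elim: k => [|k IH]; first by rewrite addn0 modn_small.
by rewrite /= IH -addn1 modnDml addn1 addnS.
Qed.

Lemma iter_rotate_ffunE k u j : iter k rotate_ffun u j = u (iter k (@ordS _) j).
Proof. by elim: k j => // k IH j; rewrite /= ffunE IH -iterSr. Qed.

Lemma iter_rotate_ffun u : iter n.+1 rotate_ffun u = u.
Proof.
apply/ffunP => j; rewrite iter_rotate_ffunE; congr (u _); apply: val_inj.
by rewrite [LHS]iter_ordS modnDr modn_small.
Qed.

(** The dictionary between rotations of tuples, used for tensor powers, and rotations of words, used
    for power series. *)
Lemma codom_rotate_ffun u : codom (rotate_ffun u) = rot 1 (codom u).
Proof.
rewrite /codom /image_mem.
rewrite [in RHS]enum_ordSl [in LHS]enum_ordSr /= rot1_cons map_rcons -!map_comp.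
congr rcons; last by rewrite ffunE; congr (u _); apply: val_inj; rewrite /= modnn.
apply: eq_map => i /=; rewrite ffunE; congr (u _); apply: val_inj.
by rewrite /= modn_small // ltnS.
Qed.

Lemma size_codom_ord u : size (codom u) = n.+1.
Proof. by rewrite size_codom card_ord. Qed.

Lemma codom_iter_rotate k u : (k <= n.+1)%N -> codom (iter k rotate_ffun u) = rot k (codom u).
Proof.
elim: k => [|k IH] kn; first by rewrite rot0.
rewrite iterS codom_rotate_ffun IH ?(ltnW kn) //.
by rewrite -rotS ?size_codom_ord.
Qed.
End RotateFfun.

HB.instance Definition _ (H : lmodType rat) n := GRing.isLinear.Build rat
  (tensor_power H n) (tensor_power H n) *:%R (@cyclic_shift H n) (@cyclic_shift_is_linear H n).

Section CyclicTrace.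
Variables (J : finType) (H : lmodType rat) (e : J -> H) (coord : J -> {linear H -> rat^o}).
Hypothesis coordE : forall i j, coord i (e j) = (i == j)%:R.
Hypothesis decomp : forall h, h = \sum_j coord j h *: e j.
Local Notation N := (ncps J).

Section Degree.
Variable n : nat.
Local Notation F := {ffun 'I_n.+1 -> J}.
Implicit Types (u phi : F).

Definition basis_tensor u : cyclic_coinvariants H n.+1 :=
  lmod_proj _ (pure_tensor [ffun i => e (u i)]).

(** The part of degree n + 1 of a series, read as a tensor through X_j |-> e_j and taken modulo
    cyclic permutations. *)
Definition cyc_trace (f : N) : cyclic_coinvariants H n.+1 :=
  \sum_(u : F) f (codom u) *: basis_tensor u.

Lemma cyc_trace_is_linear : linear cyc_trace.
Proof.
move=> a f g; rewrite /cyc_trace scaler_sumr -big_split /=; apply: eq_bigr => u _.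
by rewrite ncpsDE ncpsZE scalerDl scalerA.
Qed.
HB.instance Definition _ := GRing.isLinear.Build rat N (cyclic_coinvariants H n.+1) *:%R
  cyc_trace cyc_trace_is_linear.

Lemma rotate_basis u : rotate [ffun i => e (u i)] = [ffun i => e (rotate_ffun u i)].
Proof. by apply/ffunP => i; rewrite !ffunE. Qed.

Lemma basis_tensor_rotate u : basis_tensor (rotate_ffun u) = basis_tensor u.
Proof.
rewrite /basis_tensor -rotate_basis -cyclic_shift_pure.
by apply/lmod_projP/submod_gen_mem; exists 1%N, (pure_tensor [ffun i => e (u i)]).
Qed.

Lemma basis_tensor_iter k u : basis_tensor (iter k (@rotate_ffun _ _) u) = basis_tensor u.
Proof. by elim: k => //= k IH; rewrite basis_tensor_rotate. Qed.

Lemma iter_rotate_inj k : (k <= n.+1)%N -> injective (iter k (@rotate_ffun J n)).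
Proof.
move=> kn; apply: (can_inj (g := iter (n.+1 - k) (@rotate_ffun J n))) => u.
by rewrite -iterD subnK // iter_rotate_ffun.
Qed.

(** Cutting a word after k letters and swapping the two pieces is the k-fold rotation, which is
    invisible in the coinvariants. *)
Lemma cyc_traceC (f g : N) : cyc_trace (f * g) = cyc_trace (g * f).
Proof.
have E (f' g' : N) : cyc_trace (f' * g') = \sum_(k < n.+2) \sum_(u : F)
    (f' (take k (codom u)) * g' (drop k (codom u))) *: basis_tensor u.
  rewrite exchange_big /=; apply: eq_bigr => u _.
  by rewrite ncpsME size_codom_ord scaler_suml.
rewrite !E [RHS](reindex_inj rev_ord_inj) /=; apply: eq_bigr => k _.
have kn : (k <= n.+1)%N by rewrite -ltnS.
rewrite [RHS](reindex_inj (iter_rotate_inj kn)); apply: eq_bigr => u _.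
rewrite basis_tensor_iter codom_iter_rotate // /rot subSS.
rewrite take_size_cat ?drop_size_cat 1?mulrC // size_drop size_codom_ord //.
Qed.

Lemma cyc_trace_local (f : N) : (forall w, size w = n.+1 -> f w = 0) -> cyc_trace f = 0.
Proof.
by move=> Hf; rewrite /cyc_trace big1 // => u _; rewrite Hf ?size_codom_ord // scale0r.
Qed.

Definition in_image (v : cyclic_coinvariants H n.+1) : Prop :=
  exists2 f : N, cyc_trace f = v & forall w, size w <> n.+1 -> f w = 0.

Lemma in_image_lin a v v' : in_image v -> in_image v' -> in_image (a *: v + v').
Proof.
move=> [f <- f0] [f' <- f'0]; exists (a *: f + f'); first by rewrite linearP.
by move=> w wn; rewrite ncpsDE ncpsZE f0 // f'0 // mulr0 addr0.
Qed.
Lemma in_image0 : in_image 0.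
Proof. by exists 0; rewrite ?linear0. Qed.

Lemma in_image_basis u : in_image (basis_tensor u).
Proof.
exists (fun w => (w == codom u)%:R) => [|w wn]; last first.
  by case: eqP => // E; case: wn; rewrite E size_codom_ord.
rewrite /cyc_trace (bigD1 u) //= eqxx scale1r big1 ?addr0 // => v vu.
case: eqP => [E|_]; last by rewrite scale0r.
case/eqP: vu; apply/ffunP => i.
by have /eq_in_map := E; apply; rewrite mem_enum.
Qed.

(** Multilinear expansion of one slot at a time: in the induction on [k], the slots from [k] on
    already hold basis vectors. *)
Lemma pure_in_image (u : {ffun 'I_n.+1 -> H}) : in_image (lmod_proj _ (pure_tensor u)).
Proof.
have HH k : (k <= n.+1)%N -> forall u : {ffun 'I_n.+1 -> H},
    (forall i : 'I_n.+1, (k <= i)%N -> exists j, u i = e j) ->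
    in_image (lmod_proj _ (pure_tensor u)).
  elim: k => [|k IH] kn v Hv.
    have [phi Hphi] := choice (fun i => Hv i (leq0n i)).
    have -> : v = [ffun i => e ([ffun i => phi i] i)].
      by apply/ffunP => i; rewrite !ffunE.
    exact: in_image_basis.
  pose ik := Ordinal kn.
  have -> : v = subst_at v ik (v ik).
    by apply/ffunP => i; rewrite ffunE; case: eqP => // ->.
  rewrite [X in subst_at _ _ X]decomp.
  have Hbase j : in_image (lmod_proj _ (pure_tensor (subst_at v ik (e j)))).
    apply: IH; first exact: ltnW.
    move=> i ki; rewrite ffunE; case: eqP => [_|/eqP iik]; first by exists j.
    by apply: Hv; rewrite ltn_neqAle ki andbT; move: iik; rewrite -val_eqE /= eq_sym.
  elim/big_rec: _ => [|j h _ Hh].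
    (* The multilinear relation with coefficient 1 and two zero vectors shows that a tensor with a
       zero slot vanishes. *)
    have E := pure_tensorP v ik 1 0 0; rewrite !scale1r addr0 in E.
    have -> : pure_tensor (subst_at v ik 0) = 0.
      apply: (@addrI _ (pure_tensor (subst_at v ik 0))); rewrite addr0; exact: (esym E).
    by rewrite linear0; exact: in_image0.
  rewrite pure_tensorP linearP; apply: in_image_lin; [exact: Hbase|exact: Hh].
by apply: (HH n.+1) => // i; rewrite leqNgt ltn_ord.
Qed.

Lemma cyc_trace_surj v : in_image v.
Proof.
elim/lmod_projW: v => t; elim/lmod_projW: t => x.
elim/malg_basis_ind: x => [|a u x IH]; first by rewrite !linear0; exact: in_image0.
by rewrite !linearP; apply: in_image_lin => //; exact: pure_in_image.
Qed.

Section Functional.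
Variable phi : F.

Definition rot_weight (k : nat) (u : {ffun 'I_n.+1 -> H}) : rat :=
  \prod_i coord (phi i) (iter k (@rotate H n.+1) u i).

(** The dual basis vector of the word [phi], summed over all rotations so that it descends to the
    tensor power and then to the coinvariants. Its value on [cyc_trace f] is [rotsum f (codom phi)],
    which controls the kernel of the trace. *)
Definition rot_functional : malg {ffun 'I_n.+1 -> H} rat -> rat^o :=
  free_ext (fun u : {ffun 'I_n.+1 -> H} => \sum_(k < n.+1) rot_weight k u : rat^o).
HB.instance Definition _ := GRing.Linear.on rot_functional.

Lemma iter_rotate_subst k (u : {ffun 'I_n.+1 -> H}) i h :
  iter k (@rotate H n.+1) (subst_at u i h) =
  subst_at (iter k (@rotate H n.+1) u) (iter k (@ord_pred _) i) h.
Proof. by elim: k => //= k ->; rewrite rotate_subst. Qed.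

Lemma rot_weight_linear k (u : {ffun 'I_n.+1 -> H}) i a h h' :
  rot_weight k (subst_at u i (a *: h + h')) =
  a * rot_weight k (subst_at u i h) + rot_weight k (subst_at u i h').
Proof.
rewrite /rot_weight !iter_rotate_subst; set u' := iter _ _ _; set i' := iter _ _ _.
have E (x : H) : \prod_j coord (phi j) (subst_at u' i' x j) =
    coord (phi i') x * \prod_(j | j != i') coord (phi j) (u' j).
  rewrite (bigD1 i') //= ffunE eqxx; congr (_ * _).
  by apply: eq_bigr => j /negPf ji; rewrite ffunE ji.
by rewrite !E linearP mulrDl mulrA.
Qed.

Lemma rot_functional_multilinear s : @multilinear_relations H n.+1 s -> rot_functional s = 0.
Proof.
move=> [u [i [a [h [k ->]]]]]; rewrite !linearB linearZ /= /rot_functional !free_ext_basis.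
under eq_bigr do rewrite rot_weight_linear.
by rewrite big_split /= -mulr_sumr addrAC addrK subrr.
Qed.

Definition tensor_functional := quot_lift rot_functional_multilinear.
HB.instance Definition _ := GRing.Linear.on tensor_functional.

Lemma tensor_functional_pure (u : {ffun 'I_n.+1 -> H}) : tensor_functional (pure_tensor u) = \sum_(k < n.+1) rot_weight k u.
Proof. by rewrite [LHS](quot_liftE rot_functional_multilinear); exact: free_ext_basis. Qed.

Lemma tensor_functional_shift t : tensor_functional (cyclic_shift t) = tensor_functional t.
Proof.
elim/lmod_projW: t => x; elim/malg_basis_ind: x => [|a u x IH]; first by rewrite !linear0.
rewrite !linearP; congr (_ *: _ + _); last exact: IH.
suff: tensor_functional (cyclic_shift (pure_tensor u)) = tensor_functional (pure_tensor u) by [].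
rewrite cyclic_shift_pure !tensor_functional_pure.
have E k v : rot_weight k (rotate v) = rot_weight k.+1 v by rewrite /rot_weight -iterSr.
under eq_bigr do rewrite E.
(* The shift exchanges the term k = 0 for k = n + 1, and n + 1 rotations are the identity. *)
rewrite big_ord_recr [RHS]big_ord_recl /= addrC; congr (_ + _).
by rewrite /rot_weight (iter_rotate_ffun u).
Qed.

Lemma tensor_functional_coinv s : @coinvariant_relations H n.+1 s -> tensor_functional s = 0.
Proof.
move=> [k [t ->]]; rewrite linearB /=; apply/eqP; rewrite subr_eq0; apply/eqP.
by elim: k => //= k IH; rewrite tensor_functional_shift.
Qed.

Definition coinv_functional := quot_lift tensor_functional_coinv.
HB.instance Definition _ := GRing.Linear.on coinv_functional.

Lemma rot_weight_basis k u : rot_weight k [ffun i => e (u i)] =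
  (iter k (@rotate_ffun _ _) u == phi)%:R.
Proof.
rewrite /rot_weight; set u' := iter k _ u.
have E : iter k (@rotate H n.+1) [ffun i => e (u i)] = [ffun i => e (u' i)].
  by rewrite /u'; elim: k {u'} => //= k ->; rewrite rotate_basis.
rewrite E; under eq_bigr do rewrite ffunE coordE.
case: eqP => [<-|ne]; first by rewrite big1 // => i _; rewrite eqxx.
have [i Hi] : exists i, phi i != u' i.
  apply: contrapT => C; apply: ne; apply/ffunP => i.
  by apply/esym/eqP; apply: contrapT => /negP D; apply: C; exists i.
by rewrite (bigD1 i) //= (negPf Hi) mul0r.
Qed.

Lemma coinv_functional_trace f : coinv_functional (cyc_trace f) = rotsum f (codom phi).
Proof.
rewrite /cyc_trace linear_sum /=.
have E u : coinv_functional (f (codom u) *: basis_tensor u) =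
    \sum_(k < n.+1) f (codom u) * (iter k (@rotate_ffun _ _) u == phi)%:R.
  have Eu : coinv_functional (basis_tensor u) = tensor_functional (pure_tensor [ffun i => e (u i)]).
    exact: (quot_liftE tensor_functional_coinv).
  rewrite linearZ /= Eu tensor_functional_pure.
  by rewrite /GRing.scale /= mulr_sumr; apply: eq_bigr => k _; rewrite rot_weight_basis.
under eq_bigr do rewrite E.
rewrite exchange_big /= /rotsum size_codom_ord; apply: eq_bigr => k _.
have kn : (k <= n.+1)%N by exact: ltnW.
pose u0 := iter (n.+1 - k) (@rotate_ffun _ _) phi.
have u0E : iter k (@rotate_ffun _ _) u0 = phi by rewrite -iterD subnKC // iter_rotate_ffun.
rewrite (bigD1 u0) //= u0E eqxx mulr1 big1 ?addr0 => [|u uu0].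
  by rewrite -[in RHS]u0E codom_iter_rotate // rotK.
case: eqP; rewrite ?mulr0 // => E'.
by case/eqP: uu0; apply: (iter_rotate_inj kn); rewrite E' u0E.
Qed.
End Functional.

Lemma cyc_trace_rotsum f w : cyc_trace f = 0 -> size w = n.+1 -> rotsum f w = 0.
Proof.
case: w => // j w f0 [wn]; pose phi : F := [ffun i : 'I_n.+1 => nth j (j :: w) i].
have -> : j :: w = codom phi.
  apply: (@eq_from_nth _ j) => [|i]; first by rewrite size_codom_ord /= wn.
  rewrite /= wn => lin; rewrite (nth_map ord0) ?size_enum_ord //.
  have -> : nth ord0 (enum 'I_n.+1) i = Ordinal lin by exact: (nth_ord_enum _ (Ordinal lin)).
  by rewrite ffunE.
by rewrite -coinv_functional_trace f0 linear0.
Qed.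
End Degree.

Theorem K1_ncps_coinvariants : group_isomorphic (K1 N)
  (nonzero rat * additive_group
     (seq_prod (fun n : nat => cyclic_coinvariants H n.+1)))%type.
Proof.
apply: (@K1_ncps J (fun n => cyclic_coinvariants H n.+1) (fun n => @cyc_trace n)).
- exact: cyc_traceC.
- exact: cyc_trace_local.
- exact: cyc_trace_rotsum.
- exact: cyc_trace_surj.
Qed.
End CyclicTrace.

(** * Completed group rings of free groups *)

(** Generation gives the uniqueness of extensions, so the universal property is recorded as
    generation plus existence; the two halves are proved by different means. *)
Definition free_group_on (J : Type) (G : groupType) (l : J -> G) : Prop :=
  (forall S : G -> Prop, S 1%g -> (forall j, S (l j)) ->
     (forall x y, S x -> S y -> S (x * y)%g) -> (forall x, S x -> S (x^-1)%g) ->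
     forall x, S x) /\
  (forall (K : groupType) (k : J -> K), exists2 phi : G -> K,
     {morph phi : x y / (x * y)%g} & forall j, phi (l j) = k j).

(** Lets [unit_group] form the group of units of a ring. *)
Definition mul_monoid (R : pzRingType) : Type := R.
HB.instance Definition _ (R : pzRingType) := Choice.on (mul_monoid R).
HB.instance Definition _ (R : pzRingType) := isMonoid.Build (mul_monoid R)
  (@mulrA R) (@mul1r R) (@mulr1 R).

Section AugmentationPowerLemmas.
Variable G : groupType.
Local Notation A := (group_ring G).
Implicit Types (a b x : A).

Lemma gr_scaleAl (c : rat) x y : c *: (x * y : A) = (c *: x : A) * y.
Proof. exact: (esym (gr_mulZl c x y)). Qed.
Lemma gr_scaleAr (c : rat) x y : c *: (x * y : A) = x * (c *: y : A).
Proof. exact: (esym (gr_mulZr c x y)). Qed.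

Lemma aug_powerZ n (c : rat) x :
  x \in @augmentation_power G n -> c *: x \in @augmentation_power G n.
Proof.
by move=> Hx; rewrite -[x]mul1r gr_scaleAl; exact: augmentation_power_mull.
Qed.
Lemma aug_powerM1 n y x : augmentation y = 0 ->
  x \in @augmentation_power G n -> y * x \in @augmentation_power G n.+1.
Proof.
move=> y0 /augmentation_powerP Hx; apply/augmentation_powerP.
by exists [:: (y, x)]; split=> [p|]; rewrite ?inE ?big_seq1 // => /eqP ->.
Qed.
Lemma aug_power_sum n (I : Type) (r : seq I) (F : I -> A) :
  (forall i, F i \in @augmentation_power G n) ->
  \sum_(i <- r) F i \in @augmentation_power G n.
Proof. by move=> HF; apply: rpred_sum. Qed.
Lemma aug_power_approxM n (a b p q t : A) :
  a - p \in @augmentation_power G n -> b - q \in @augmentation_power G n ->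
  t - p * q \in @augmentation_power G n -> a * b - t \in @augmentation_power G n.
Proof.
move=> Ha Hb Ht.
have -> : a * b - t = ((a - p) * b + p * (b - q)) - (t - p * q).
  by rewrite mulrBl mulrBr addrA subrK opprB addrA subrK.
apply: rpredB; last exact: Ht.
by apply: rpredD; [exact: (augmentation_power_mulr b Ha)|exact: (augmentation_power_mull p Hb)].
Qed.
(** Congruence modulo I^n passes to inverses; a left inverse [q] of [p] modulo I^n suffices. *)
Lemma aug_power_approxV n (a b p q : A) : a * b = 1 ->
  a - p \in @augmentation_power G n -> 1 - q * p \in @augmentation_power G n ->
  b - q \in @augmentation_power G n.
Proof.
move=> ab Ha H1.
have -> : b - q = (1 - q * p) * b - q * (a - p) * b.
  rewrite mulrBr !mulrBl mul1r -(mulrA q a) ab mulr1.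
  by rewrite opprB addrA subrK.
apply: rpredB; first exact: (augmentation_power_mulr b H1).
exact: (augmentation_power_mulr b (augmentation_power_mull q Ha)).
Qed.
End AugmentationPowerLemmas.

(** * The Magnus expansion and its inverse on the completion *)

Section Magnus.
Variables (J : finType) (G : groupType) (l : J -> G).
Hypothesis l_gen : forall S : G -> Prop, S 1%g -> (forall j, S (l j)) ->
  (forall x y, S x -> S y -> S (x * y)%g) -> (forall x, S x -> S (x^-1)%g) ->
  forall x, S x.
Local Notation N := (ncps J).
Local Notation A := (group_ring G).
Local Notation Aug n := (@augmentation_power G n).
Variable phi : G -> N.
Hypothesis phiM : {morph phi : x y / (x * y)%g >-> x * y}.
Hypothesis phi1 : phi 1%g = 1.
Hypothesis phi_l : forall j, phi (l j) = 1 + nc_var j.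

Definition magnus (a : A) : N := free_ext phi a.
Lemma magnus_is_linear : linear magnus. Proof. exact: free_ext_is_linear. Qed.
HB.instance Definition _ := GRing.isLinear.Build rat A N *:%R magnus magnus_is_linear.

Lemma magnus_basis g : magnus (basis_elt g) = phi g.
Proof. exact: free_ext_basis. Qed.

Lemma magnus1 : magnus 1 = 1.
Proof. by rewrite -phi1 -magnus_basis. Qed.

Lemma magnusM : {morph magnus : a b / a * b}.
Proof.
move=> a b; elim/free_mod_ind: a => [c x y Hx Hy||g].
- by rewrite mulrDl -gr_scaleAl !magnus_is_linear Hx Hy mulrDl scalerAl.
- by rewrite mul0r linear0 mul0r.
elim/free_mod_ind: b => [c x y Hx Hy||h].
- by rewrite mulrDr -gr_scaleAr !magnus_is_linear Hx Hy mulrDr scalerAr.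
- by rewrite mulr0 linear0 mulr0.
by rewrite [X in magnus X](gr_mul_basis g h) !magnus_basis phiM.
Qed.

Lemma phi_nil g : phi g [::] = 1.
Proof.
apply: (l_gen (S := fun g => phi g [::] = 1)) => [|j|x y Hx Hy|x Hx].
- by rewrite phi1.
- by rewrite phi_l var1_nil.
- by rewrite phiM ncpsM_nil Hx Hy mulr1.
by have := congr1 (fun f : N => f [::]) (phiM x^-1%g x); rewrite mulVg phi1 ncpsM_nil Hx mulr1.
Qed.

Lemma magnus_nil a : magnus a [::] = augmentation a.
Proof.
elim/free_mod_ind: a => [c x y Hx Hy||g].
- by rewrite magnus_is_linear ncpsDE ncpsZE Hx Hy augmentation_linear.
- by rewrite linear0 augmentation0.
by rewrite magnus_basis phi_nil augmentation_basis.
Qed.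

Lemma magnus_aug_power n a : a \in Aug n -> vanish n (magnus a).
Proof.
move=> /augmentation_powerP; elim: n a => [|n IH] a //= [s [Hs ->]].
rewrite raddf_sum /=; rewrite big_seq; apply: big_ind => [//|f g|p /Hs [p1 p2]].
  exact: vanishD.
rewrite magnusM -add1n; apply: vanishM; last exact: IH.
by apply: vanish1; rewrite magnus_nil.
Qed.

Definition gen_minus1 j : A := (basis_elt (l j) : A) - 1.

Lemma gen_minus1_aug j : augmentation (gen_minus1 j) = 0.
Proof.
have := @augmentation_linear G (-1) (1 : A) (basis_elt (l j)).
by rewrite scaleN1r addrC mulN1r !augmentation_basis addNr.
Qed.

(** The terms of [f] of degree less than n, evaluated at X_j |-> [gen_minus1 j] by recursion on the
    first letter. This inverts the Magnus expansion modulo I^n. *)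
Fixpoint truncation n (f : N) : A :=
  if n is m.+1 then
    (f [::] *: (1 : A) : A) + \sum_j gen_minus1 j * truncation m (coef_at j f)
  else 0.

Lemma truncation_is_linear n : linear (truncation n).
Proof.
elim: n => [|n IH] c f g /=; first by rewrite scaler0 addr0.
have E : \sum_j gen_minus1 j * truncation n (coef_at j (c *: f + g)) =
    c *: (\sum_j gen_minus1 j * truncation n (coef_at j f) : A) +
    \sum_j gen_minus1 j * truncation n (coef_at j g).
  rewrite scaler_sumr -big_split; apply: eq_bigr => j _.
  by rewrite [coef_at _ _](_ : _ = c *: coef_at j f + coef_at j g) // IH mulrDr gr_scaleAr.
by rewrite E ncpsDE ncpsZE scalerDl -scalerA scalerDr addrACA.
Qed.
HB.instance Definition _ n := GRing.isLinear.Build rat N A *:%R (truncation n)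
  (@truncation_is_linear n).

Lemma truncation_vanish n f : vanish n f -> truncation n f = 0.
Proof.
elim: n f => // n IH f Hf /=; rewrite Hf // scale0r add0r big1 // => j _.
by rewrite IH ?mulr0 // => w wn; exact: Hf.
Qed.

Lemma truncationS n f : truncation n.+1 f - truncation n f \in Aug n.
Proof.
elim: n f => [|n IH] f; first by apply/augmentation_powerP.
rewrite [truncation n.+2 f]/= [truncation n.+1 f]/= opprD addrACA subrr add0r -sumrB.
apply: aug_power_sum => j; rewrite -mulrBr; apply: aug_powerM1; first exact: gen_minus1_aug.
exact: IH.
Qed.

(** A product of two truncations also has terms of degree n and more, but they lie in I^n. Peeling
    off the first letter of [f] lowers n by one. *)
Lemma truncationM n f g : truncation n (f * g) - truncation n f * truncation n g \in Aug n.
Proof.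
elim: n f => [|n IH] f; first by apply/augmentation_powerP.
have -> : truncation n.+1 (f * g) =
    f [::] *: truncation n.+1 g + \sum_j gen_minus1 j * truncation n (coef_at j f * g).
  rewrite /= ncpsM_nil -scalerA scalerDr -addrA; congr (_ + _).
  rewrite scaler_sumr -big_split; apply: eq_bigr => j _.
  have -> : coef_at j (f * g) = f [::] *: coef_at j g + coef_at j f * g by exact: coef_at_conv.
  by rewrite linearP mulrDr gr_scaleAr.
rewrite [truncation n.+1 f]/= mulrDl -gr_scaleAl mul1r opprD addrACA subrr add0r mulr_suml -sumrB.
apply: aug_power_sum => j; rewrite -mulrA -mulrBr; apply: aug_powerM1; first exact: gen_minus1_aug.
have -> : truncation n (coef_at j f * g) - truncation n (coef_at j f) * truncation n.+1 g =
    (truncation n (coef_at j f * g) - truncation n (coef_at j f) * truncation n g) -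
    truncation n (coef_at j f) * (truncation n.+1 g - truncation n g).
  by rewrite mulrBr opprB addrA subrK.
by apply: rpredB; [exact: IH|apply: augmentation_power_mull; exact: truncationS].
Qed.

Lemma magnus_truncation n f : vanish n (magnus (truncation n f) - f).
Proof.
move=> w wn; rewrite ncpsDE ncpsNE; apply/eqP; rewrite subr_eq0; apply/eqP.
elim: n w f wn => // n IH w f wn; rewrite [truncation _ _]/= magnus_is_linear magnus1 raddf_sum /=.
rewrite ncpsDE ncpsZE ncps_sumE.
have E j : magnus (gen_minus1 j * truncation n (coef_at j f)) =
    nc_var j * magnus (truncation n (coef_at j f)).
  rewrite magnusM; congr (_ * _).
  by rewrite raddfB /= magnus_basis magnus1 phi_l addrC addKr.
under eq_bigr do rewrite E.
case: w wn => [|i w] wn.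
  by rewrite ncps1E mulr1 big1 ?addr0 // => j _; rewrite nc_varM_nil.
rewrite ncps1E mulr0 add0r (bigD1 i) //= nc_varM_cons eqxx mul1r IH // big1 ?addr0 //.
by move=> j /negPf ij; rewrite nc_varM_cons eq_sym ij mul0r.
Qed.

(** By linearity only group elements matter. Those satisfying the congruence form a subgroup, since
    [truncation] is multiplicative modulo I^n and inverses are handled by [aug_power_approxV]; so
    the generators decide. *)
Lemma truncation_magnus n a : a - truncation n (magnus a) \in Aug n.
Proof.
case: n => [|n]; first by apply/augmentation_powerP.
elim/free_mod_ind: a => [c x y Hx Hy||g].
- have -> : c *: x + y - truncation n.+1 (magnus (c *: x + y)) =
    c *: (x - truncation n.+1 (magnus x)) + (y - truncation n.+1 (magnus y)).
    by rewrite magnus_is_linear truncation_is_linear scalerBr opprD addrACA.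
  by apply: rpredD; [exact: (aug_powerZ c Hx)|exact: Hy].
- by rewrite [magnus 0]linear0 [truncation _ _]linear0 subrr rpred0.
have T1 : truncation n.+1 1 = 1.
  rewrite /= ncps1E scale1r big1 ?addr0 // => j _.
  by rewrite [coef_at j 1](_ : _ = 0) ?linear0 ?mulr0.
apply: (l_gen (S := fun g => (basis_elt g : A) - truncation n.+1 (magnus (basis_elt g)) \in Aug n.+1)).
- by rewrite magnus_basis phi1 T1 subrr rpred0.
- move=> j; rewrite magnus_basis phi_l.
  have -> : truncation n.+1 (1 + nc_var j) = truncation n.+1 1 + truncation n.+1 (nc_var j).
    exact: linearD.
  rewrite T1.
  have -> : truncation n.+1 (nc_var j) = gen_minus1 j * truncation n 1.
    rewrite /= scale0r add0r (bigD1 j) //= big1 ?addr0.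
      congr (_ * truncation n _); apply: ncpsP => w.
      by rewrite /coef_at /nc_var eqseq_cons eqxx.
    move=> i /negPf ij; rewrite [coef_at i _](_ : _ = 0) ?linear0 ?mulr0 //.
    by apply: ncpsP => w; rewrite /coef_at /nc_var eqseq_cons ij.
  rewrite opprD addrA -/(gen_minus1 j) -[X in X - _]mulr1 -mulrBr.
  apply: aug_powerM1; first exact: gen_minus1_aug.
  case: n {T1} => [|n]; first by apply/augmentation_powerP.
  have -> : truncation n.+1 1 = 1; last by rewrite subrr rpred0.
  rewrite /= ncps1E scale1r big1 ?addr0 // => i _.
  by rewrite [coef_at i 1](_ : _ = 0) ?linear0 ?mulr0.
- move=> x y Hx Hy.
  have -> : basis_elt (x * y)%g = (basis_elt x : A) * basis_elt y by rewrite -gr_mul_basis.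
  rewrite magnusM; apply: (aug_power_approxM Hx Hy); exact: truncationM.
move=> x Hx.
have ab : (basis_elt x : A) * basis_elt x^-1%g = 1 by rewrite [LHS]gr_mul_basis mulgV.
have ba : (basis_elt x^-1%g : A) * basis_elt x = 1 by rewrite [LHS]gr_mul_basis mulVg.
apply: (aug_power_approxV ab Hx).
by have := truncationM n.+1 (magnus (basis_elt x^-1%g)) (magnus (basis_elt x));
  rewrite -magnusM ba magnus1 T1.
Qed.

Local Notation C := (completed_group_ring G).
Implicit Types (x y : C).

Lemma trunc_projP n (a b : A) : trunc_proj n a = trunc_proj n b <-> a - b \in Aug n.
Proof. by split=> [H|H]; apply/rq_eqP. Qed.

Lemma aug_powerW m p (c : A) : c \in Aug (m + p) -> c \in Aug m.
Proof. by elim: p => [|p IH]; [rewrite addn0|rewrite addnS => /augmentation_power_anti]. Qed.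

Lemma trunc_proj_repr n (q : trunc_ring G n) : trunc_proj n (repr q) = q.
Proof. exact: reprK. Qed.

Lemma compatible_repr x n k : repr (val x (n + k)%N) - repr (val x n) \in Aug n.
Proof.
elim: k => [|k IH]; first by rewrite addn0 subrr rpred0.
have /asboolP/(_ (n + k)%N) Hx := valP x.
rewrite addnS -[X in X - _](subrK (repr (val x (n + k)%N))) -addrA.
apply: rpredD; last exact: IH.
by apply/(@aug_powerW _ k)/trunc_projP; rewrite trunc_proj_repr -Hx.
Qed.

(** The expansion sends I^n to series of order n, so the coefficient at [w] is well defined modulo
    I^n as soon as n exceeds [size w]. *)
Definition completed_magnus x : N := fun w => magnus (repr (val x (size w).+1)) w.

Lemma completed_magnusE x n a : trunc_proj n a = val x n ->
  vanish n (completed_magnus x - magnus a).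
Proof.
rewrite -[val x n]trunc_proj_repr => /trunc_projP Ha w wn.
rewrite ncpsDE ncpsNE /completed_magnus.
set m := (size w).+1; have e : n = (m + (n - m))%N by rewrite subnKC.
have Hm : repr (val x m) - a \in Aug m.
  have := compatible_repr x m (n - m); rewrite -e -[in X in X -> _]opprB rpredN => H.
  rewrite -[X in X - _](subrK (repr (val x n))) -addrA; apply: rpredD; first exact: H.
  by apply: (@aug_powerW _ (n - m)); rewrite -e -opprB rpredN.
have := magnus_aug_power Hm; rewrite [magnus _]linearB; apply; exact: ltnSn.
Qed.

Lemma completed_magnusD : {morph completed_magnus : x y / x + y}.
Proof.
move=> x y; apply/eqP; rewrite -subr_eq0; apply/eqP/vanish_eq0 => n.
have [Hx Hy] : trunc_proj n (repr (val x n)) = val x n /\ trunc_proj n (repr (val y n)) = val y n.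
  by split; exact: reprK.
have Hxy : trunc_proj n (repr (val x n) + repr (val y n)) = val (x + y) n.
  by rewrite trunc_projD Hx Hy.
apply: vanish_trans (completed_magnusE Hxy) _; rewrite raddfD /= opprD addrACA.
by apply: vanishD; apply: vanish_subC; exact: completed_magnusE.
Qed.

Lemma completed_magnusM : {morph completed_magnus : x y / x * y}.
Proof.
move=> x y; apply/eqP; rewrite -subr_eq0; apply/eqP/vanish_eq0 => n.
have [Hx Hy] : trunc_proj n (repr (val x n)) = val x n /\ trunc_proj n (repr (val y n)) = val y n.
  by split; exact: reprK.
have Hxy : trunc_proj n (repr (val x n) * repr (val y n)) = val (x * y) n.
  by rewrite trunc_projM Hx Hy.
apply: vanish_trans (completed_magnusE Hxy) _; rewrite magnusM.
set a := magnus _; set b := magnus _.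
apply: (@vanish_trans _ _ _ (a * completed_magnus y)).
  by rewrite -mulrBr; apply/vanishMl/vanish_subC; exact: completed_magnusE.
by rewrite -mulrBl; apply/vanishMr/vanish_subC; exact: completed_magnusE.
Qed.

Lemma completed_magnus1 : completed_magnus 1 = 1.
Proof.
apply/eqP; rewrite -subr_eq0; apply/eqP/vanish_eq0 => n; rewrite -[X in _ - X]magnus1.
by apply: completed_magnusE; exact: trunc_proj1.
Qed.

Lemma truncation_compatible f : (fun n => trunc_proj n (truncation n f)) \in @compatible G.
Proof.
by apply/asboolP => n; rewrite transition_proj; apply/trunc_projP; exact: truncationS.
Qed.
Definition completed_truncation f : C :=
  exist (fun z : seq_prod (trunc_ring G) => z \in @compatible G) _ (truncation_compatible f).

Lemma completed_truncationK : cancel completed_truncation completed_magnus.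
Proof.
move=> f; apply/eqP; rewrite -subr_eq0; apply/eqP/vanish_eq0 => n.
apply: (@vanish_trans _ _ _ (magnus (truncation n f))); last exact: magnus_truncation.
exact: completed_magnusE.
Qed.

Lemma completed_magnusK : cancel completed_magnus completed_truncation.
Proof.
move=> x; apply: val_inj; apply: functional_extensionality_dep => n /=.
have Hx : trunc_proj n (repr (val x n)) = val x n by exact: reprK.
rewrite -[RHS]Hx; apply/esym/trunc_projP.
have -> : truncation n (completed_magnus x) = truncation n (magnus (repr (val x n))).
  apply/eqP; rewrite -subr_eq0 -raddfB; apply/eqP/truncation_vanish.
  exact: completed_magnusE.
exact: truncation_magnus.
Qed.
End Magnus.

(** * Invariance of [K1] under ring isomorphisms *)

Section K1Functor.
Variables (A B : pzRingType) (f : A -> B) (f' : B -> A).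
Hypotheses (fK : cancel f f') (f'K : cancel f' f).
Hypotheses (fD : {morph f : x y / x + y}) (fM : {morph f : x y / x * y}) (f1 : f 1 = 1).

Definition map_infmx (X : nat -> nat -> A) : nat -> nat -> B := fun i j => f (X i j).

Let f0 : f 0 = 0.
Proof. by apply: (@addrI _ (f 0)); rewrite -fD !addr0. Qed.

Lemma map_infmx_stable n X : stable_above n X -> stable_above n (map_infmx X).
Proof. by move=> H i j /H; rewrite /map_infmx => ->; case: eqP. Qed.

Lemma map_infmx1 : map_infmx (@infmx_one A) = @infmx_one B.
Proof. by apply/funext => i; apply/funext => j; rewrite /map_infmx /infmx_one; case: eqP. Qed.

Lemma map_infmxM n X Y : stable_above n X ->
  map_infmx (infmx_mul X Y) = infmx_mul (map_infmx X) (map_infmx Y).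
Proof.
move=> HX; apply/funext => i; apply/funext => j.
have le1 : (n <= maxn n i.+1)%N by rewrite leq_maxl.
have lt1 : (i < maxn n i.+1)%N by rewrite leq_maxr.
rewrite (infmx_mulE _ _ (map_infmx_stable HX) le1 lt1) /map_infmx (infmx_mulE _ _ HX le1 lt1).
by rewrite (big_morph f fD f0); apply: eq_bigr => k _; rewrite fM.
Qed.

Definition map_GL (x : stable_GL A) : stable_GL B :=
  mkGL (map_infmx (GLmx x)) (map_infmx (GLmxV x)).

Lemma map_GLE x : GLmx (map_GL x) = map_infmx (GLmx x).
Proof.
have [n Hn] := GLmx_stable x; have HV := stable_above_GLmxV Hn.
have [] // := mkGLE (map_infmx_stable Hn) (map_infmx_stable HV).
  by rewrite -(map_infmxM _ Hn) GLmx_mulV map_infmx1.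
by rewrite -(map_infmxM _ HV) GLmx_mulVl map_infmx1.
Qed.

Lemma map_GLM : {morph map_GL : x y / (x * y)%g}.
Proof.
move=> x y; have [n Hn] := GLmx_stable x.
by apply: GLmx_inj; rewrite GLmxM !map_GLE GLmxM (map_infmxM _ Hn).
Qed.
End K1Functor.

Lemma K1_ring_iso (A B : pzRingType) (f : A -> B) (f' : B -> A) (H : groupType) :
  cancel f f' -> cancel f' f ->
  {morph f : x y / x + y} -> {morph f : x y / x * y} -> f 1 = 1 ->
  group_isomorphic (K1 B) H -> group_isomorphic (K1 A) H.
Proof.
move=> fK f'K fD fM f1.
have f'D : {morph f' : x y / x + y} by move=> x y; apply: (can_inj fK); rewrite fD !f'K.
have f'M : {morph f' : x y / x * y} by move=> x y; apply: (can_inj fK); rewrite fM !f'K.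
have f'1 : f' 1 = 1 by rewrite -f1 fK.
apply: (@group_isomorphic_comp _ _ _ (map_GL f) (map_GL f')).
- exact: map_GLM.
- move=> x; apply: GLmx_inj; rewrite !map_GLE //.
  by apply/funext => i; apply/funext => j; rewrite /map_infmx fK.
- move=> x; apply: GLmx_inj; rewrite !map_GLE //.
  by apply/funext => i; apply/funext => j; rewrite /map_infmx f'K.
Qed.

Theorem K1_completed_free (J : finType) (G : groupType) (l : J -> G) (H : groupType) :
  free_group_on l -> group_isomorphic (K1 (ncps J)) H ->
  group_isomorphic (K1 (completed_group_ring G)) H.
Proof.
move=> [l_gen l_univ].
have xP j : (1 + nc_var j : ncps J) * nc_inv (1 + nc_var j) = 1 /\
    nc_inv (1 + nc_var j) * (1 + nc_var j) = 1 by apply: nc_invP; exact: var1_nil.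
have uP j : unit_pred ((1 + nc_var j, nc_inv (1 + nc_var j)) :
    mul_monoid (ncps J) * mul_monoid (ncps J)).
  by apply/andP; split; apply/eqP; [exact: (xP j).1|exact: (xP j).2].
(* The universal property needs a group as target: the elements 1 + X_j are placed in the unit group
   of the power series ring. *)
have [psi psiM psil] := l_univ (unit_group (mul_monoid (ncps J))) (fun j => Sub _ (uP j)).
pose phi g : ncps J := (val (psi g)).1.
have phiM : {morph phi : x y / (x * y)%g >-> x * y} by move=> x y; rewrite /phi psiM.
have phi1 : phi 1%g = 1.
  have psi1 : psi 1%g = 1%g by apply: (mulgI (psi 1%g)); rewrite -psiM !mulg1.
  by rewrite /phi psi1.
have phil j : phi (l j) = 1 + nc_var j by rewrite /phi psil.
apply: (K1_ring_iso (completed_magnusK l_gen phiM phi1 phil) (completed_truncationK l_gen phiM phi1 phil)).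
- exact: (completed_magnusD l_gen phiM phi1 phil).
- exact: (completed_magnusM l_gen phiM phi1 phil).
- exact: (completed_magnus1 l_gen phiM phi1 phil).
Qed.

(** * Paths *)

Section Clamp.
Variable R : realType.
Implicit Types (x y s t : R).

Definition cl x : R := Num.max 0 (Num.min 1 x).

Lemma cl_ge0 x : 0 <= cl x. Proof. by rewrite /cl le_max lexx. Qed.
Lemma cl_le1 x : cl x <= 1. Proof. by rewrite /cl ge_max ler01 ge_min lexx. Qed.
Lemma cl_id x : 0 <= x -> x <= 1 -> cl x = x.
Proof. by move=> x0 x1; rewrite /cl (min_idPr x1) (max_idPr x0). Qed.
Lemma cl_le0 x : x <= 0 -> cl x = 0.
Proof. by move=> x0; rewrite /cl (min_idPr (le_trans x0 ler01)) (max_idPl x0). Qed.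
Lemma cl_ge1 x : 1 <= x -> cl x = 1.
Proof. by move=> x1; rewrite /cl (min_idPl x1) (max_idPr ler01). Qed.
Lemma cl0 : cl 0 = 0. Proof. exact: cl_le0. Qed.
Lemma cl1 : cl 1 = 1. Proof. exact: cl_ge1. Qed.
Lemma cl_spec x : [\/ x <= 0 /\ cl x = 0, 1 <= x /\ cl x = 1 | [/\ 0 <= x, x <= 1 & cl x = x]].
Proof.
have [x0|x0] := lerP x 0; first by constructor 1; rewrite cl_le0.
have [x1|x1] := lerP 1 x; first by constructor 2; rewrite cl_ge1.
by constructor 3; rewrite cl_id ?ltW.
Qed.
Lemma cl_1B x : cl (1 - x) = 1 - cl x.
Proof. by case: (cl_spec x) => -[? ?]; case: (cl_spec (1 - x)) => -[? ?]; lra. Qed.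
Lemma real_of_clampcl x : real_of (clamp x) = cl x. Proof. by []. Qed.

Lemma continuous_cl : continuous cl.
Proof.
apply: (cont_max (f := fun=> 0) (g := fun x => Num.min 1 x)); first exact: cst_continuous.
by move=> x; apply: (@continuous_min R R (fun=> 1) id); [exact: cst_continuous|exact: cvg_id].
Qed.
Lemma cont_cl (T : topologicalType) (f : T -> R) :
  continuous f -> continuous (fun y : T => cl (f y)).
Proof. by move=> cf; apply: (cont_comp cf); exact: continuous_cl. Qed.
Lemma cont_id (T : topologicalType) : continuous (fun y : T => y).
Proof. by move=> y; exact: cvg_id. Qed.
Lemma cont_fst (T U : topologicalType) : continuous (fun z : T * U => z.1).
Proof. by move=> z; exact: cvg_fst. Qed.
Lemma cont_snd (T U : topologicalType) : continuous (fun z : T * U => z.2).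
Proof. by move=> z; exact: cvg_snd. Qed.
End Clamp.

Ltac cont_tac := repeat lazymatch goal with
  | |- continuous (fun _ => ?c) => exact: (@cont_cst _ _ c)
  | |- continuous (fun z => z) => exact: (@cont_id _)
  | |- continuous (fun z => z.1) => exact: (@cont_fst _ _)
  | |- continuous (fun z => z.2) => exact: (@cont_snd _ _)
  | |- continuous (fun z => @?f z - @?g z) => refine (@contB _ _ f g _ _)
  | |- continuous (fun z => @?f z + @?g z) => refine (@contD _ _ f g _ _)
  | |- continuous (fun z => @?f z * @?g z) => refine (@contM _ _ f g _ _)
  | |- continuous (fun z => cl (@?f z)) => refine (@cont_cl _ _ f _)
  | |- continuous (fun z => (@?f z, @?g z)) => refine (@cont_pair _ _ _ f g _ _)
  | |- continuous ( *%R ?c) => refine (@contM _ _ (fun=> c) (fun z => z) _ _)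
  | |- continuous (+%R ?c) => refine (@contD _ _ (fun=> c) (fun z => z) _ _)
  | |- continuous (@cl _) => exact: (@continuous_cl _)
  | |- _ => first [ exact: cont_cst | exact: cont_id | exact: cont_fst | exact: cont_snd ]
  end.

Section RealPaths.
Variables (R : realType) (X : topologicalType).
Implicit Types (a b c d : X) (s t : R).

(* Paths are functions on the whole real line, constant outside [0, 1]. *)
Record rpath a b := RPath {
  rpath_fun :> R -> X;
  rpath_cont : continuous rpath_fun;
  rpath_le0 : forall t, t <= 0 -> rpath_fun t = a;
  rpath_ge1 : forall t, 1 <= t -> rpath_fun t = b }.

Definition hty a b (p q : rpath a b) : Prop := exists F : R * R -> X,
  [/\ continuous F, forall t, F (0, t) = p t, forall t, F (1, t) = q t,
      forall s t, t <= 0 -> F (s, t) = a & forall s t, 1 <= t -> F (s, t) = b].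

Lemma rpath0 a b (p : rpath a b) : p 0 = a. Proof. exact: rpath_le0. Qed.
Lemma rpath1 a b (p : rpath a b) : p 1 = b. Proof. exact: rpath_ge1. Qed.
Lemma rpath_cl a b (p : rpath a b) t : p (cl t) = p t.
Proof.
case: (cl_spec t) => -[h E]; last by move=> ->.
- by rewrite E !rpath_le0.
- by rewrite E !rpath_ge1.
Qed.

(** Two reparametrisations of one map [f] are joined by linear interpolation of the parameters; the
    last two conditions keep the ends fixed. The groupoid laws below come down to this. *)
Lemma hty_reparam_gen a b (p q : rpath a b) (f : R -> X) (phi psi : R -> R) :
  continuous f -> continuous phi -> continuous psi ->
  (forall t, p t = f (phi t)) -> (forall t, q t = f (psi t)) ->
  (forall s t, 0 <= s -> s <= 1 -> t <= 0 -> f ((1 - s) * phi t + s * psi t) = a) ->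
  (forall s t, 0 <= s -> s <= 1 -> 1 <= t -> f ((1 - s) * phi t + s * psi t) = b) ->
  hty p q.
Proof.
move=> cf cphi cpsi Hp Hq H0 H1.
exists (fun z => f ((1 - cl z.1) * phi z.2 + cl z.1 * psi z.2)); split.
- apply: (cont_comp _ cf); cont_tac.
    exact: (cont_comp (@cont_snd R R) cphi).
  exact: (cont_comp (@cont_snd R R) cpsi).
- by move=> t; rewrite /= cl0 subr0 mul1r mul0r addr0.
- by move=> t; rewrite /= cl1 subrr mul1r mul0r add0r.
- by move=> s t t0 /=; apply: H0; rewrite ?cl_ge0 ?cl_le1.
- by move=> s t t0 /=; apply: H1; rewrite ?cl_ge0 ?cl_le1.
Qed.

Lemma hty_reparam_eq a b (p q : rpath a b) (f : R -> X) (phi psi : R -> R) :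
  continuous f -> continuous phi -> continuous psi ->
  (forall t, p t = f (phi t)) -> (forall t, q t = f (psi t)) ->
  (forall t, t <= 0 -> phi t = psi t) -> (forall t, 1 <= t -> phi t = psi t) ->
  hty p q.
Proof.
move=> cf cphi cpsi Hp Hq H0 H1; apply: (hty_reparam_gen cf cphi cpsi Hp Hq) => s t _ _ ht.
- by rewrite H0 // -mulrDl subrK mul1r -Hq rpath_le0.
- by rewrite H1 // -mulrDl subrK mul1r -Hq rpath_ge1.
Qed.

Lemma hty_reparam_path a b (p q f : rpath a b) (phi psi : R -> R) :
  continuous phi -> continuous psi ->
  (forall t, p t = f (phi t)) -> (forall t, q t = f (psi t)) ->
  (forall t, t <= 0 -> phi t <= 0 /\ psi t <= 0) ->
  (forall t, 1 <= t -> 1 <= phi t /\ 1 <= psi t) ->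
  hty p q.
Proof.
move=> cphi cpsi Hp Hq H0 H1; apply: (hty_reparam_gen (@rpath_cont _ _ f) cphi cpsi Hp Hq).
- move=> s t s0 s1 /H0[h1 h2]; apply: rpath_le0; nra.
- move=> s t s0 s1 /H1[h1 h2]; apply: rpath_ge1; nra.
Qed.

Lemma hty_ext a b (p q : rpath a b) : (forall t, p t = q t) -> hty p q.
Proof.
by move=> pq; apply: (@hty_reparam_path _ _ p q q id id) => // *; exact: cont_id.
Qed.
Lemma hty_refl a b (p : rpath a b) : hty p p. Proof. exact: hty_ext. Qed.
Lemma hty_sym a b (p q : rpath a b) : hty p q -> hty q p.
Proof.
move=> [F [cF F0 F1 Fa Fb]]; exists (fun z => F (1 - z.1, z.2)); split=> //=.
- by apply: (cont_comp _ cF); cont_tac.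
- by move=> t; rewrite subr0.
- by move=> t; rewrite subrr.
- by move=> s t; exact: Fa.
- by move=> s t; exact: Fb.
Qed.
Lemma hty_trans a b (p q r : rpath a b) : hty p q -> hty q r -> hty p r.
Proof.
move=> [F [cF F0 F1 Fa Fb]] [G [cG G0 G1 Ga Gb]].
exists (fun z => if z.1 <= 2^-1 then F (cl (2 * z.1), z.2) else G (cl (2 * z.1 - 1), z.2)); split.
- apply: paste_continuous; first exact: cont_fst.
  + by apply: (cont_comp _ cF); cont_tac.
  + by apply: (cont_comp _ cG); cont_tac.
  + by move=> z ->; rewrite mulfV ?pnatr_eq0 // subrr cl1 cl0 F1 G0.
- by move=> t /=; rewrite invr_ge0 ler0n mulr0 cl0 F0.
- move=> t /=; rewrite ifF; last by apply/negbTE; rewrite -ltNge; lra.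
  by rewrite cl_ge1 ?G1 //; lra.
- by move=> s t t0 /=; case: ifP => _; rewrite ?Fa ?Ga.
- by move=> s t t0 /=; case: ifP => _; rewrite ?Fb ?Gb.
Qed.

Definition pcst a : rpath a a :=
  RPath (@cont_cst R X a) (fun _ _ => erefl) (fun _ _ => erefl).

Section Cat.
Variables (a b c : X) (p : rpath a b) (q : rpath b c).
Definition pcat_fun t : X := if t <= 2^-1 then p (2 * t) else q (2 * t - 1).
Lemma pcat_cont : continuous pcat_fun.
Proof.
apply: paste_continuous; first exact: cont_id.
- by apply: (cont_comp _ (@rpath_cont _ _ p)); cont_tac.
- by apply: (cont_comp _ (@rpath_cont _ _ q)); cont_tac.
- by move=> t ->; rewrite mulfV ?pnatr_eq0 // subrr rpath0 rpath1.
Qed.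
Lemma pcat_le0 t : t <= 0 -> pcat_fun t = a.
Proof.
by move=> t0; rewrite /pcat_fun ifT; [apply: rpath_le0|]; lra.
Qed.
Lemma pcat_ge1 t : 1 <= t -> pcat_fun t = c.
Proof.
move=> t1; rewrite /pcat_fun ifF; first by apply: rpath_ge1; lra.
by apply/negbTE; rewrite -ltNge; lra.
Qed.
Definition pcat : rpath a c := RPath pcat_cont pcat_le0 pcat_ge1.
End Cat.

Section Rev.
Variables (a b : X) (p : rpath a b).
Lemma prev_cont : continuous (fun t => p (1 - t)).
Proof. by apply: (cont_comp _ (@rpath_cont _ _ p)); cont_tac. Qed.
Lemma prev_le0 t : t <= 0 -> p (1 - t) = b.
Proof. by move=> t0; apply: rpath_ge1; lra. Qed.
Lemma prev_ge1 t : 1 <= t -> p (1 - t) = a.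
Proof. by move=> t0; apply: rpath_le0; lra. Qed.
Definition prev : rpath b a := RPath prev_cont prev_le0 prev_ge1.
End Rev.

Lemma hty_cat a b c (p p' : rpath a b) (q q' : rpath b c) :
  hty p p' -> hty q q' -> hty (pcat p q) (pcat p' q').
Proof.
move=> [F [cF F0 F1 Fa Fb]] [G [cG G0 G1 Ga Gb]].
exists (fun z => if z.2 <= 2^-1 then F (z.1, 2 * z.2) else G (z.1, 2 * z.2 - 1)); split.
- apply: paste_continuous; first exact: cont_snd.
  + by apply: (cont_comp _ cF); cont_tac.
  + by apply: (cont_comp _ cG); cont_tac.
  + by move=> z ->; rewrite mulfV ?pnatr_eq0 // subrr Fb // Ga.
- by move=> t /=; rewrite /pcat_fun F0 G0.
- by move=> t /=; rewrite /pcat_fun F1 G1.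
- by move=> s t t0 /=; rewrite ifT; [apply: Fa|]; lra.
- move=> s t t0 /=; rewrite ifF; first by apply: Gb; lra.
  by apply/negbTE; rewrite -ltNge; lra.
Qed.

Lemma pcatA a b c d (p : rpath a b) (q : rpath b c) (r : rpath c d) :
  hty (pcat p (pcat q r)) (pcat (pcat p q) r).
Proof.
(* The change of parameter between the two bracketings has slopes 1/2, 1, 2 and breaks at 1/2 and
   3/4. It is convex, hence a maximum of affine maps, which makes continuity immediate. *)
pose m (x : R) := Num.max (2^-1 * x) (Num.max (x - 4^-1) (2 * x - 1)).
apply: (@hty_reparam_path _ _ _ _ (pcat (pcat p q) r) m id).
- by apply: cont_max; [|apply: cont_max]; cont_tac.
- exact: cont_id.
- move=> t; rewrite /= /pcat_fun /= /pcat_fun.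
  have mE : m t = if t <= 2^-1 then 2^-1 * t else
                  if t <= 3 / 4 then t - 4^-1 else 2 * t - 1.
    by case: (max3_spec (erefl (m t))) => -[-> ? ?];
      (case: lerP => ?; [|case: lerP => ?]); lra.
  rewrite mE; have [h1|h1] := lerP t 2^-1.
    by rewrite !ifT; [congr (p _)|..]; lra.
  have [h2|h2] := lerP t (3 / 4).
    have -> : 2 * t - 1 <= 2^-1 by lra.
    have -> : t - 4^-1 <= 2^-1 by lra.
    have /lt_geF -> : 2^-1 < 2 * (t - 4^-1) by lra.
    by congr (q _); lra.
  by have /lt_geF -> : 2^-1 < 2 * t - 1 by lra.
- by [].
- by move=> t t0; split=> //; case: (max3_spec (erefl (m t))) => -[-> ? ?]; lra.
- by move=> t t0; split=> //; case: (max3_spec (erefl (m t))) => -[-> ? ?]; lra.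
Qed.

Lemma pcat1p a b (p : rpath a b) : hty (pcat (pcst a) p) p.
Proof.
apply: (@hty_reparam_path _ _ _ _ p (fun t => Num.max 0 (2 * t - 1)) id) => //.
- by apply: cont_max; cont_tac.
- exact: cont_id.
- move=> t; rewrite /= /pcat_fun /=; case: lerP => h.
    by rewrite rpath_le0 //; rewrite /Num.max; case: ltP => ?; lra.
  by congr (p _); rewrite /Num.max; case: ltP => ?; lra.
- by move=> t t0; split=> //; rewrite /Num.max; case: ltP => ?; lra.
- by move=> t t0; split=> //; rewrite /Num.max; case: ltP => ?; lra.
Qed.

Lemma pcatp1 a b (p : rpath a b) : hty (pcat p (pcst b)) p.
Proof.
apply: (@hty_reparam_path _ _ _ _ p (fun t => 2 * t - Num.max 0 (2 * t - 1)) id) => //.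
- by apply: contB; [|apply: cont_max]; cont_tac.
- exact: cont_id.
- move=> t; rewrite /= /pcat_fun /=; case: lerP => h.
    by congr (p _); rewrite /Num.max; case: ltP => ?; lra.
  by rewrite rpath_ge1 //; rewrite /Num.max; case: ltP => ?; lra.
- by move=> t t0; split=> //; rewrite /Num.max; case: ltP => ?; lra.
- by move=> t t0; split=> //; rewrite /Num.max; case: ltP => ?; lra.
Qed.

Lemma pcatpV a b (p : rpath a b) : hty (pcat p (prev p)) (pcst a).
Proof.
(* A tent function, rising to 1 on the first half and returning to 0 on the second, is contracted to
   0. *)
apply: (@hty_reparam_eq _ _ _ _ p (fun t => cl (2 * t) - cl (2 * t - 1)) (fun=> 0)).
- exact: rpath_cont.
- by cont_tac.
- by cont_tac.
- move=> t; rewrite /= /pcat_fun /=; case: lerP => h.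
    by rewrite [cl (_ - 1)]cl_le0 ?subr0 ?rpath_cl //; lra.
  by rewrite [cl (2 * t)]cl_ge1 -?cl_1B ?rpath_cl //; lra.
- by move=> t; rewrite rpath0.
- by move=> t t0; rewrite !cl_le0 ?subrr //; lra.
- by move=> t t0; rewrite !cl_ge1 ?subrr //; lra.
Qed.

Lemma pcatVp a b (p : rpath a b) : hty (pcat (prev p) p) (pcst b).
Proof.
apply: hty_trans (pcatpV (prev p)); apply: hty_cat; first exact: hty_refl.
by apply: hty_ext => t /=; congr (p _); lra.
Qed.

Section Segment.
Variables (f : R -> X) (cf : continuous f).
Lemma pseg_cont (u v : R) : continuous (fun t => f (u + cl t * (v - u))).
Proof. by apply: (cont_comp _ cf); cont_tac. Qed.
Lemma pseg_le0 (u v : R) t : t <= 0 -> f (u + cl t * (v - u)) = f u.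
Proof. by move=> t0; rewrite cl_le0 // mul0r addr0. Qed.
Lemma pseg_ge1 (u v : R) t : 1 <= t -> f (u + cl t * (v - u)) = f v.
Proof. by move=> t0; rewrite cl_ge1 // mul1r addrC subrK. Qed.
Definition pseg u v : rpath (f u) (f v) :=
  RPath (@pseg_cont u v) (@pseg_le0 u v) (@pseg_ge1 u v).

Lemma pseg_cat u v w : hty (pcat (pseg u v) (pseg v w)) (pseg u w).
Proof.
apply: (@hty_reparam_eq _ _ _ _ f (fun t => u + cl (2 * t) * (v - u) + cl (2 * t - 1) * (w - v))
  (fun t => u + cl t * (w - u))); rewrite //.
- by cont_tac.
- by cont_tac.
- move=> t; rewrite /= /pcat_fun /=; case: lerP => h.
    by rewrite [cl (_ - 1)]cl_le0 ?mul0r ?addr0 //; lra.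
  by rewrite [cl (2 * t)]cl_ge1 ?mul1r; [congr (f _); ring|lra].
- by move=> t t0; rewrite !cl_le0 ?mul0r ?addr0 //; lra.
- by move=> t t0; rewrite !cl_ge1 ?mul1r; [ring|lra..].
Qed.

End Segment.
End RealPaths.

(** * Holonomy *)

Section Subdivision.
Variables (R : realType) (X : topologicalType) (I : Type) (U : I -> set X).
Hypothesis Uopen : forall i, open (U i).
Hypothesis Ucover : forall x, exists i, U i x.

(** The Lebesgue number lemma on the unit square. Compactness in near-covering form turns a bound
    that holds near each point for large n into one n for all points. *)
Lemma lebesgue_grid (F : R * R -> X) : continuous F ->
  exists N, forall n, (N <= n)%N -> forall s t : R, 0 <= s <= 1 -> 0 <= t <= 1 ->
    exists i, forall s' t', `|s' - s| <= n.+1%:R^-1 -> `|t' - t| <= n.+1%:R^-1 -> U i (F (s', t')).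
Proof.
move=> cF.
pose P (n : nat) (z : R * R) := exists i, forall s' t',
  `|s' - z.1| <= n.+1%:R^-1 -> `|t' - z.2| <= n.+1%:R^-1 -> U i (F (s', t')).
have K : compact (`[0, 1]%classic `*` `[0, 1]%classic : set (R * R)).
  by apply: compact_setX; exact: segment_compact.
have H : \forall n \near \oo, (`[0, 1]%classic `*` `[0, 1]%classic : set (R * R)) `<=` P n.
  move/compact_near_coveringP: K; apply=> -[s t] _.
  have [i Ui] := Ucover (F (s, t)).
  have : nbhs (s, t) (F @^-1` U i) by apply: cF; apply: open_nbhs_nbhs; split.
  move=> /nbhs_ballP[e /= e0 He].
  have e2 : 0 < e / 2 by apply: divr_gt0.
  exists (ball (s, t) (e / 2), [set n | n.+1%:R^-1 < e / 2 :> R]) => /=.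
    split; first exact: nbhsx_ballx.
    exact: (near_infty_natSinv_lt (PosNum e2)).
  move=> [[s1 t1] n] [/= [b1 b2] ne]; exists i => s' t' /= hs ht; apply: He.
  have {}b1 : `|s - s1| < e / 2 by [].
  have {}b2 : `|t - t1| < e / 2 by [].
  have {}ne : n.+1%:R^-1 < e / 2 by [].
  split; rewrite /ball /=.
    rewrite (_ : s - s' = (s - s1) - (s' - s1)); last by ring.
    by apply: le_lt_trans (ler_normB _ _) _; rewrite [ltRHS]splitr; exact: ltrD b1 (le_lt_trans hs ne).
  rewrite (_ : t - t' = (t - t1) - (t' - t1)); last by ring.
  by apply: le_lt_trans (ler_normB _ _) _; rewrite [ltRHS]splitr; exact: ltrD b2 (le_lt_trans ht ne).
case: H => N _ HN; exists N => n Nn s t s01 t01.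
by apply: (HN n Nn (s, t)); split; rewrite /= in_itv.
Qed.

Definition grid_point (n k : nat) : R := k%:R / n%:R.
Definition subordinate (f : R -> X) (n : nat) : Prop := forall k, (k < n)%N ->
  exists i, forall t, grid_point n k <= t -> t <= grid_point n k.+1 -> U i (f t).

Lemma grid_point01 n k : (k <= n)%N -> (0 < n)%N -> 0 <= grid_point n k <= 1.
Proof.
move=> kn n0; rewrite /grid_point divr_ge0 ?ler0n //= ler_pdivrMr ?ltr0n // mul1r ler_nat //.
Qed.
Lemma grid_pointS n k : (0 < n)%N -> grid_point n k.+1 = grid_point n k + n%:R^-1.
Proof. by move=> n0; rewrite /grid_point -natr1 mulrDl mul1r. Qed.
Lemma grid_point_le n k l : (k <= l)%N -> grid_point n k <= grid_point n l.
Proof. by move=> kl; rewrite /grid_point ler_wpM2r ?invr_ge0 ?ler0n // ler_nat. Qed.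

Lemma grid_subordinate (F : R * R -> X) : continuous F ->
  exists N, forall n, (N <= n)%N -> (0 < n)%N /\ forall k l, (k < n)%N -> (l < n)%N ->
    exists i, forall s t, grid_point n k <= s -> s <= grid_point n k.+1 ->
      grid_point n l <= t -> t <= grid_point n l.+1 -> U i (F (s, t)).
Proof.
move=> /lebesgue_grid[N HN]; exists N.+1 => -[//|n] Nn; split=> // k l kn ln.
have [i Hi] := HN n Nn _ _ (grid_point01 (ltnW kn) (ltn0Sn n)) (grid_point01 (ltnW ln) (ltn0Sn n)).
have i0 : 0 <= n.+1%:R^-1 :> R by rewrite invr_ge0.
exists i => s t; rewrite !grid_pointS // => h1 h2 h3 h4.
by apply: Hi; rewrite ler_distl lerBlDr ler_wpDr.
Qed.

Lemma path_subordinate (f : R -> X) : continuous f ->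
  exists N, forall n, (N <= n)%N -> (0 < n)%N /\ subordinate f n.
Proof.
move=> cf; have [|N HN] := @grid_subordinate (fun z => f z.2).
  by apply: (cont_comp _ cf); cont_tac.
exists N => n /HN[n0 H]; split=> // k kn; have [i Hi] := H k k kn kn.
by exists i => t h1 h2; apply: (Hi (grid_point n k)) => //; exact: grid_point_le.
Qed.

Section Holonomy.
Variables (G : groupType) (c : X -> X -> G).
(** The identity is required only inside one member of the cover; between points that share no
    member [c] may be anything. *)
Hypothesis coc : forall i x y z, U i x -> U i y -> U i z -> (c x y * c y z)%g = c x z.

Lemma cocycle_refl x : c x x = 1%g.
Proof. by have [i Ui] := Ucover x; apply: (mulgI (c x x)); rewrite (coc Ui) // mulg1. Qed.

Definition hol_sum (f : R -> X) (n : nat) : G :=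
  (\prod_(0 <= k < n) c (f (grid_point n k)) (f (grid_point n k.+1)))%g.

Lemma cocycle_telescope i (x : nat -> X) m : (forall k, (k <= m)%N -> U i (x k)) ->
  (\prod_(0 <= k < m) c (x k) (x k.+1))%g = c (x 0%N) (x m).
Proof.
elim: m => [|m IH] H; first by rewrite big_nil cocycle_refl.
rewrite big_nat_recr //= IH; last by move=> k km; apply: H; exact: leqW.
by apply: (@coc i); apply: H.
Qed.

(** On each of the n old intervals the curve stays in one member of the cover, so its m new factors
    telescope. *)
Lemma hol_sum_refine f n m : (0 < n)%N -> (0 < m)%N -> subordinate f n ->
  hol_sum f (n * m) = hol_sum f n.
Proof.
move=> n0 m0 Hf.
have E k : grid_point (n * m) (k * m) = grid_point n k.
  by rewrite /grid_point !natrM -mulf_div divff ?mulr1 // pnatr_eq0 -lt0n.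
have H i : (i <= n)%N ->
    (\prod_(0 <= k < i * m) c (f (grid_point (n * m) k)) (f (grid_point (n * m) k.+1)))%g =
    (\prod_(0 <= k < i) c (f (grid_point n k)) (f (grid_point n k.+1)))%g.
  elim: i => [|i IH] lin; first by rewrite mul0n !big_nil.
  rewrite [RHS]big_nat_recr //= -IH ?(ltnW lin) //.
  rewrite (@big_cat_nat _ _ _ (i * m)) //=; last by rewrite leq_mul2r leqnSn orbT.
  congr (_ * _)%g.
  have [a Ha] := Hf i lin.
  rewrite -{1}[(i * m)%N]add0n big_addn mulSn addnK.
  rewrite (@cocycle_telescope a (fun k => f (grid_point (n * m) (k + i * m)))).
    by rewrite add0n -mulSn !E.
  move=> k km; apply: Ha; rewrite -E; apply: grid_point_le; first exact: leq_addl.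
  by rewrite mulSn leq_add2r.
exact: H.
Qed.

(** Any subordinate subdivision gives the same value: sizes n and m are compared through n * m. *)
Definition holonomy (f : R -> X) : G :=
  hol_sum f (xget 1%N [set n | (0 < n)%N /\ subordinate f n]).

Lemma holonomyE f n : (0 < n)%N -> subordinate f n -> holonomy f = hol_sum f n.
Proof.
move=> n0 Hn; rewrite /holonomy; set S := [set n | _].
have [m0 Hm] : S (xget 1%N S) by apply: xgetPex; exists n.
by rewrite -(hol_sum_refine m0 n0 Hm) mulnC hol_sum_refine.
Qed.

Lemma holonomy_local f i : (forall t, 0 <= t -> t <= 1 -> U i (f t)) ->
  holonomy f = c (f 0) (f 1).
Proof.
move=> Hf; rewrite (@holonomyE _ 1) //.
  by rewrite /hol_sum big_nat1 /grid_point mul0r divr1.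
move=> [|//] _; exists i => t; rewrite /grid_point mul0r divr1 => t0 t1; exact: Hf.
Qed.

Lemma holonomy_cst a : holonomy (pcst R a) = 1%g.
Proof.
have [i Ui] := Ucover a.
by rewrite (@holonomy_local _ i) // cocycle_refl.
Qed.

Lemma holonomy_cat a b d (p : rpath R a b) (q : rpath R b d) :
  holonomy (pcat p q) = (holonomy p * holonomy q)%g.
Proof.
have [N1 H1] := path_subordinate (@rpath_cont _ _ _ _ p).
have [N2 H2] := path_subordinate (@rpath_cont _ _ _ _ q).
have [N3 H3] := path_subordinate (@rpath_cont _ _ _ _ (pcat p q)).
pose n := maxn N1 (maxn N2 N3).
have [n0 Hp] : (0 < n)%N /\ subordinate p n by apply: H1; rewrite /n; lia.
have [_ Hq] : (0 < n)%N /\ subordinate q n by apply: H2; rewrite /n; lia.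
have [nn0 Hpq] : (0 < n + n)%N /\ subordinate (pcat p q) (n + n) by apply: H3; rewrite /n; lia.
rewrite (holonomyE n0 Hp) (holonomyE n0 Hq) (holonomyE nn0 Hpq) /hol_sum.
have nz : n%:R != 0 :> R by rewrite pnatr_eq0 -lt0n.
have npos : 0 < n%:R :> R by rewrite ltr0n.
have nn : (n%:R + n%:R)^-1 = 2^-1 * n%:R^-1 :> R by rewrite -mulr2n -[n%:R *+ 2]mulr_natl invfM.
have Ep k : (k <= n)%N -> pcat p q (grid_point (n + n) k) = p (grid_point n k).
  move=> kn; rewrite /= /pcat_fun /grid_point natrD.
  have e : k%:R / (n%:R + n%:R) = 2^-1 * (k%:R / n%:R) :> R by rewrite nn mulrCA.
  have k1 : k%:R / n%:R <= 1 :> R by rewrite ler_pdivrMr // mul1r ler_nat.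
  rewrite e; move: (k%:R / n%:R) k1 => x x1; rewrite ifT; last by lra.
  by congr (p _); lra.
have Eq k : pcat p q (grid_point (n + n) (k + n)) = q (grid_point n k).
  rewrite /= /pcat_fun /grid_point !natrD.
  have e : (k%:R + n%:R) / (n%:R + n%:R) = 2^-1 * (k%:R / n%:R) + 2^-1 :> R.
    by rewrite nn mulrDl mulrCA [n%:R * _]mulrCA divff // mulr1.
  have k0 : 0 <= k%:R / n%:R :> R by apply: divr_ge0; rewrite ler0n.
  rewrite e; move: (k%:R / n%:R) k0 => x x0; case: ifP => h; last by congr (q _); lra.
  have -> : x = 0 by lra.
  by rewrite rpath0 mulr0 add0r mulfV ?pnatr_eq0 // rpath1.
rewrite (@big_cat_nat _ _ _ n) ?leq_addr //; congr (_ * _)%g.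
  by apply: eq_big_nat => k /andP[_ kn]; rewrite !Ep // ltnW.
rewrite -{1}[n]add0n big_addn addnK; apply: eq_big_nat => k _.
by rewrite -addSn !Eq.
Qed.

(** On a fine grid every small square lies in one member of the cover, so consecutive rows differ
    only by the vertical factors at the two ends; these are trivial because the ends are fixed. *)
Lemma holonomy_hty a b (p q : rpath R a b) : hty p q -> holonomy p = holonomy q.
Proof.
move=> [F [cF F0 F1 Fa Fb]].
have [N1 H1] := path_subordinate (@rpath_cont _ _ _ _ p).
have [N2 H2] := path_subordinate (@rpath_cont _ _ _ _ q).
have [N3 H3] := grid_subordinate cF.
pose n := maxn N1 (maxn N2 N3).
have [n0 Hp] : (0 < n)%N /\ subordinate p n by apply: H1; rewrite /n; lia.
have [_ Hq] : (0 < n)%N /\ subordinate q n by apply: H2; rewrite /n; lia.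
have [_ HF] := H3 n ltac:(rewrite /n; lia).
rewrite (holonomyE n0 Hp) (holonomyE n0 Hq).
have g0 : grid_point n 0 = 0 by rewrite /grid_point mul0r.
have gn : grid_point n n = 1 by rewrite /grid_point divff // pnatr_eq0 -lt0n.
pose Frow i t := F (grid_point n i, t).
have le k : grid_point n k <= grid_point n k.+1 by exact: grid_point_le.
have row i : (i < n)%N -> hol_sum (Frow i) n = hol_sum (Frow i.+1) n.
  move=> lin; pose f := Frow i; pose g := Frow i.+1; pose x k := grid_point n k.
  have H j : (j <= n)%N ->
      ((\prod_(0 <= k < j) c (f (x k)) (f (x k.+1))) * c (f (x j)) (g (x j)) =
       c (f (x 0%N)) (g (x 0%N)) * \prod_(0 <= k < j) c (g (x k)) (g (x k.+1)))%g.
    elim: j => [|j IH] jn; first by rewrite !big_nil mul1g mulg1.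
    have [a0 Ha] := HF i j lin jn.
    rewrite !big_nat_recr //= -mulgA [RHS]mulgA -IH ?(ltnW jn) // -mulgA; congr (_ * _)%g.
    by rewrite (@coc a0) ?(@coc a0) //; apply: Ha.
  have := H n (leqnn n); rewrite /x g0 gn.
  rewrite /f /g /Frow !(Fa _ 0 (lexx 0)) !(Fb _ 1 (lexx 1)) !cocycle_refl mulg1 mul1g; exact.
have all i : (i <= n)%N -> hol_sum (Frow i) n = hol_sum (Frow 0%N) n.
  by elim: i => // i IH lin; rewrite -row // IH // ltnW.
have -> : hol_sum p n = hol_sum (Frow 0%N) n.
  by apply: eq_bigr => k _; rewrite /Frow g0 !F0.
rewrite -(all n) //; apply: eq_bigr => k _; by rewrite /Frow gn !F1.
Qed.

Lemma holonomy_rev a b (p : rpath R a b) : holonomy (prev p) = (holonomy p)^-1%g.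
Proof.
by apply: (mulgI (holonomy p)); rewrite mulgV -holonomy_cat (holonomy_hty (pcatpV p)) holonomy_cst.
Qed.
End Holonomy.
End Subdivision.

(** * Path algebra up to homotopy *)

Section HtyInstances.
Variables (R : realType) (X : topologicalType).
#[local] Instance hty_equivalence a b : RelationClasses.Equivalence (@hty R X a b).
Proof.
split; [exact: hty_refl|exact: hty_sym|exact: hty_trans].
Qed.
#[local] Instance pcat_proper a b c :
  Morphisms.Proper (Morphisms.respectful (@hty R X a b)
    (Morphisms.respectful (@hty R X b c) (@hty R X a c))) (@pcat R X a b c).
Proof. by move=> p p' pp' q q' qq'; exact: hty_cat. Qed.

Lemma pcat_insert a b c d e (p : rpath R a b) (t : rpath R e b) (s : rpath R b c) (u : rpath R c d) :
  @hty R X _ _ (pcat (pcat p (prev t)) (pcat (pcat t s) u)) (pcat (pcat p s) u).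
Proof.
rewrite -(pcatA p (prev t)) -(pcatA t s u) (pcatA (prev t) t) pcatVp pcat1p.
exact: pcatA.
Qed.

Lemma pcat_conj_mul a b (d : rpath R a b) (p q : rpath R a a) :
  @hty R X _ _ (pcat (pcat (pcat (prev d) p) d) (pcat (pcat (prev d) q) d))
    (pcat (pcat (prev d) (pcat p q)) d).
Proof.
rewrite -(pcatA (prev d) q d) -(pcatA (pcat (prev d) p) d) (pcatA d (prev d)) pcatpV pcat1p !pcatA.
exact: hty_refl.
Qed.

Lemma pcat_conj_inv a b (d : rpath R a b) (p : rpath R a a) :
  @hty R X _ _ (pcat (pcat (pcat (prev d) (prev p)) d) (pcat (pcat (prev d) p) d)) (pcst R b).
Proof. rewrite pcat_conj_mul pcatVp pcatp1; exact: pcatVp. Qed.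

Lemma pcat_conjK a b (d : rpath R a b) (p : rpath R b b) :
  @hty R X _ _ (pcat (pcat (prev d) (pcat (pcat d p) (prev d))) d) p.
Proof.
rewrite -(pcatA d p) (pcatA (prev d) d) pcatVp pcat1p -(pcatA p) pcatVp.
exact: pcatp1.
Qed.

Definition pcast (a a' b b' : X) (ea : a = a') (eb : b = b') (p : rpath R a b) : rpath R a' b' :=
  RPath (@rpath_cont _ _ _ _ p)
    (fun t t0 => etrans (rpath_le0 p t0) ea) (fun t t1 => etrans (rpath_ge1 p t1) eb).
End HtyInstances.

(** * Comparison of real paths with the fundamental group *)

Section FundamentalGroupPaths.
Variables (R : realType) (X : topologicalType) (x0 : X).
Local Notation P := (rpath R x0 x0).
Implicit Types (p q : P).
Local Open Scope quotient_scope.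

Definition of_loop (l : loop R x0) : P :=
  RPath (@ext_continuous R X x0 l) (@ext_le0 R X x0 l) (@ext_ge1 R X x0 l).

Lemma to_loop_cont p : continuous (fun t : unit_interval R => p (real_of t)).
Proof. exact: (cont_comp (@real_of_continuous R) (@rpath_cont _ _ _ _ p)). Qed.
Lemma to_loop0 p : p (real_of (zero : unit_interval R)) = x0.
Proof. by rewrite real_of0 rpath0. Qed.
Lemma to_loop1 p : p (real_of (one : unit_interval R)) = x0.
Proof. by rewrite real_of1 rpath1. Qed.
Definition to_loop p : loop R x0 := mk_path (@to_loop_cont p) (to_loop0 p) (to_loop1 p).

Lemma to_loopE p t : to_loop p t = p (real_of t). Proof. by []. Qed.

Lemma of_loopK p : hty (of_loop (to_loop p)) p.
Proof.
by apply: hty_ext => t; rewrite /= /ext to_loopE real_of_clampcl rpath_cl.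
Qed.

Lemma homotopic_to_loop p q : hty p q -> homotopic (to_loop p) (to_loop q).
Proof.
move=> [F [cF F0 F1 Fa Fb]].
exists (fun z => F (real_of z.1, real_of z.2)); split.
- apply: (cont_comp _ cF); apply: cont_pair; [exact: real_of1_continuous|exact: real_of2_continuous].
- by move=> t; rewrite /= real_of0 F0.
- by move=> t; rewrite /= real_of1 F1.
- by move=> s; rewrite /= real_of0 real_of1 Fa // Fb.
Qed.

Lemma hty_of_loop (l l' : loop R x0) : homotopic l l' -> hty (of_loop l) (of_loop l').
Proof.
move=> [F [cF F0 F1 Fe]]; exists (fun z => F (clamp z.1, clamp z.2)); split.
- apply: (cont_comp _ cF); apply: cont_pair.
    exact: (cont_comp (@cont_fst R R) (@clamp_continuous R)).
  exact: (cont_comp (@cont_snd R R) (@clamp_continuous R)).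
- by move=> t; rewrite /= -[clamp 0]/(zero) F0.
- by move=> t; rewrite /= -[clamp 1]/(one) F1.
- by move=> s t t0; rewrite /= (clamp_le0 t0) -[clamp 0]/(zero) (Fe _).1.
- by move=> s t t0; rewrite /= (clamp_ge1 t0) -[clamp 1]/(one) (Fe _).2.
Qed.

Definition pcls p : pi1 R x0 := \pi_(pi1 R x0) (to_loop p).

Lemma pcls_eqP p q : pcls p = pcls q <-> hty p q.
Proof.
split=> [/eqmodP/asboolP H|H]; last by apply: pi1_eqP; exact: homotopic_to_loop.
apply: hty_trans (hty_trans (hty_of_loop H) (of_loopK q)).
by apply: hty_sym; exact: of_loopK.
Qed.

Lemma pcls_surj (c : pi1 R x0) : exists p, c = pcls p.
Proof.
exists (of_loop (repr c)); rewrite -[LHS]reprK; apply: pi1_eqP.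
exists (fun z => repr c z.2); split=> //.
- by apply: (cont_comp (@cont_snd (unit_interval R) (unit_interval R))); exact: cts_fun.
- by move=> t; rewrite to_loopE /= extE.
- by move=> s; rewrite /= path_zero path_one.
Qed.
End FundamentalGroupPaths.

(** * Spaces deforming onto a wedge of circles *)

(* A space X with a deformation onto a wedge of circles indexed by J: [gm_lab x] is the
   circle over which x lies, with its coordinate in the open interval (0, 1), and [None]
   when x lies over the vertex. *)
Record graph_model (R : realType) (X : topologicalType) (J : Type) := GraphModel {
  gm_v : X;
  gm_lab : X -> option (J * R);
  gm_e : J -> rpath R gm_v gm_v;
  gm_H : R * X -> X;
  gm_range : forall x j u, gm_lab x = Some (j, u) -> 0 < u < 1;
  gm_lab_e : forall j u, 0 < u < 1 -> gm_lab (gm_e j u) = Some (j, u);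
  gm_lab_v : gm_lab gm_v = None;
  gm_near_edge : forall x j u, gm_lab x = Some (j, u) -> forall eps : R, 0 < eps ->
    \forall y \near x, exists2 u', gm_lab y = Some (j, u') & `|u' - u| < eps;
  gm_near_vertex : forall x, gm_lab x = None -> \forall y \near x,
    gm_lab y = None \/ exists j u, gm_lab y = Some (j, u) /\ (u < 3^-1 \/ 2 / 3 < u);
  gm_H_cont : continuous gm_H;
  gm_H0 : forall x, gm_H (0, x) = x;
  gm_Hv : forall s, gm_H (s, gm_v) = gm_v;
  gm_H1 : forall x, gm_H (1, x) =
    if gm_lab x is Some (j, u) then gm_e j (cl (3 * u - 1)) else gm_v }.

Section GraphModel.
Variables (R : realType) (X : topologicalType) (J : eqType) (M : graph_model R X J).
Local Notation v := (gm_v M).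
Local Notation lab := (gm_lab M).
Local Notation e := (gm_e M).
Local Notation H := (gm_H M).
Local Notation P := (rpath R v v).
Implicit Types (x y : X) (j : J) (u : R).

Definition near_v : set X :=
  [set x | lab x = None \/ exists j u, lab x = Some (j, u) /\ (u < 3^-1 \/ 2 / 3 < u)].
Definition over_edge j (S : set R) : set X := [set x | exists2 u, lab x = Some (j, u) & S u].

Lemma open_over_edge j (S : set R) : open S -> open (over_edge j S).
Proof.
move=> oS; rewrite openE => x [u xu Su].
have /nbhs_ballP[eps /= eps0 Heps] : nbhs u S by apply: open_nbhs_nbhs; split.
apply: filterS (gm_near_edge xu eps0) => y [u' yu' uu']; exists u' => //.
by apply: Heps; rewrite /ball /= distrC.
Qed.

Lemma open_near_v : open near_v.
Proof.
rewrite openE => x [xN|[j [u [xu Hu]]]]; first exact: gm_near_vertex.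
have open1 : open (over_edge j [set t | t < 3^-1 \/ 2 / 3 < t]).
  apply: open_over_edge; apply: openU; [exact: open_lt|exact: open_gt].
have : nbhs x (over_edge j [set t | t < 3^-1 \/ 2 / 3 < t]).
  by apply: open_nbhs_nbhs; split=> //; exists u.
by apply: filterS => y [u' yu' Hu']; right; exists j, u'.
Qed.

Definition st u : R := cl (3 * u - 1).
Lemma st_lo u : u < 3^-1 -> st u = 0. Proof. by move=> h; apply: cl_le0; lra. Qed.
Lemma st_hi u : 2 / 3 < u -> st u = 1. Proof. by move=> h; apply: cl_ge1; lra. Qed.

Lemma H1_near_v x : near_v x -> H (1, x) = v.
Proof.
rewrite gm_H1; case=> [->//|[j [u [-> Hu]]]]; rewrite -/(st u).
by case: Hu => h; rewrite ?(st_lo h) ?(st_hi h) ?rpath0 ?rpath1.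
Qed.

(** The star of the vertex meets a whole edge in two ends, between which the cocycle has to jump.
    With two overlapping charts per edge, each chart meets the star in a single end. *)
Definition graph_cover (i : option (J * bool)) : set X :=
  match i with
  | None => near_v
  | Some (j, true) => over_edge j [set u | u < 2 / 3]
  | Some (j, false) => over_edge j [set u | 3^-1 < u]
  end.

Lemma graph_cover_open i : open (graph_cover i).
Proof.
case: i => [[j []]|]; [| |exact: open_near_v];
  apply: open_over_edge; [exact: open_lt|exact: open_gt].
Qed.
Lemma graph_cover_cover x : exists i, graph_cover i x.
Proof.
case E : (lab x) => [[j u]|]; last by exists None; left.
have [h|h] := ltrP u (2 / 3); first by exists (Some (j, true)); exists u.
by exists (Some (j, false)); exists u => //=; lra.
Qed.

Section Cocycle.
Variables (G : groupType) (k : J -> G).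

(** On the star the cocycle is the coboundary of this function, and on the edge charts it is
    trivial. The two agree on overlaps because the function is constant on each end of an edge;
    passing from the far end of edge [j] to the vertex gives [k j]. *)
Definition half_mark x : G := if lab x is Some (j, u) then
  (if 2^-1 < u then (k j)^-1%g else 1%g) else 1%g.
Definition same_side x y : bool :=
  match lab x, lab y with
  | Some (j, u), Some (j', u') => (j == j') &&
      ((u < 2 / 3) && (u' < 2 / 3) || (3^-1 < u) && (3^-1 < u'))
  | _, _ => false
  end.
Definition graph_cocycle x y : G :=
  if same_side x y then 1%g else ((half_mark x)^-1 * half_mark y)%g.

Lemma graph_cocycle_v x y : near_v x -> near_v y ->
  graph_cocycle x y = ((half_mark x)^-1 * half_mark y)%g.
Proof.
rewrite /graph_cocycle /same_side /half_mark.
case=> [->//|[j [u [-> Hu]]]]; case=> [->//|[j' [u' [-> Hu']]]].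
case: eqP => //= <-; case: ifP => // /orP[/andP[h1 h2]|/andP[h1 h2]].
- have u0 : u < 3^-1 by case: Hu => ?; lra.
  have u'0 : u' < 3^-1 by case: Hu' => ?; lra.
  by rewrite !ifF ?mulVg //; apply/negbTE; rewrite -leNgt; lra.
- have u0 : 2 / 3 < u by case: Hu => ?; lra.
  have u'0 : 2 / 3 < u' by case: Hu' => ?; lra.
  by rewrite !ifT ?mulVg //; lra.
Qed.

Lemma graph_cocycle_edge i j b x y : i = Some (j, b) ->
  graph_cover i x -> graph_cover i y -> graph_cocycle x y = 1%g.
Proof.
rewrite /graph_cocycle /same_side => ->.
by case: b => -[u -> /= h] [u' -> /= h']; rewrite eqxx h h' //= orbT.
Qed.

Lemma graph_cocycleP i x y z : graph_cover i x -> graph_cover i y -> graph_cover i z ->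
  (graph_cocycle x y * graph_cocycle y z)%g = graph_cocycle x z.
Proof.
case: i => [[j b]|] Hx Hy Hz.
  by rewrite !(graph_cocycle_edge (erefl (Some (j, b)))) // mulg1.
by rewrite !graph_cocycle_v // mulgA mulgK.
Qed.

Definition ghol (f : R -> X) : G := holonomy graph_cover graph_cocycle f.

Lemma ghol_cat a b c (p : rpath R a b) (q : rpath R b c) : ghol (pcat p q) = (ghol p * ghol q)%g.
Proof. exact: (holonomy_cat graph_cover_open graph_cover_cover graph_cocycleP). Qed.
Lemma ghol_hty a b (p q : rpath R a b) : hty p q -> ghol p = ghol q.
Proof. exact: (holonomy_hty graph_cover_open graph_cover_cover graph_cocycleP). Qed.
Lemma ghol_rev a b (p : rpath R a b) : ghol (prev p) = (ghol p)^-1%g.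
Proof. exact: (holonomy_rev graph_cover_open graph_cover_cover graph_cocycleP). Qed.

(** Four steps are subordinate: star, lower chart, upper chart, star. Only the last one, from
    parameter 3/4 to the vertex, contributes. *)
Lemma ghol_e j : ghol (e j) = k j.
Proof.
have lab_in t : 0 < t -> t < 1 -> lab (e j t) = Some (j, t).
  by move=> t0 t1; apply: gm_lab_e; rewrite t0 t1.
have labe t : t <= 0 -> e j t = v by exact: rpath_le0.
have labe1 t : 1 <= t -> e j t = v by exact: rpath_ge1.
have Hsub : subordinate graph_cover (e j) 4.
  have g (i : nat) : grid_point R 4 i = i%:R * 4^-1 by [].
  move=> [|[|[|[|//]]]] _; rewrite !g.
  - exists None => t h0 h1; have [t0|t0] := lerP t 0.
      by left; rewrite labe // gm_lab_v.
    by right; exists j, t; rewrite lab_in //; [split=> //; left|]; lra.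
  - by exists (Some (j, true)) => t h0 h1; exists t; rewrite /= ?lab_in //; lra.
  - by exists (Some (j, false)) => t h0 h1; exists t; rewrite /= ?lab_in //; lra.
  - exists None => t h0 h1; have [t0|t0] := lerP 1 t.
      by left; rewrite labe1 // gm_lab_v.
    by right; exists j, t; rewrite lab_in //; [split=> //; right|]; lra.
rewrite /ghol (holonomyE graph_cover_cover graph_cocycleP _ Hsub) //.
rewrite /hol_sum !big_nat_recr //= big_nil mul1g.
have g (i : nat) : grid_point R 4 i = i%:R * 4^-1 by [].
rewrite /graph_cocycle /same_side /half_mark.
rewrite (labe (grid_point R 4 0)); last by rewrite g; lra.
rewrite (labe1 (grid_point R 4 4)); last by rewrite g; lra.
have L i : (0 < i < 4)%N -> lab (e j (grid_point R 4 i)) = Some (j, grid_point R 4 i).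
  by case: i => [|[|[|[|?]]]] // _; apply: lab_in; rewrite g; lra.
rewrite gm_lab_v !L // eqxx /=.
have -> : (2^-1 < grid_point R 4 1) = false by apply/negbTE; rewrite -leNgt g; lra.
have -> : grid_point R 4 1 < 2 / 3 by rewrite g; lra.
have -> : grid_point R 4 2 < 2 / 3 by rewrite g; lra.
have -> : 3^-1 < grid_point R 4 2 by rewrite g; lra.
have -> : 3^-1 < grid_point R 4 3 by rewrite g; lra.
have -> : 2^-1 < grid_point R 4 3 by rewrite g; lra.
by rewrite /= orbT !invg1 !mulg1 !mul1g invgK.
Qed.
End Cocycle.

(** Closed under homotopy, so that proving every loop at the vertex to be of this kind is the
    generation half of freeness. The same induction serves for H_1. *)
Inductive edge_word : P -> Prop :=
| edge_word_cst : edge_word (pcst R v)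
| edge_word_e j : edge_word (e j)
| edge_word_cat p q : edge_word p -> edge_word q -> edge_word (pcat p q)
| edge_word_rev p : edge_word p -> edge_word (prev p)
| edge_word_hty p q : edge_word p -> hty p q -> edge_word q.

Definition initial_edge x (t : rpath R v (H (1, x))) : Prop :=
  if lab x is Some (j, u) then forall r, t r = e j (cl r * st u) else forall r, t r = v.

Lemma initial_edge_exists x : exists t : rpath R v (H (1, x)), initial_edge t.
Proof.
rewrite /initial_edge; case E : (lab x) => [[j u]|]; last first.
  have Ex : H (1, x) = v by rewrite gm_H1 E.
  by exists (pcast erefl (esym Ex) (pcst R v)).
have c : continuous (fun r => e j (cl r * st u)).
  by apply: (cont_comp _ (@rpath_cont _ _ _ _ (e j))); cont_tac.
have h0 r : r <= 0 -> e j (cl r * st u) = v by move=> r0; rewrite cl_le0 // mul0r rpath0.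
have h1 r : 1 <= r -> e j (cl r * st u) = H (1, x).
  by move=> r1; rewrite cl_ge1 // mul1r gm_H1 E.
by exists (RPath c h0 h1).
Qed.

Definition tau x := projT1 (cid (initial_edge_exists x)).
Lemma tauP x : initial_edge (tau x). Proof. exact: projT2 (cid (initial_edge_exists x)). Qed.

Lemma path_from_v x : exists t : rpath R v x, True.
Proof.
have c : continuous (fun r => H (cl r, x)).
  by apply: (cont_comp _ (@gm_H_cont _ _ _ M)); cont_tac.
have h0 r : r <= 0 -> H (cl r, x) = x by move=> r0; rewrite cl_le0 // gm_H0.
have h1 r : 1 <= r -> H (cl r, x) = H (1, x) by move=> r0; rewrite cl_ge1.
by exists (pcat (tau x) (prev (RPath c h0 h1))).
Qed.

Lemma edge_word_tau_near_v x y (a : rpath R v y) : near_v x -> (forall r, a r = tau x r) ->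
  (forall r, a r = v) \/ exists j, forall r, a r = e j (cl r).
Proof.
move=> Hx Ha; have := tauP x; rewrite /initial_edge.
case: Hx => [->|[j [u [-> Hu]]]] Ht; first by left=> r; rewrite Ha Ht.
case: Hu => h; [left|right; exists j] => r; rewrite Ha Ht.
  by rewrite st_lo // mulr0 rpath0.
by rewrite st_hi // mulr1.
Qed.

Lemma edge_word_conj_v y z (a : rpath R v y) (b : rpath R y z) (c : rpath R v z) :
  v = y -> v = z -> (forall r, b r = v) ->
  ((forall r, a r = v) \/ exists j, forall r, a r = e j (cl r)) ->
  ((forall r, c r = v) \/ exists j, forall r, c r = e j (cl r)) ->
  edge_word (pcat (pcat a b) (prev c)).
Proof.
move=> vy vz; case: y / vy a b => a; case: z / vz c => c b Hb Ha Hc.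
have W (p : P) : ((forall r, p r = v) \/ exists j, forall r, p r = e j (cl r)) -> edge_word p.
  case=> [Hp|[j Hp]].
    by apply: (edge_word_hty edge_word_cst); apply: hty_ext => r; rewrite Hp.
  by apply: (edge_word_hty (edge_word_e j)); apply: hty_ext => r; rewrite Hp rpath_cl.
by apply: edge_word_cat; [apply: edge_word_cat|apply: edge_word_rev]; apply: W => //; left.
Qed.

(** All three paths factor through [e j] and paths in the line; a loop in the line based at 0
    contracts linearly. *)
Lemma edge_word_conj_edge j (s t0 t1 : R) y z (a : rpath R v y) (b : rpath R y z) (c : rpath R v z)
   (a' : rpath R 0 t0) (b' : rpath R t0 t1) (c' : rpath R 0 t1) :
  (forall r, a r = e j (a' r)) -> (forall r, b r = e j (b' r)) -> (forall r, c r = e j (c' r)) ->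
  edge_word (pcat (pcat a b) (prev c)).
Proof.
move=> Ha Hb Hc; apply: (edge_word_hty edge_word_cst).
apply: (@hty_reparam_eq _ _ _ _ _ _ (e j) (fun=> 0) (pcat (pcat a' b') (prev c'))).
- exact: rpath_cont.
- exact: cont_cst.
- exact: rpath_cont.
- by move=> r; rewrite rpath0.
- by move=> r; rewrite /= /pcat_fun /= /pcat_fun; repeat case: ifP => _; rewrite ?Ha ?Hb ?Hc.
- by move=> r r0; rewrite rpath_le0.
- by move=> r r0; rewrite rpath_ge1.
Qed.

Section Decompose.
Variable p : P.
Lemma pushed_cont : continuous (fun t => H (1, p t)).
Proof.
by apply: (cont_comp _ (@gm_H_cont _ _ _ M)); apply: cont_pair; [cont_tac|exact: rpath_cont].
Qed.
Local Notation f := (fun t => H (1, p t)).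

Lemma pushed0 : f 0 = v. Proof. by rewrite /= rpath0 gm_Hv. Qed.

Lemma between (a b r : R) : a <= b -> a <= a + cl r * (b - a) <= b.
Proof.
move=> ab; have := cl_ge0 r; have := cl_le1 r => h1 h2; apply/andP; split; nra.
Qed.

(** Over the star the pushed piece is constant and each closing path is constant or a whole edge;
    over an edge chart everything lifts to the coordinate of the edge. *)
Lemma edge_word_piece i (a b : R) : a <= b ->
  (forall t, a <= t -> t <= b -> graph_cover i (p t)) ->
  edge_word (pcat (pcat (tau (p a)) (pseg pushed_cont a b)) (prev (tau (p b)))).
Proof.
move=> ab Hi; have Hin r : graph_cover i (p (a + cl r * (b - a))).
  by have /andP[h1 h2] := between r ab; exact: Hi.
case: i Hi Hin => [[j s]|] Hi Hin; last first.
  have [Ha Hb] : near_v (p a) /\ near_v (p b) by split; apply: Hi.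
  apply: edge_word_conj_v; rewrite ?H1_near_v //.
  - by move=> r /=; apply: H1_near_v; exact: Hin.
  - exact: (edge_word_tau_near_v Ha).
  - exact: (edge_word_tau_near_v Hb).
have Hlab r : exists u, lab (p (a + cl r * (b - a))) = Some (j, u).
  by case: s {Hi} Hin => Hin; have [u Hu _] := Hin r; exists u.
(* The edge coordinate along the piece; its continuity is what [gm_near_edge] provides. *)
have [g Hg] := choice Hlab.
have gc : continuous g.
  move=> r; apply/cvgrPdist_lt => eps eps0.
  have c : continuous (fun r => p (a + cl r * (b - a))).
    by apply: (cont_comp _ (@rpath_cont _ _ _ _ p)); cont_tac.
  have Hn : \forall r' \near r, exists2 u', lab (p (a + cl r' * (b - a))) = Some (j, u') &
      `|u' - g r| < eps := c r _ (gm_near_edge (Hg r) eps0).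
  by apply: filterS Hn => r' [u']; rewrite Hg distrC => -[->].
have E0 r : r <= 0 -> g r = g 0.
  by move=> r0; have := Hg 0; rewrite [cl 0](_ : _ = cl r) ?Hg => [[]//|]; rewrite cl0 cl_le0.
have E1 r : 1 <= r -> g r = g 1.
  by move=> r0; have := Hg 1; rewrite [cl 1](_ : _ = cl r) ?Hg => [[]//|]; rewrite cl1 cl_ge1.
have Hga : lab (p a) = Some (j, g 0) by rewrite -Hg cl0 mul0r addr0.
have Hgb : lab (p b) = Some (j, g 1) by rewrite -Hg cl1 mul1r addrC subrK.
have stc : continuous st by rewrite /st; cont_tac.
pose b' : rpath R (st (g 0)) (st (g 1)) := RPath (cont_comp gc stc)
  (fun r r0 => congr1 st (E0 r r0)) (fun r r0 => congr1 st (E1 r r0)).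
have lin (t : R) : continuous (fun r => cl r * t) by cont_tac.
have lin0 (t : R) r : r <= 0 -> cl r * t = 0 by move=> r0; rewrite cl_le0 // mul0r.
have lin1 (t : R) r : 1 <= r -> cl r * t = t by move=> r0; rewrite cl_ge1 // mul1r.
apply: (@edge_word_conj_edge j 0 _ _ _ _ _ _ _ (RPath (lin _) (lin0 _) (lin1 _)) b'
  (RPath (lin _) (lin0 _) (lin1 _))).
- by move=> r /=; have := tauP (p a); rewrite /initial_edge Hga.
- by move=> r /=; rewrite gm_H1 Hg.
- by move=> r /=; have := tauP (p b); rewrite /initial_edge Hgb.
Qed.

(** After the deformation the loop is cut at a subordinate subdivision and each piece is closed up
    by [tau] at its ends. The inserted paths cancel between consecutive pieces and are constant at
    the two ends of the loop. *)
Lemma edge_word_all : edge_word p.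
Proof.
have [N HN] := path_subordinate graph_cover_open graph_cover_cover (@rpath_cont _ _ _ _ p).
have [n0 Hn] := HN N (leqnn N).
pose x i := grid_point R N i.
pose pre i := pcast pushed0 erefl (pseg pushed_cont 0 (x i)).
have x0E : x 0%N = 0 by rewrite /x /grid_point mul0r.
have x1E : x N = 1 by rewrite /x /grid_point divff // pnatr_eq0 -lt0n.
have W i : (i <= N)%N -> edge_word (pcat (pre i) (prev (tau (p (x i))))).
  elim: i => [|i IH] iN.
    have t0 : forall r, tau (p (x 0%N)) r = v.
      by have := tauP (p (x 0%N)); rewrite /initial_edge {1}x0E rpath0 gm_lab_v.
    apply: (edge_word_hty edge_word_cst); apply: hty_sym.
    apply: (@hty_reparam_eq _ _ _ _ _ _ (fun=> v) id id) => //; try exact: cont_id.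
      exact: cont_cst.
    move=> r; rewrite /= /pcat_fun /= t0; case: ifP => // _.
    by rewrite x0E subrr mulr0 addr0 rpath0 gm_Hv.
  have [k Hk] := Hn i iN.
  have piece := edge_word_piece (grid_point_le R N (leqnSn i)) Hk.
  apply: (edge_word_hty (edge_word_cat (IH (ltnW iN)) piece)).
  apply: hty_trans (pcat_insert _ _ _ _) _; apply: hty_cat; last exact: hty_refl.
  apply: hty_trans (_ : hty _ (pcast pushed0 erefl (pcat (pseg pushed_cont 0 (x i))
     (pseg pushed_cont (x i) (x i.+1))))) _.
    by apply: hty_ext.
  have [F [cF F0 F1 Fa Fb]] := pseg_cat pushed_cont 0 (x i) (x i.+1).
  by exists F; split=> // s t t0; rewrite Fa // pushed0.
have := W N (leqnn N) => WN.
have tN : forall r, tau (p (x N)) r = v.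
  by have := tauP (p (x N)); rewrite /initial_edge {1}x1E rpath1 gm_lab_v.
have f_le0 t : t <= 0 -> f t = v by move=> t0; rewrite /= rpath_le0 // gm_Hv.
have f_ge1 t : 1 <= t -> f t = v by move=> t1; rewrite /= rpath_ge1 // gm_Hv.
pose p' : P := RPath pushed_cont f_le0 f_ge1.
apply: (edge_word_hty (edge_word_hty WN (_ : hty _ p'))); last first.
  (* The deformation itself is the homotopy between [p] and its image; [gm_Hv] keeps the base point
     fixed. *)
  apply: hty_sym; exists (fun z => H (z.1, p z.2)); split.
  - apply: (cont_comp _ (@gm_H_cont _ _ _ M)); apply: cont_pair; first exact: cont_fst.
    exact: (cont_comp (@cont_snd R R) (@rpath_cont _ _ _ _ p)).
  - by move=> t; rewrite gm_H0.
  - by move=> t.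
  - by move=> s t t0; rewrite /= rpath_le0 // gm_Hv.
  - by move=> s t t1; rewrite /= rpath_ge1 // gm_Hv.
apply: (@hty_reparam_path _ _ _ _ _ _ p' (fun t => 2 * t) id); try by cont_tac.
- move=> t; rewrite -[RHS](rpath_cl p') /= /pcat_fun /= tN; case: ifP => h.
    by rewrite x1E subr0 mulr1 add0r.
  by rewrite (@cl_ge1 _ (2 * t)) ?rpath1 ?gm_Hv //; move/negbT: h; rewrite -ltNge; lra.
- by move=> t t0; split=> //; lra.
- by move=> t t0; split=> //; lra.
Qed.
End Decompose.

Section FreeGenerators.
Variable x0 : X.

Definition base_path : rpath R v x0 := projT1 (cid (path_from_v x0)).
Local Notation d := base_path.

Definition gen_class (j : J) : pi1 R x0 := pcls (pcat (pcat (prev d) (e j)) d).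

Lemma pclsM (p q : rpath R x0 x0) : (pcls p * pcls q)%g = pcls (pcat p q).
Proof.
rewrite /pcls [LHS](_ : _ = \pi_(pi1 R x0)%qT (concat (to_loop p) (to_loop q))); last first.
  exact/esym/pi_pi1_mul.
apply: pi1_eqP; exists (fun z => pcat p q (real_of z.2)); split=> //.
- apply: (cont_comp _ (@rpath_cont _ _ _ _ (pcat p q))); exact: real_of2_continuous.
- move=> t; suff : pcat p q (real_of t) = concat_fun (to_loop p) (to_loop q) t by [].
  by rewrite /concat_fun /ext !to_loopE !real_of_clampcl !rpath_cl.
- move=> s; rewrite real_of0 real_of1; split; [exact: rpath0|exact: rpath1].
Qed.

Lemma pcls1 : pcls (pcst R x0) = 1%g.
Proof.
apply: (mulgI (pcls (pcst R x0))); rewrite mulg1 pclsM; apply/pcls_eqP; exact: pcat1p.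
Qed.

Lemma edge_word_in (S : pi1 R x0 -> Prop) : S 1%g -> (forall j, S (gen_class j)) ->
  (forall a b, S a -> S b -> S (a * b)%g) -> (forall a, S a -> S (a^-1)%g) ->
  forall p : P, edge_word p -> S (pcls (pcat (pcat (prev d) p) d)).
Proof.
move=> S1 Sl SM SV p; elim=> {p} [|j|p q _ Sp _ Sq|p _ Sp|p q _ Sp pq].
- suff -> : pcls (pcat (pcat (prev d) (pcst R v)) d) = 1%g by [].
  rewrite -pcls1; apply/pcls_eqP; apply: hty_trans (pcatVp d).
  by apply: hty_cat; [exact: pcatp1|exact: hty_refl].
- exact: Sl.
- suff <- : (pcls (pcat (pcat (prev d) p) d) * pcls (pcat (pcat (prev d) q) d))%g =
      pcls (pcat (pcat (prev d) (pcat p q)) d) by exact: SM.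
  by rewrite pclsM; apply/pcls_eqP; exact: pcat_conj_mul.
- suff -> : pcls (pcat (pcat (prev d) (prev p)) d) = (pcls (pcat (pcat (prev d) p) d))^-1%g.
    exact: SV.
  apply: (mulIg (pcls (pcat (pcat (prev d) p) d))); rewrite mulVg pclsM -pcls1.
  by apply/pcls_eqP; exact: pcat_conj_inv.
suff <- : pcls (pcat (pcat (prev d) p) d) = pcls (pcat (pcat (prev d) q) d) by [].
apply/pcls_eqP; apply: hty_cat; last exact: hty_refl.
by apply: hty_cat; first exact: hty_refl.
Qed.

Theorem graph_pi1_generated (S : pi1 R x0 -> Prop) : S 1%g -> (forall j, S (gen_class j)) ->
  (forall a b, S a -> S b -> S (a * b)%g) -> (forall a, S a -> S (a^-1)%g) ->
  forall c, S c.
Proof.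
move=> S1 Sl SM SV c; have [p ->] := pcls_surj c.
have := edge_word_in S1 Sl SM SV (edge_word_all (pcat (pcat d p) (prev d))).
suff -> : pcls (pcat (pcat (prev d) (pcat (pcat d p) (prev d))) d) = pcls p by [].
by apply/pcls_eqP; exact: pcat_conjK.
Qed.

(** Holonomy, conjugated by the holonomy [D] of the base path; this undoes the conjugation by that
    path in [gen_class]. *)
Theorem graph_pi1_extend (G : groupType) (k : J -> G) : exists2 phi : pi1 R x0 -> G,
  {morph phi : a b / (a * b)%g} & forall j, phi (gen_class j) = k j.
Proof.
pose D := ghol k d.
pose phi (c : pi1 R x0) : G := (D * (ghol k (of_loop (repr c)) * D^-1))%g.
have phiE p : phi (pcls p) = (D * (ghol k p * D^-1))%g.
  rewrite /phi; congr (_ * (_ * _))%g; apply: ghol_hty.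
  apply: hty_trans (of_loopK p); apply: hty_of_loop.
  by apply/homotopic_sym; exact: homotopic_repr.
exists phi => [x y|j].
  have [p ->] := pcls_surj x; have [q ->] := pcls_surj y.
  by rewrite pclsM !phiE ghol_cat !mulgA mulgVK.
by rewrite phiE !ghol_cat ghol_rev ghol_e -/D !mulgA mulgV mul1g mulgK.
Qed.
End FreeGenerators.
End GraphModel.

(** * The surface *)

(** The product of a quotient map with the line is again a quotient map because the line is locally
    compact: by the tube lemma over a compact interval [K] around [s], the set [C] of points whose
    whole segment over [K] goes into [W'] is open. *)
Lemma quotient_homotopy_continuous (R : realType) (T : topologicalType) (Q : quotType T)
    (Y : topologicalType) (F : R * quotient_topology Q -> Y) :
  continuous (fun z : R * T => F (z.1, \pi_(quotient_topology Q)%qT z.2)) -> continuous F.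
Proof.
move=> cF [s m] W; rewrite nbhsE => -[W' [oW' W'F] W'W].
pose p := repr m; have mE : m = \pi_(quotient_topology Q)%qT p by rewrite reprK.
pose O := (fun z : R * T => F (z.1, \pi_(quotient_topology Q)%qT z.2)) @^-1` W'.
have nO s' p' : W' (F (s', \pi_(quotient_topology Q)%qT p')) -> nbhs (s', p') O.
  by move=> H; apply: (cF (s', p')); apply: open_nbhs_nbhs; split.
have Osp : nbhs (s, p) O by apply: nO; rewrite -mE.
case: Osp => [[A B] [/= nA nB] AB].
have /nbhs_ballP[e /= e0 eA] := nA.
have e2 : 0 < e / 2 by exact: divr_gt0.
pose K : set R := `[s - e / 2, s + e / 2]%classic.
have cK : compact K by exact: segment_compact.
have KA s' : K s' -> A s'.
  rewrite /K /= in_itv /= => /andP[h1 h2]; apply: eA; rewrite /ball /=.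
  by rewrite ltr_norml; apply/andP; split; lra.
pose C : set (quotient_topology Q) := [set m' | forall s', K s' -> W' (F (s', m'))].
have oC : open C.
  rewrite /open /= /quotient_open openE => p' Cp'.
  have NC : \forall p'' \near p', K `<=` (fun s' => W' (F (s', \pi_(quotient_topology Q)%qT p''))).
    apply: (iffLR (compact_near_coveringP K) cK) => s' Ks'.
    exact: (nO s' p' (Cp' s' Ks')).
  by apply: filterS NC => p'' Hp'' s' Ks'; exact: Hp''.
have Cm : C m by move=> s' Ks'; rewrite mE; apply: (AB (s', p)); split=> /=; [exact: KA|exact: nbhs_singleton].
exists (K, C) => /=.
  split; last by apply: open_nbhs_nbhs; split.
  have nb : nbhs s (ball s (e / 2)) by exact: nbhsx_ballx.
  apply: filterS nb => s' /=; rewrite /ball /= ltr_norml => /andP[h1 h2].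
  by rewrite /K /= in_itv /=; apply/andP; split; lra.
by move=> [s' m'] /= [Ks' Cm']; apply: W'W; exact: Cm'.
Qed.

(** * Letters and coordinates along the bottom edge of the polygon *)

Section EdgeCoordinate.
Variables (R : realType) (g : nat).
Implicit Types (x u t : R) (k : nat).
Local Notation J := ('I_g * bool)%type.

(** Segments 4i and 4i+1 carry a_i and b_i forwards, 4i+2 and 4i+3 the same letters backwards.
    [insub] fails on the free segment 4g, which thereby counts as lying over the vertex. *)
Definition seg_lab k u : option (J * R) :=
  omap (fun i : 'I_g => ((i, odd k), if (k %% 4 < 2)%N then u else 1 - u)) (insub (k %/ 4)%N).

Definition edge_lab x : option (J * R) :=
  let k := Num.truncn x in
  if k%:R < x then seg_lab k (x - k%:R) else None.

Lemma edge_lab_in k u : 0 < u < 1 -> edge_lab (k%:R + u) = seg_lab k u.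
Proof.
move=> /andP[u0 u1]; rewrite /edge_lab (@truncn_def _ _ k); first by rewrite ltrDl u0 addrC addKr.
by rewrite lerDl ltW //= -natr1 ltrD2l.
Qed.
Lemma edge_lab_nat k : edge_lab k%:R = None.
Proof. by rewrite /edge_lab (@truncn_def _ _ k) ?ltxx // lexx ltr_nat /=. Qed.
Lemma edge_lab_neg x : x < 0 -> edge_lab x = None.
Proof.
move=> x0; rewrite /edge_lab ifF //; apply/negbTE; rewrite -leNgt.
by apply: le_trans (ltW x0) _; rewrite ler0n.
Qed.

Lemma real_split x : [\/ x < 0, exists k, x = k%:R | exists k u, 0 < u < 1 /\ x = k%:R + u].
Proof.
have [x0|x0] := ltrP x 0; first by constructor 1.
have /andP[h1 h2] := truncn_itv x0; set k := Num.truncn x in h1 h2.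
have [e|ne] := eqVneq (k%:R) x; first by constructor 2; exists k.
constructor 3; exists k, (x - k%:R); split; last by rewrite addrC subrK.
rewrite subr_gt0 lt_neqAle ne h1 /= ltrBlDl; by rewrite -natr1 in h2.
Qed.

Lemma seg_lab_spec k : (forall u, seg_lab k u = None) \/
  exists j, (forall u, seg_lab k u = Some (j, u)) \/ (forall u, seg_lab k u = Some (j, 1 - u)).
Proof.
rewrite /seg_lab; case: insubP => [i _ _|_]; last by left.
by right; exists (i, odd k); case: (k %% 4 < 2)%N; [left|right].
Qed.

Lemma edge_lab_range x j u : edge_lab x = Some (j, u) -> 0 < u < 1.
Proof.
case: (real_split x) => [/edge_lab_neg ->//|[k ->]|[k [t [t01 ->]]]]; first by rewrite edge_lab_nat.
rewrite edge_lab_in //; case: (seg_lab_spec k) => [E|[j' [E|E]]]; rewrite E // => -[_ <-] //.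
by move: t01 => /andP[h1 h2]; apply/andP; split; lra.
Qed.

Lemma open_edge_lab j u (eps : R) :
  open [set x | exists2 u', edge_lab x = Some (j, u') & `|u' - u| < eps].
Proof.
rewrite openE => x [u' + Hu'].
case: (real_split x) => [/edge_lab_neg ->//|[k ->]|[k [t [t01 ->]]]]; first by rewrite edge_lab_nat.
rewrite edge_lab_in // => E; have /andP[t0 t1] := t01.
pose d := Num.min (Num.min t (1 - t)) (eps - `|u' - u|).
have d0 : 0 < d by rewrite /d !lt_min t0 !subr_gt0 t1 Hu'.
apply/nbhs_ballP; exists d => //= y; rewrite /ball /= /d !lt_min => /andP[/andP[h1 h2] h3].
pose s := t + (y - (k%:R + t)).
have yE : y = k%:R + s by rewrite /s; ring.
move: h1 h2 h3; rewrite distrC !ltr_norml => /andP[h1 h1'] /andP[h2 h2'] /andP[h3 h3'].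
have s01 : 0 < s < 1 by apply/andP; rewrite /s; split; lra.
have st : `|s - t| < eps - `|u' - u|.
  by rewrite ltr_norml /s; apply/andP; split; lra.
rewrite yE edge_lab_in //.
case: (seg_lab_spec k) E => [Hj|[j' [] Hj]]; rewrite !Hj // => -[<- Eu].
- exists s => //; have -> : s - u = (s - t) + (u' - u) by rewrite -Eu; ring.
  by apply: le_lt_trans (ler_normD _ _) _; lra.
- exists (1 - s) => //; have -> : 1 - s - u = (u' - u) - (s - t) by rewrite -Eu; ring.
  by apply: le_lt_trans (ler_normB _ _) _; lra.
Qed.

(** Near an integer the adjacent segments are met in one of their ends, whatever their orientation,
    because the condition on [u] is symmetric under u |-> 1 - u. *)
Lemma open_vertex_lab : open [set x | edge_lab x = None \/
  exists j u, edge_lab x = Some (j, u) /\ (u < 3^-1 \/ 2 / 3 < u)].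
Proof.
set S := [set x | _].
have inS k s : 0 < s < 1 -> s < 3^-1 \/ 2 / 3 < s -> S (k%:R + s).
  move=> s01 Hs; rewrite /S /= edge_lab_in //.
  case: (seg_lab_spec k) => [E|[j [E|E]]]; rewrite E; first by left.
    by right; exists j, s.
  by right; exists j, (1 - s); split=> //; case: Hs => ?; [right|left]; lra.
rewrite openE => x Sx.
case: (real_split x) Sx => [x0|[k ->]|[k [t [t01 ->]]]] Sx.
- have : nbhs x [set y | y < 0] by apply: open_nbhs_nbhs; split=> //; exact: open_lt.
  by apply: filterS => y y0; left; exact: edge_lab_neg.
- apply/nbhs_ballP; exists 3^-1 => /=; first by rewrite invr_gt0.
  move=> y; rewrite /ball /= distrC ltr_norml => /andP[h1 h2].
  have [yk|yk|->] := ltgtP y k%:R; last by left; exact: edge_lab_nat.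
    case: k yk h1 h2 {Sx} => [|k] yk h1 h2; first by left; exact: edge_lab_neg.
    have -> : y = k%:R + (y - k%:R) by rewrite addrC subrK.
    rewrite -natr1 in yk h1 h2.
    by apply: inS; [apply/andP; split|right]; lra.
  have -> : y = k%:R + (y - k%:R) by rewrite addrC subrK.
  by apply: inS; [apply/andP; split|left]; lra.
move: Sx; rewrite /S /= edge_lab_in //.
case: (seg_lab_spec k) => [E _|[j Hj] Hs].
  have /andP[t0 t1] := t01.
  have : nbhs (k%:R + t) [set y | k%:R < y] by apply: open_nbhs_nbhs; split; [exact: open_gt|rewrite /=; lra].
  have : nbhs (k%:R + t) [set y | y < k%:R + 1] by apply: open_nbhs_nbhs; split; [exact: open_lt|rewrite /=; lra].
  apply: filterS2 => y /= h1 h2; left.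
  have -> : y = k%:R + (y - k%:R) by rewrite addrC subrK.
  by rewrite edge_lab_in ?E //; apply/andP; split; lra.
have [u [Eu Hu]] : exists u, seg_lab k t = Some (j, u) /\ (u < 3^-1 \/ 2 / 3 < u).
  by case: Hj Hs => Hj []; rewrite Hj // => -[j' [u [[_ E2] Hu]]]; exists u; rewrite E2.
pose eps : R := if u < 3^-1 then 3^-1 - u else u - 2 / 3.
have eps0 : 0 < eps by rewrite /eps; case: ifP => h; case: Hu => ?; lra.
have oE := @open_edge_lab j u eps.
have : nbhs (k%:R + t) [set x | exists2 u', edge_lab x = Some (j, u') & `|u' - u| < eps].
  by apply: open_nbhs_nbhs; split=> //; exists u; rewrite ?edge_lab_in // subrr normr0.
apply: filterS => y [u' Hy]; rewrite ltr_norml /eps => /andP[h1 h2]; right; exists j, u'.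
by split=> //; move: h1 h2; case: ifP => h h1 h2; [left|right]; lra.
Qed.

(** A staircase that fixes the integers from 0 to [n], flattens the outer thirds of each unit
    interval and is constant beyond [n]. On a segment it commutes with t |-> 1 - t, as the gluing
    requires. *)
Definition stair (n : nat) x : R := \sum_(i < n) cl (3 * (x - i%:R) - 1).

Lemma stair_cont n : continuous (stair n).
Proof.
rewrite /stair; elim: n => [|n IH].
  have -> : (fun x : R => \sum_(i < 0) cl (3 * (x - i%:R) - 1)) = (fun=> 0).
    by apply/funext => x; rewrite big_ord0.
  exact: cont_cst.
have -> : (fun x : R => \sum_(i < n.+1) cl (3 * (x - i%:R) - 1)) =
    (fun x => \sum_(i < n) cl (3 * (x - i%:R) - 1) + cl (3 * (x - n%:R) - 1)).
  by apply/funext => x; rewrite big_ord_recr.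
by apply: contD; [exact: IH|cont_tac].
Qed.
Lemma stair_le0 n x : x <= 0 -> stair n x = 0.
Proof.
move=> x0; rewrite /stair big1 // => i _; apply: cl_le0.
by have : 0 <= i%:R :> R by []; lra.
Qed.
Lemma stair_ge n x : n%:R <= x -> stair n x = n%:R.
Proof.
elim: n => [|n IH] nx; first by rewrite /stair big_ord0.
rewrite /stair big_ord_recr /= -/(stair n x) -natr1 in nx *; rewrite IH; last by lra.
by rewrite cl_ge1 //; lra.
Qed.
Lemma stair_in n k u : (k < n)%N -> 0 <= u -> u <= 1 ->
  stair n (k%:R + u) = k%:R + cl (3 * u - 1).
Proof.
move=> kn u0 u1; elim: n kn => // n IH; rewrite ltnS leq_eqVlt => /orP[/eqP <-|kn].
  rewrite /stair big_ord_recr /= -/(stair k _) stair_ge; last by lra.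
  by congr (_ + cl (3 * _ - 1)); ring.
rewrite /stair big_ord_recr /= -/(stair n _) IH // [X in _ + X]cl_le0 ?addr0 //.
have : k.+1%:R <= n%:R :> R by rewrite ler_nat.
by rewrite -natr1; lra.
Qed.
End EdgeCoordinate.

(** * The glued polygon as a graph model *)

Section SurfaceGraph.
Variables (R : realType) (g : nat).
Implicit Types (x y u t s : R) (k : nat).
Local Notation J := ('I_g * bool)%type.
Local Notation Poly := (@polygon R g).
Local Notation S := (surface_model R g).
Local Notation N := ((4 * g + 1)%:R : R).

(** Clamping retracts the plane onto the rectangle, so points of the surface can be given by real
    coordinates without membership proofs. *)
Definition to_poly_fun (z : R * R) : R * R := (Num.max 0 (Num.min N z.1), cl z.2).
Fact to_poly_subproof z : to_poly_fun z \in Poly.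
Proof.
apply/mem_set; rewrite /polygon /= le_max lexx ge_max ge_min lexx ler0n /= ?andbT cl_ge0 cl_le1.
by split.
Qed.
Definition to_poly (z : R * R) : Poly := exist (fun p => p \in Poly) _ (to_poly_subproof z).

Lemma to_poly_cont : continuous to_poly.
Proof.
apply: continuous_comp_initial.
suff : continuous to_poly_fun by [].
apply: cont_pair; last by cont_tac.
have c : continuous (fun x : R => Num.max 0 (Num.min N x)).
  apply: cont_max; first exact: cst_continuous.
  by move=> x; apply: (@continuous_min R R (fun=> N) id); [exact: cst_continuous|exact: cvg_id].
exact: (cont_comp (@cont_fst R R) c).
Qed.

Definition Spi (p : Poly) : S := \pi_(surface_model R g)%qT p.
Definition Spt (z : R * R) : S := Spi (to_poly z).

Lemma Spt_cont : continuous Spt.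
Proof. by apply: (cont_comp to_poly_cont); exact: pi_continuous. Qed.

Lemma to_polyK (p : Poly) : to_poly (set_val p) = p.
Proof.
apply: val_inj; rewrite /= /to_poly_fun; case: p => -[x y] /= /set_mem[/= /andP[x0 xN] /andP[y0 y1]].
by rewrite (min_idPr xN) (max_idPr x0) cl_id.
Qed.
Lemma Spt_val (p : Poly) : Spt (set_val p) = Spi p.
Proof. by rewrite /Spt to_polyK. Qed.

Lemma in_poly x y : 0 <= x -> x <= N -> 0 <= y -> y <= 1 -> set_val (to_poly (x, y)) = (x, y).
Proof. by move=> x0 xN y0 y1; rewrite -[LHS]/(to_poly_fun (x, y)) /to_poly_fun /= (min_idPr xN) (max_idPr x0) cl_id. Qed.

Lemma glue_points (p q : Poly) : glued p q -> Spi p = Spi q.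
Proof. by move=> pq; apply/eqmodP/asboolP. Qed.

Lemma Spi_invariant (T : Type) (f : R * R -> T) :
  (forall p q, side_pairing g p q -> f p = f q) ->
  forall p : Poly, f (set_val (repr (Spi p))) = f (set_val p).
Proof.
move=> Hf p; have H (a b : Poly) : glued a b -> f (set_val a) = f (set_val b).
  by elim=> {a b} [a b ab|//|a b _ ->|a b c _ -> _ ->] //; exact: Hf.
by apply: H; have /eqmodP/asboolP := reprK (Spi p).
Qed.

Lemma le_N k u : (k < 4 * g)%N -> u <= 1 -> k%:R + u <= N.
Proof.
move=> kg u1; apply: le_trans (_ : k.+1%:R <= _); first by rewrite -natr1 lerD2l.
by rewrite ler_nat; lia.
Qed.

Lemma glue_pt i (b : bool) t : (i < g)%N -> 0 <= t -> t <= 1 ->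
  Spt ((4 * i + b)%:R + t, 0) = Spt ((4 * i + 2 + b)%:R + (1 - t), 0).
Proof.
move=> ig t0 t1; apply: glue_points; apply: glued_pair; exists i, t; split=> //; first by rewrite t0.
have b1 : (b <= 1)%N by case: b.
have h1 : (4 * i + b)%:R + t <= N by apply: le_N => //; lia.
have h2 : (4 * i + 2 + b)%:R + (1 - t) <= N by apply: le_N; [lia|lra].
have h3 k : 0 <= k%:R + t by apply: addr_ge0; rewrite ?ler0n.
have h4 k : 0 <= k%:R + (1 - t) by apply: addr_ge0; rewrite ?ler0n // subr_ge0.
rewrite !in_poly //; case: b {b1 h1 h2}; [right|left]; rewrite ?addn0 //.
by rewrite -addnA.
Qed.

(** The ends of the paired segments of block i give 4i ~ 4i+3 ~ 4i+2 ~ 4i+1 ~ 4i+4, and induction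
    links the blocks. *)
Lemma vertex_pt k : (k <= 4 * g)%N -> Spt (k%:R, 0) = Spt (0, 0).
Proof.
have step i : (i < g)%N -> Spt ((4 * i)%:R, 0) = Spt (0, 0) ->
    [/\ Spt ((4 * i + 1)%:R, 0) = Spt (0, 0), Spt ((4 * i + 2)%:R, 0) = Spt (0, 0),
        Spt ((4 * i + 3)%:R, 0) = Spt (0, 0) & Spt ((4 * i + 4)%:R, 0) = Spt (0, 0)].
  move=> ig H0.
  have [l0 l1 l2] : [/\ 0 <= 0 :> R, 0 <= 1 :> R & 1 <= 1 :> R] by split=> //; exact: ler01.
  have := glue_pt false ig l0 l1; rewrite subr0 !addr0 !addn0 natr1 H0 => H3.
  have := glue_pt false ig l1 l2; rewrite subrr !addr0 !addn0 natr1 => H12.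
  have := glue_pt true ig l0 l1; rewrite subr0 !addr0 natr1 => H14.
  have := glue_pt true ig l1 l2; rewrite subrr !addr0 natr1 => H23.
  have e3 : ((4 * i + 2).+1 = 4 * i + 3)%N by lia.
  have e1 : ((4 * i).+1 = 4 * i + 1)%N by lia.
  have e2 : ((4 * i + 1).+1 = 4 * i + 2)%N by lia.
  have e3' : (4 * i + 2 + 1 = 4 * i + 3)%N by lia.
  have e4 : ((4 * i + 3).+1 = 4 * i + 4)%N by lia.
  rewrite /= in H3 H12 H14 H23; rewrite ?e3 ?e1 ?e2 ?e3' ?e4 in H3 H12 H14 H23.
  by split; rewrite -?H14 ?H12 ?H23 -?H3.
have base i : (i <= g)%N -> Spt ((4 * i)%:R, 0) = Spt (0, 0).
  elim: i => [|i IH] ig; first by rewrite muln0.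
  have [_ _ _] := step i ig (IH (ltnW ig)).
  by have -> : (4 * i + 4 = 4 * i.+1)%N by lia.
move=> kg; have kE : k = (4 * (k %/ 4) + k %% 4)%N by rewrite mulnC -divn_eq.
have [kg'|kg'] := ltnP (k %/ 4) g; last first.
  have -> : k = (4 * g)%N by lia.
  exact: base.
have [H1 H2 H3 _] := step _ kg' (base _ (ltnW kg')).
rewrite kE; have : (k %% 4 < 4)%N by rewrite ltn_mod.
by case: (k %% 4)%N => [|[|[|[|//]]]] _ //; rewrite addn0; apply: base; exact: ltnW.
Qed.

(** The height is ignored, since the deformation collapses the rectangle onto its bottom edge. *)
Definition surf_lab (m : S) : option (J * R) := edge_lab g (set_val (repr m)).1.

Lemma seg_lab_4 i (ig : (i < g)%N) (r : nat) u : (r < 4)%N ->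
  seg_lab g (4 * i + r) u = Some ((Ordinal ig, odd r), if (r < 2)%N then u else 1 - u).
Proof.
move=> r4; rewrite /seg_lab.
have -> : ((4 * i + r) %/ 4 = i)%N by rewrite mulnC divnMDl // divn_small // addn0.
have -> : ((4 * i + r) %% 4 = r)%N by rewrite mulnC modnMDl modn_small.
rewrite (insubT (fun i => (i < g)%N) ig) /=.
by rewrite oddD oddM.
Qed.

Lemma edge_lab_pair (p q : R * R) : side_pairing g p q -> edge_lab g p.1 = edge_lab g q.1.
Proof.
move=> [i [t [ig /andP[t0 t1] H]]].
have [b [-> ->]] : exists b : bool, p.1 = (4 * i + b)%:R + t /\ q.1 = (4 * i + 2 + b)%:R + (1 - t).
  case: H => -[-> ->]; [exists false|exists true]; rewrite /= ?addn0 //.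
  by rewrite -addnA.
have [->|tn0] := eqVneq t 0.
  by rewrite addr0 subr0 natr1 !edge_lab_nat.
have [->|tn1] := eqVneq t 1.
  by rewrite subrr addr0 natr1 !edge_lab_nat.
have t01 : 0 < t < 1 by rewrite !lt_neqAle t0 t1 tn1 eq_sym tn0.
have t01' : 0 < 1 - t < 1 by move: t01 => /andP[h1 h2]; apply/andP; split; lra.
rewrite !edge_lab_in // -addnA !(seg_lab_4 ig); last 2 first.
- by case: b.
- by case: b.
by case: b => /=; rewrite opprB addrC subrK.
Qed.

Lemma surf_labE (p : Poly) : surf_lab (Spi p) = edge_lab g (set_val p).1.
Proof. exact: (Spi_invariant (f := fun z => edge_lab g z.1) edge_lab_pair). Qed.

Lemma surf_lab_pt x : 0 <= x -> x <= N -> surf_lab (Spt (x, 0)) = edge_lab g x.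
Proof. by move=> x0 xN; rewrite surf_labE in_poly // ler01. Qed.

Lemma surf_lab_open (A : set R) (B : set (option (J * R))) : open A ->
  (forall x, A x <-> B (edge_lab g x)) -> open [set m | B (surf_lab m)].
Proof.
move=> oA AB; rewrite /open /= /quotient_open.
have -> : \pi_(surface_model R g)%qT @^-1` [set m | B (surf_lab m)] =
    (fun p : Poly => (set_val p).1) @^-1` A.
  by apply/seteqP; split=> p /=; rewrite -/(Spi p) surf_labE => /AB.
have c : continuous (fun p : Poly => (set_val p).1).
  by apply: (cont_comp _ (@cont_fst R R)); exact: initial_continuous.
by move/continuousP: c; apply.
Qed.

(** Heights shrink to 0 while abscissas move linearly to their image under [stair], which brings the
    free segment to the vertex 4g. *)
Definition surf_push (z : R * (R * R)) : S :=
  Spt ((1 - cl z.1) * z.2.1 + cl z.1 * stair (4 * g) z.2.1, (1 - cl z.1) * z.2.2).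
Definition surf_H (z : R * S) : S := surf_push (z.1, set_val (repr z.2)).

Lemma surf_push_pair s (p q : R * R) : side_pairing g p q -> surf_push (s, p) = surf_push (s, q).
Proof.
move=> [i [t [ig /andP[t0 t1] H]]].
have [b [p1 q1 p2 q2]] : exists b : bool, [/\ p.1 = (4 * i + b)%:R + t,
    q.1 = (4 * i + 2 + b)%:R + (1 - t), p.2 = 0 & q.2 = 0].
  case: H => -[-> ->]; [exists false|exists true]; split; rewrite /= ?addn0 //.
  by rewrite -addnA.
have b1 : (b <= 1)%N by case: (b).
have k1 : (4 * i + b < 4 * g)%N by lia.
have k2 : (4 * i + 2 + b < 4 * g)%N by lia.
have [t0' t1'] : 0 <= 1 - t /\ 1 - t <= 1 by split; lra.
rewrite /surf_push /= p1 q1 p2 q2 mulr0 !stair_in //.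
set c := cl s; have [c0 c1] : 0 <= c /\ c <= 1 by split; [exact: cl_ge0|exact: cl_le1].
set w := cl (3 * t - 1); have [w0 w1] : 0 <= w /\ w <= 1 by split; [exact: cl_ge0|exact: cl_le1].
have -> : cl (3 * (1 - t) - 1) = 1 - w.
  by rewrite /w -cl_1B; congr cl; ring.
pose t' := (1 - c) * t + c * w.
have -> : (1 - c) * ((4 * i + b)%:R + t) + c * ((4 * i + b)%:R + w) = (4 * i + b)%:R + t'.
  by rewrite /t'; ring.
have -> : (1 - c) * ((4 * i + 2 + b)%:R + (1 - t)) + c * ((4 * i + 2 + b)%:R + (1 - w)) =
    (4 * i + 2 + b)%:R + (1 - t') by rewrite /t'; ring.
by apply: glue_pt => //; rewrite /t'; nra.
Qed.

Lemma surf_HE s (p : Poly) : surf_H (s, Spi p) = surf_push (s, set_val p).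
Proof. exact: (Spi_invariant (f := fun z => surf_push (s, z)) (@surf_push_pair s)). Qed.

Lemma surf_H_cont : continuous surf_H.
Proof.
apply: quotient_homotopy_continuous.
have -> : (fun z : R * Poly => surf_H (z.1, \pi_(surface_model R g)%qT z.2)) =
    (fun z => surf_push (z.1, set_val z.2)) by apply/funext => z; exact: surf_HE.
apply: (cont_comp _ Spt_cont).
have c1 : continuous (fun z : R * Poly => (set_val z.2).1).
  apply: (cont_comp _ (@cont_fst R R)); apply: (cont_comp (@cont_snd R Poly)).
  exact: initial_continuous.
have c2 : continuous (fun z : R * Poly => (set_val z.2).2).
  apply: (cont_comp _ (@cont_snd R R)); apply: (cont_comp (@cont_snd R Poly)).
  exact: initial_continuous.
apply: cont_pair; last by apply: contM; [cont_tac|exact: c2].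
apply: contD; apply: contM; try by cont_tac.
exact: (cont_comp c1 (@stair_cont R _)).
Qed.

Definition surf_v : S := Spt (0, 0).
Definition edge_pos (j : J) : nat := (4 * j.1 + j.2)%N.

Lemma edge_pos_lt j : (edge_pos j < 4 * g)%N.
Proof. by case: j => -[i ig] b; rewrite /edge_pos /=; have : (b <= 1)%N by [case: b]; lia. Qed.

Lemma surf_e_cont j : continuous (fun t : R => Spt ((edge_pos j)%:R + cl t, 0)).
Proof. by apply: (cont_comp _ Spt_cont); cont_tac. Qed.
Lemma surf_e_le0 j t : t <= 0 -> Spt ((edge_pos j)%:R + cl t, 0) = surf_v.
Proof. by move=> t0; rewrite cl_le0 // addr0 vertex_pt // ltnW // edge_pos_lt. Qed.
Lemma surf_e_ge1 j t : 1 <= t -> Spt ((edge_pos j)%:R + cl t, 0) = surf_v.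
Proof. by move=> t0; rewrite cl_ge1 // natr1 vertex_pt // edge_pos_lt. Qed.
Definition surf_e j : rpath R surf_v surf_v :=
  RPath (@surf_e_cont j) (@surf_e_le0 j) (@surf_e_ge1 j).

Lemma seg_lab_edge_pos j u : seg_lab g (edge_pos j) u = Some (j, u).
Proof.
case: j => -[i ig] b; rewrite /edge_pos /= (seg_lab_4 ig); last by case: b.
by case: b.
Qed.

Lemma surf_lab_e j u : 0 < u < 1 -> surf_lab (surf_e j u) = Some (j, u).
Proof.
move=> /[dup] u01 /andP[u0 u1]; rewrite /= cl_id ?ltW // surf_lab_pt.
- by rewrite edge_lab_in // seg_lab_edge_pos.
- by apply: addr_ge0; rewrite ?ler0n ?ltW.
- by apply: le_N; [exact: edge_pos_lt|exact: ltW].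
Qed.

Lemma surf_lab_v : surf_lab surf_v = None.
Proof. by rewrite surf_lab_pt ?ler0n // -[0]/(0%:R) edge_lab_nat. Qed.

Lemma surf_H1 m : surf_H (1, m) =
  if surf_lab m is Some (j, u) then surf_e j (cl (3 * u - 1)) else surf_v.
Proof.
rewrite -[m]reprK -/(Spi (repr m)) surf_HE surf_labE.
have Hp : polygon g (set_val (repr m)) := set_mem (valP (repr m)).
move: (set_val (repr m)) Hp => [x y] [/= /andP[x0 xN] _]; rewrite /surf_push /= cl1 subrr !mul0r add0r mul1r.
have big : (4 * g)%:R <= x -> Spt (stair (4 * g) x, 0) = surf_v.
  by move=> h; rewrite stair_ge // vertex_pt.
case: (real_split x) => [|[k xk]|[k [u [u01 xk]]]]; first by rewrite ltNge x0.
  rewrite xk edge_lab_nat -xk.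
  have [kg|kg] := ltnP k (4 * g); last by apply: big; rewrite xk ler_nat.
  have := @stair_in R (4 * g) k 0 kg (lexx 0) ler01.
  by rewrite addr0 mulr0 sub0r (cl_le0 (lerN10 R)) addr0 xk => ->; rewrite vertex_pt // ltnW.
have /andP[u0 u1] := u01; rewrite xk edge_lab_in // -xk.
have [kg|kg] := ltnP k (4 * g); last first.
  rewrite /seg_lab insubN /=; last by rewrite -leqNgt leq_divRL // mulnC.
  by apply: big; rewrite xk; apply: le_trans (_ : k%:R <= _); [rewrite ler_nat|rewrite lerDl ltW].
rewrite xk stair_in ?ltW //.
have kE : k = (4 * (k %/ 4) + k %% 4)%N by rewrite mulnC -divn_eq.
have kg' : (k %/ 4 < g)%N by rewrite ltn_divLR // mulnC.
have r4 : (k %% 4 < 4)%N by rewrite ltn_mod.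
rewrite kE (seg_lab_4 kg' u r4) /=.
set i := (k %/ 4)%N; set w := cl (3 * u - 1).
have [w0 w1] : 0 <= w /\ w <= 1 by split; [exact: cl_ge0|exact: cl_le1].
have clw : cl w = w by exact: cl_id.
have cl1w : cl (cl (3 * (1 - u) - 1)) = 1 - w.
  have -> : 3 * (1 - u) - 1 = 1 - (3 * u - 1) by ring.
  by rewrite cl_1B cl_id // -/w; lra.
rewrite /edge_pos /=.
(* Points of the backward segments 4i+2 and 4i+3 are carried across the gluing to the forward copy
   of their letter. *)
have glue (b : bool) : Spt ((4 * i + (2 + b))%:R + w, 0) = Spt ((4 * i + b)%:R + (1 - w), 0).
  rewrite (@glue_pt i b (1 - w)) //; [|lra|lra].
  by have -> : 1 - (1 - w) = w by [ring]; rewrite addnA.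
by case: (k %% 4)%N r4 => [|[|[|[|//]]]] _ /=; rewrite ?clw ?cl1w //; [exact: (glue false)|exact: (glue true)].
Qed.

Lemma surf_near_edge (m : S) j u : surf_lab m = Some (j, u) -> forall eps : R, 0 < eps ->
  \forall y \near m, exists2 u', surf_lab y = Some (j, u') & `|u' - u| < eps.
Proof.
move=> mE eps eps0; apply: open_nbhs_nbhs; split; last by exists u => //; rewrite subrr normr0.
apply: (@surf_lab_open _ [set l | exists2 u', l = Some (j, u') & `|u' - u| < eps]
  (@open_edge_lab R g j u eps)) => x; by [].
Qed.

Lemma surf_near_vertex (m : S) : surf_lab m = None -> \forall y \near m,
  surf_lab y = None \/ exists j u, surf_lab y = Some (j, u) /\ (u < 3^-1 \/ 2 / 3 < u).
Proof.
move=> mE; apply: open_nbhs_nbhs; split; last by left.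
apply: (@surf_lab_open _ [set l | l = None \/ exists j u, l = Some (j, u) /\ (u < 3^-1 \/ 2 / 3 < u)]
  (@open_vertex_lab R g)) => x; by [].
Qed.

Definition surface_graph : graph_model R S J.
Proof.
apply: (@GraphModel R S J surf_v surf_lab surf_e surf_H).
- by move=> m j u; exact: edge_lab_range.
- exact: surf_lab_e.
- exact: surf_lab_v.
- exact: surf_near_edge.
- exact: surf_near_vertex.
- exact: surf_H_cont.
- move=> m; rewrite -[m]reprK -/(Spi (repr m)) surf_HE /surf_push /= cl0 subr0 !mul1r mul0r addr0.
  by rewrite -surjective_pairing Spt_val.
- move=> s; rewrite surf_HE in_poly ?ler01 ?ler0n // /surf_push /= !mulr0 stair_le0 // mulr0 addr0.
  by [].
- exact: surf_H1.
Defined.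
End SurfaceGraph.

(** * Graph models along a homeomorphism *)

Section Transport.
Variables (R : realType) (X Y : topologicalType) (J : Type) (M : graph_model R Y J).
Variables (f : X -> Y) (f' : Y -> X).
Hypotheses (cf : continuous f) (cf' : continuous f') (fK : cancel f f') (f'K : cancel f' f).

Definition rpath_map a b (p : rpath R a b) : rpath R (f' a) (f' b) :=
  RPath (cont_comp (@rpath_cont _ _ _ _ p) cf')
    (fun t t0 => congr1 f' (rpath_le0 p t0)) (fun t t1 => congr1 f' (rpath_ge1 p t1)).

Definition transport_graph : graph_model R X J.
Proof.
apply: (@GraphModel R X J (f' (gm_v M)) (gm_lab M \o f) (fun j => rpath_map (gm_e M j))
  (fun z => f' (gm_H M (z.1, f z.2)))).
- by move=> x j u /=; exact: gm_range.
- by move=> j u u01 /=; rewrite f'K; exact: gm_lab_e.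
- by rewrite /= f'K; exact: gm_lab_v.
- by move=> x j u xE eps eps0; exact: (cf (gm_near_edge xE eps0)).
- by move=> x xE; exact: (cf (gm_near_vertex xE)).
- apply: (cont_comp _ cf'); apply: (cont_comp _ (@gm_H_cont _ _ _ M)); apply: cont_pair.
    exact: cont_fst.
  exact: (cont_comp (@cont_snd R X) cf).
- by move=> x /=; rewrite gm_H0 fK.
- by move=> s /=; rewrite f'K gm_Hv.
- by move=> x /=; rewrite gm_H1; case: (gm_lab M (f x)) => [[j u]|].
Defined.
End Transport.

(** * Singular chains and first homology *)

Section SimplexPoints.
Variable R : realType.
Implicit Types (u : R) (z : R * R).

Lemma row_continuous (T : topologicalType) n (h : T -> 'rV[R]_n) :
  (forall j, continuous (fun t => h t 0 j)) -> continuous h.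
Proof.
move=> ch t A [P nP PA].
have H : \forall t' \near t, forall j : 'I_n, P 0 j (h t' 0 j).
  by apply: filter_forall => j; exact: (ch j t _ (nP 0 j)).
by apply: filterS H => t' Ht'; apply: PA => a j; rewrite (ord1 a).
Qed.

(** Clamps [b] to the interval from 0 to 1 - cl u, so that [bary2] is defined on the whole plane and
    restricts to the standard coordinates of the triangle. *)
Definition trim u (b : R) : R := Num.max 0 (Num.min (1 - cl u) b).
Lemma trim_bounds u b : 0 <= trim u b /\ cl u + trim u b <= 1.
Proof.
rewrite /trim; have := cl_le1 u => h; split; first by rewrite le_max lexx.
by rewrite /Num.max /Num.min; case: (ltP (1 - cl u) b) => h1; case: ltP => h2; lra.
Qed.
Lemma trim_id u b : 0 <= u -> 0 <= b -> u + b <= 1 -> trim u b = b.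
Proof.
move=> u0 b0 ub; rewrite /trim cl_id //; last by lra.
by rewrite (min_idPr _) ?(max_idPr b0) //; lra.
Qed.

Definition bary1 u : 'rV[R]_2 := \row_i (if i == ord0 then 1 - cl u else cl u).
Definition bary2 z : 'rV[R]_3 := \row_i
  (if i == ord0 then 1 - cl z.1 - trim z.1 z.2 else if i == ord_max then trim z.1 z.2 else cl z.1).

Fact bary1_simplex u : bary1 u \in @std_simplex R 1.
Proof.
apply/mem_set; split=> [i|].
  by rewrite mxE; case: ifP => _; rewrite ?cl_ge0 // subr_ge0 cl_le1.
by rewrite big_ord_recl big_ord1 !mxE /= subrK.
Qed.
Fact bary2_simplex z : bary2 z \in @std_simplex R 2.
Proof.
have [t0 t1] := trim_bounds z.1 z.2; have c0 := cl_ge0 z.1.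
apply/mem_set; split=> [i|].
  by rewrite mxE; case: ifP => _; [lra|case: ifP].
by rewrite !big_ord_recl big_ord0 !mxE /=; lra.
Qed.
Definition pt1 u : @std_simplex R 1 := exist (fun p => p \in @std_simplex R 1) _ (bary1_simplex u).
Definition pt2 z : @std_simplex R 2 := exist (fun p => p \in @std_simplex R 2) _ (bary2_simplex z).

Lemma pt1_cont : continuous pt1.
Proof.
apply: continuous_comp_initial; suff : continuous bary1 by [].
apply: row_continuous => j; rewrite /bary1.
have -> : (fun t => (\row_i (if i == ord0 then 1 - cl t else cl t) : 'rV[R]_2) 0 j) =
    (if j == ord0 then (fun t => 1 - cl t) else @cl R).
  by apply/funext => t; rewrite mxE; case: ifP.
by case: ifP => _; cont_tac; exact: continuous_cl.
Qed.
Lemma trim_cont : continuous (fun z : R * R => trim z.1 z.2).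
Proof.
have c : continuous (fun z : R * R => 1 - cl z.1) by cont_tac.
move=> z; apply: (@continuous_max R _ (fun=> 0) (fun z : R * R => Num.min (1 - cl z.1) z.2)).
  exact: cst_continuous.
by apply: (@continuous_min R _ (fun z : R * R => 1 - cl z.1) (fun z => z.2)); [exact: c|exact: cvg_snd].
Qed.
Lemma pt2_cont : continuous pt2.
Proof.
apply: continuous_comp_initial; suff : continuous bary2 by [].
apply: row_continuous => j; rewrite /bary2.
have -> : (fun z : R * R => (\row_i (if i == ord0 then 1 - cl z.1 - trim z.1 z.2
      else if i == ord_max then trim z.1 z.2 else cl z.1) : 'rV[R]_3) 0 j) =
    (if j == ord0 then (fun z => 1 - cl z.1 - trim z.1 z.2)
     else if j == ord_max then (fun z => trim z.1 z.2) else (fun z => cl z.1)).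
  by apply/funext => t; rewrite mxE; case: ifP => _; [|case: ifP].
case: ifP => _; first by apply: contB; [cont_tac|exact: trim_cont].
by case: ifP => _; [exact: trim_cont|cont_tac].
Qed.

Lemma simplex_ge0 n (v : @std_simplex R n) i : 0 <= set_val v 0 i.
Proof. by have [/(_ i)] := set_mem (valP v). Qed.
Lemma simplex1_sum (v : @std_simplex R 1) : set_val v 0 ord0 = 1 - set_val v 0 ord_max.
Proof.
have [_] := set_mem (valP v); rewrite big_ord_recl big_ord1 => <-.
have -> : lift ord0 ord0 = ord_max :> 'I_2 by apply: val_inj.
by rewrite addrK.
Qed.
Lemma simplex1_le1 (v : @std_simplex R 1) : set_val v 0 ord_max <= 1.
Proof. by have := simplex1_sum v; have := simplex_ge0 v ord0; lra. Qed.
Lemma pt1K (v : @std_simplex R 1) : pt1 (set_val v 0 ord_max) = v.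
Proof.
apply: val_inj; apply/rowP => i; rewrite mxE cl_id ?simplex_ge0 ?simplex1_le1 //.
case: eqP => [->|/eqP ne]; first by rewrite -simplex1_sum.
by congr (_ _ _); apply: val_inj; case: i ne => -[|[|//]].
Qed.
End SimplexPoints.

Ltac malg_zmod := apply/malgP => k; rewrite !(mcoeffD, mcoeffN); ring.

Section Simplices.
Variables (R : realType) (X : topologicalType).

Definition sx_fun n (h : 'rV[R]_n.+1 -> X) of continuous h := fun v : @std_simplex R n => h (set_val v).
Lemma sx_fun_cont n (h : 'rV[R]_n.+1 -> X) (ch : continuous h) : continuous (sx_fun ch).
Proof. by apply: (cont_comp _ ch); exact: initial_continuous. Qed.
HB.instance Definition _ n h ch := isContinuous.Build _ _ _ (@sx_fun_cont n h ch).
Definition sx n (h : 'rV[R]_n.+1 -> X) (ch : continuous h) : singular_simplex R X n := sx_fun ch.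

Lemma coord_cont n (i : 'I_n) : continuous (fun v : 'rV[R]_n => v 0 i).
Proof. exact: coord_continuous. Qed.

(** Barycentric coordinates other than the first serve as real parameters: one for a path, two for a
    map of the plane. *)
Definition sx1 (f : R -> X) (cf : continuous f) : singular_simplex R X 1 :=
  sx (cont_comp (@coord_cont 2 ord_max) cf).
Definition sx2 (F : R * R -> X) (cF : continuous F) : singular_simplex R X 2 :=
  sx (cont_comp (cont_pair (@coord_cont 3 (lift ord0 ord0)) (@coord_cont 3 ord_max)) cF).

Lemma sx1E f cf v : @sx1 f cf v = f (set_val v 0 ord_max). Proof. by []. Qed.
Lemma sx2E F cF v : @sx2 F cF v = F (set_val v 0 (lift ord0 ord0), set_val v 0 ord_max).
Proof. by []. Qed.

Lemma insert0E n (i : 'I_n.+2) (v : 'rV[R]_n.+1) (j : 'I_n.+1) : insert0 i v 0 (lift i j) = v 0 j.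
Proof. by rewrite mxE liftK. Qed.
Lemma insert00 n (i : 'I_n.+2) (v : 'rV[R]_n.+1) : insert0 i v 0 i = 0.
Proof. by rewrite mxE unlift_none. Qed.

Lemma face_sx2 F cF (i : 'I_3) v : simplex_face (@sx2 F cF) i v =
  if i == ord0 then F (set_val v 0 ord0, set_val v 0 ord_max)
  else if i == ord_max then F (set_val v 0 ord_max, 0) else F (0, set_val v 0 ord_max).
Proof.
rewrite [LHS]sx2E /= /face /=.
have [l11 l01 lm1 lm0] : [/\ lift (lift ord0 ord0) ord_max = ord_max :> 'I_3,
   lift ord0 ord_max = ord_max :> 'I_3, lift ord_max ord_max = lift ord0 ord0 :> 'I_3 &
   lift ord0 ord0 = lift ord0 ord0 :> 'I_3] by split; apply: val_inj.
case: i => -[|[|[|//]]] lti; rewrite -!val_eqE /=.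
- have -> : Ordinal lti = ord0 by apply: val_inj.
  by rewrite insert0E -[in X in insert0 _ _ 0 X]l01 insert0E.
- have -> : Ordinal lti = lift ord0 ord0 by apply: val_inj.
  by rewrite insert00 -[in X in insert0 _ _ 0 X]l11 insert0E.
have -> : Ordinal lti = ord_max by apply: val_inj.
by rewrite insert00 -lm1 insert0E.
Qed.

Definition sx_path (s : singular_simplex R X 1) (t : R) : X := s (pt1 t).
Lemma sx_path_cont s : continuous (sx_path s).
Proof. by apply: (cont_comp (@pt1_cont R)); exact: cts_fun. Qed.
Lemma sx_path_le0 s t : t <= 0 -> sx_path s t = sx_path s 0.
Proof.
move=> t0; congr (s _); apply: val_inj => /=; apply/rowP => i; rewrite !mxE.
by rewrite cl_le0 // cl0.
Qed.
Lemma sx_path_ge1 s t : 1 <= t -> sx_path s t = sx_path s 1.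
Proof.
move=> t0; congr (s _); apply: val_inj => /=; apply/rowP => i; rewrite !mxE.
by rewrite cl_ge1 // cl1.
Qed.
Definition sx_rpath s : rpath R (sx_path s 0) (sx_path s 1) :=
  RPath (@sx_path_cont s) (@sx_path_le0 s) (@sx_path_ge1 s).

Lemma sx1_path s : sx1 (@sx_path_cont s) = s.
Proof. by apply/continuousEP => v; rewrite sx1E /sx_path pt1K. Qed.
Lemma path_sx1 a b (p : rpath R a b) t : sx_path (sx1 (@rpath_cont _ _ _ _ p)) t = p t.
Proof. by rewrite /sx_path sx1E mxE /= rpath_cl. Qed.

Local Notation C1 := (malg (singular_simplex R X 1) rat).
Local Notation C0 := (malg (singular_simplex R X 0) rat).

Definition is_boundary (c : C1) : Prop := exists d, c = boundary d.
Lemma is_boundary_lin a c c' : is_boundary c -> is_boundary c' -> is_boundary (a *: c + c').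
Proof. by move=> [d ->] [d' ->]; exists (a *: d + d'); rewrite linearP. Qed.
Lemma is_boundary0 : is_boundary 0.
Proof. by exists 0; rewrite linear0. Qed.
Lemma is_boundaryD c c' : is_boundary c -> is_boundary c' -> is_boundary (c + c').
Proof. by move=> h1 h2; rewrite -[c]scale1r; exact: is_boundary_lin. Qed.
Lemma is_boundaryN c : is_boundary c -> is_boundary (- c).
Proof. by move=> h; rewrite -scaleN1r -[_ *: _]addr0; apply: is_boundary_lin => //; exact: is_boundary0. Qed.
Lemma is_boundaryB c c' : is_boundary c -> is_boundary c' -> is_boundary (c - c').
Proof. by move=> h1 h2; apply: is_boundaryD => //; exact: is_boundaryN. Qed.

Lemma boundary_basis2 (s : singular_simplex R X 2) : boundary (basis_elt s) =
  basis_elt (simplex_face s ord0) - basis_elt (simplex_face s (lift ord0 ord0)) +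
  basis_elt (simplex_face s ord_max).
Proof.
rewrite /boundary free_ext_basis !big_ord_recl big_ord0 /= expr0 scale1r expr1 scaleN1r.
rewrite addr0 -addrA; congr (_ + (_ + _)).
have -> : (-1) ^+ 2 = 1 :> rat by rewrite sqrrN expr1n.
by rewrite scale1r; congr (basis_elt (simplex_face s _)); apply: val_inj.
Qed.

Definition chain a b (p : rpath R a b) : C1 := basis_elt (sx1 (@rpath_cont _ _ _ _ p)).

Lemma boundary_sx2 (F : R * R -> X) (cF : continuous F) a0 b0 a1 b1 a2 b2
    (p0 : rpath R a0 b0) (p1 : rpath R a1 b1) (p2 : rpath R a2 b2) :
  (forall t, 0 <= t -> t <= 1 -> F (1 - t, t) = p0 t) ->
  (forall t, 0 <= t -> t <= 1 -> F (0, t) = p1 t) ->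
  (forall t, 0 <= t -> t <= 1 -> F (t, 0) = p2 t) ->
  is_boundary (chain p0 - chain p1 + chain p2).
Proof.
move=> H0 H1 H2; exists (basis_elt (sx2 cF)).
apply: etrans (esym (boundary_basis2 (sx2 cF))).
have E s s' : s = s' -> basis_elt s = basis_elt s' :> C1 by move=> ->.
apply: congr2; first (apply: congr2; first last; first apply: congr1); apply: E;
  apply/continuousEP => v; rewrite sx1E [RHS]face_sx2 /=.
- by rewrite H1 ?simplex_ge0 ?simplex1_le1.
- by rewrite simplex1_sum H0 ?simplex_ge0 ?simplex1_le1.
- by rewrite H2 ?simplex_ge0 ?simplex1_le1.
Qed.

(** The constant 2-simplex has three equal faces, whose alternating sum is one of them. *)
Lemma chain_cst a : is_boundary (chain (pcst R a)).
Proof.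
have := @boundary_sx2 (fun=> a) (@cont_cst _ _ a) _ _ _ _ _ _ (pcst R a) (pcst R a) (pcst R a).
by rewrite subrr add0r; apply.
Qed.

Lemma chain_cat a b c (p : rpath R a b) (q : rpath R b c) :
  is_boundary (chain q - chain (pcat p q) + chain p).
Proof.
(* The triangle is projected to the line with its vertices at 0, 1/2 and 1, so its sides trace [p],
   [q] and their concatenation. *)
have cF : continuous (fun z : R * R => pcat p q (2^-1 * z.1 + z.2)).
  by apply: (cont_comp _ (@rpath_cont _ _ _ _ (pcat p q))); cont_tac.
apply: (boundary_sx2 cF) => t t0 t1.
- rewrite /= /pcat_fun; case: ifP => h; last by congr (q _); lra.
  have -> : t = 0 by lra.
  by rewrite rpath0 subr0 mulr1 addr0 mulfV // rpath1.
- by rewrite /= mulr0 add0r.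
- rewrite /= /pcat_fun addr0 ifT; last by lra.
  by congr (p _); lra.
Qed.

(** The square of the homotopy is cut along its diagonal [D] into two triangles; its constant sides
    are boundaries by [chain_cst]. *)
Lemma chain_hty a b (p q : rpath R a b) : hty p q -> is_boundary (chain p - chain q).
Proof.
move=> [F [cF F0 F1 Fa Fb]].
have cD : continuous (fun t => F (t, t)) by apply: (cont_comp _ cF); cont_tac.
pose D := sx_rpath (sx1 cD).
have DE t : 0 <= t -> t <= 1 -> D t = F (t, t).
  by move=> t0 t1; rewrite /= /sx_path sx1E mxE /= cl_id.
move: D DE => D DE.
have c1 : continuous (fun z : R * R => F (z.2, z.1 + z.2)) by apply: (cont_comp _ cF); cont_tac.
have c2 : continuous (fun z : R * R => F (z.1 + z.2, z.2)) by apply: (cont_comp _ cF); cont_tac.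
have B1 : is_boundary (chain (pcst R b) - chain D + chain p).
  apply: (boundary_sx2 c1) => t t0 t1 /=.
  - by rewrite subrK Fb.
  - by rewrite add0r DE.
  - by rewrite addr0 F0.
have B2 : is_boundary (chain q - chain D + chain (pcst R a)).
  apply: (boundary_sx2 c2) => t t0 t1 /=.
  - by rewrite subrK F1.
  - by rewrite add0r DE.
  - by rewrite addr0 Fa.
have -> : chain p - chain q = (chain (pcst R b) - chain D + chain p) -
    (chain q - chain D + chain (pcst R a)) - chain (pcst R b) + chain (pcst R a).
  move: (chain p) (chain q) (chain D) (chain _) (chain _) => x y z u w.
  malg_zmod.
apply: is_boundaryD; last exact: chain_cst.
by apply: is_boundaryB; [exact: is_boundaryB|exact: chain_cst].
Qed.

Lemma simplex2_paths (s : singular_simplex R X 2) : exists x0 x1 x2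
    (p0 : rpath R x1 x2) (p1 : rpath R x0 x2) (p2 : rpath R x0 x1),
  [/\ p0 =1 sx_path (simplex_face s ord0), p1 =1 sx_path (simplex_face s (lift ord0 ord0)),
      p2 =1 sx_path (simplex_face s ord_max) & hty (pcat p2 p0) p1].
Proof.
pose h z := s (pt2 z).
have ch : continuous h by apply: (cont_comp (@pt2_cont R)); exact: cts_fun.
have mkc (f : R -> R * R) : continuous f -> continuous (fun t => h (f t)).
  by move=> cf; exact: (cont_comp cf ch).
have c0 : continuous (fun t : R => h (1 - cl t, cl t)) by apply: mkc; cont_tac.
have c1 : continuous (fun t : R => h (0, cl t)) by apply: mkc; cont_tac.
have c2 : continuous (fun t : R => h (cl t, 0)) by apply: mkc; cont_tac.
have l0 t : t <= 0 -> h (1 - cl t, cl t) = h (1, 0) by move=> t0; rewrite cl_le0 // subr0.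
have g0 t : 1 <= t -> h (1 - cl t, cl t) = h (0, 1) by move=> t0; rewrite cl_ge1 // subrr.
have l1 t : t <= 0 -> h (0, cl t) = h (0, 0) by move=> t0; rewrite cl_le0.
have g1 t : 1 <= t -> h (0, cl t) = h (0, 1) by move=> t0; rewrite cl_ge1.
have l2 t : t <= 0 -> h (cl t, 0) = h (0, 0) by move=> t0; rewrite cl_le0.
have g2 t : 1 <= t -> h (cl t, 0) = h (1, 0) by move=> t0; rewrite cl_ge1.
exists (h (0, 0)), (h (1, 0)), (h (0, 1)), (RPath c0 l0 g0), (RPath c1 l1 g1), (RPath c2 l2 g2).
have facts (t : R) : [/\ 0 <= cl t, cl t <= 1, 0 <= 1 - cl t & 1 - cl t <= 1].
  by have := cl_ge0 t; have := cl_le1 t => ? ?; split; lra.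
have [m1 m2 m3] : [/\ lift (lift ord0 ord0) ord_max = ord_max :> 'I_3,
   lift ord0 ord_max = ord_max :> 'I_3 & lift ord_max ord_max = lift ord0 ord0 :> 'I_3]
  by split; apply: val_inj.
have rowE (w w' : 'rV[R]_3) : w 0 ord0 = w' 0 ord0 -> w 0 (lift ord0 ord0) = w' 0 (lift ord0 ord0) ->
    w 0 ord_max = w' 0 ord_max -> w = w'.
  move=> e0 e1 e2; apply/rowP => -[[|[|[|//]]] li].
  - by have -> : Ordinal li = ord0 by apply: val_inj.
  - by have -> : Ordinal li = lift ord0 ord0 by apply: val_inj.
  - by have -> : Ordinal li = ord_max by apply: val_inj.
split=> [t|t|t|] /=.
1-3: have [h1 h2 h3 h4] := facts t; congr (s _); apply: val_inj; apply: rowE => /=;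
  rewrite /bary2 !mxE /=.
- by rewrite unlift_none cl_id // trim_id //; lra.
- by rewrite liftK mxE /= cl_id.
- by rewrite -m2 liftK mxE /= trim_id //; lra.
- have -> : ord0 = lift (lift ord0 ord0) ord0 :> 'I_3 by apply: val_inj.
  by rewrite liftK mxE /= cl0 trim_id //; lra.
- by rewrite unlift_none cl0.
- by rewrite -[in X in unlift _ X]m1 liftK mxE /= trim_id //; lra.
- have -> : ord0 = lift ord_max ord0 :> 'I_3 by apply: val_inj.
  by rewrite liftK mxE /= cl_id // trim_id //; lra.
- by rewrite -[in X in unlift _ X]m3 liftK mxE /= cl_id.
- by rewrite unlift_none trim_id //; lra.
(* [P] runs from (0, 0) through (1, 0) to (0, 1); by convexity straight segments join it to the
   remaining side of the triangle. *)
- pose P t := ((cl (2 * t) - cl (2 * t - 1) : R), (cl (2 * t - 1) : R)).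
  exists (fun z => h ((1 - cl z.1) * (P z.2).1, (1 - cl z.1) * (P z.2).2 + cl z.1 * cl z.2)).
  split=> [|t|t|w t t0|w t t1] /=.
  + by apply: (cont_comp _ ch); cont_tac.
  + rewrite cl0 subr0 !mul1r mul0r addr0 /pcat_fun /=; case: ifP => h1.
      by rewrite [cl (_ - 1)]cl_le0 ?subr0 //; lra.
    by rewrite [cl (2 * t)]cl_ge1 //; move/negbT: h1; rewrite -ltNge; lra.
  + by rewrite cl1 subrr !mul0r mul1r add0r.
  + have [e1 e2 e3] : [/\ cl (2 * t) = 0, cl (2 * t - 1) = 0 & cl t = 0] by split; apply: cl_le0; lra.
    by rewrite e1 e2 e3 subrr !mulr0 addr0.
  + have [e1 e2 e3] : [/\ cl (2 * t) = 1, cl (2 * t - 1) = 1 & cl t = 1] by split; apply: cl_ge1; lra.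
    by rewrite e1 e2 e3 subrr mulr0 !mulr1 subrK.
Qed.
End Simplices.

(** * First homology of a graph model *)

Section FirstHomology.
Variables (R : realType) (X : topologicalType) (J : finType) (M : graph_model R X J).
Local Notation v := (gm_v M).
Local Notation C1 := (malg (singular_simplex R X 1) rat).
Local Notation C0 := (malg (singular_simplex R X 0) rat).

(** With these values in the additive group of Q, holonomy counts the passages through circle
    [j]. *)
Definition winding (j i : J) : additive_group rat := (i == j)%:R.
Definition hol (j : J) (f : R -> X) : rat := ghol M (winding j) f.

Lemma hol_cat j a b c (p : rpath R a b) (q : rpath R b c) : hol j (pcat p q) = hol j p + hol j q.
Proof. exact: (ghol_cat M (winding j) p q). Qed.
Lemma hol_hty j a b (p q : rpath R a b) : hty p q -> hol j p = hol j q.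
Proof. exact: (@ghol_hty _ _ _ M _ (winding j)). Qed.
Lemma hol_edge j i : hol j (gm_e M i) = (i == j)%:R.
Proof. exact: (ghol_e M (winding j)). Qed.

Definition chain_hol (j : J) : {linear C1 -> rat^o} := free_ext (fun s => hol j (sx_path s) : rat^o).

Lemma chain_hol_chain j a b (p : rpath R a b) : chain_hol j (chain p) = hol j p.
Proof.
rewrite [LHS]free_ext_basis; congr (hol j _); apply/funext => t; exact: path_sx1.
Qed.

Lemma chain_hol_boundary j (d : malg (singular_simplex R X 2) rat) : chain_hol j (boundary d) = 0.
Proof.
elim/malg_basis_ind: d => [|a s x IH]; first by rewrite !linear0.
rewrite [boundary _]boundary_is_linear linearP IH addr0.
suff E : chain_hol j (boundary (basis_elt s)) = 0 by rewrite E scaler0.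
rewrite (boundary_basis2 s) linearD linearB /chain_hol /= !free_ext_basis.
have [x0 [x1 [x2 [p0 [p1 [p2 [/funext <- /funext <- /funext <- h]]]]]]] := simplex2_paths s.
by rewrite -(hol_hty j h) hol_cat opprD addrA addrAC subrr add0r addNr.
Qed.

Definition sx0 (x : X) : singular_simplex R X 0 := sx (@cont_cst _ _ x).

Lemma boundary_chain a b (p : rpath R a b) :
  boundary (chain p) = basis_elt (sx0 b) - basis_elt (sx0 a) :> C0.
Proof.
rewrite /boundary free_ext_basis !big_ord_recl big_ord0 /= expr0 scale1r expr1 scaleN1r addr0.
congr (basis_elt _ - basis_elt _); apply/continuousEP => w.
  rewrite [LHS]sx1E /= /face /= (_ : ord_max = lift ord0 ord0); last exact: val_inj.
  rewrite insert0E; have [_] := set_mem (valP w); rewrite big_ord1 => ->; exact: rpath1.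
rewrite [LHS]sx1E /= /face /= (_ : ord_max = lift ord0 ord0); last exact: val_inj.
by rewrite insert00 rpath0.
Qed.

Lemma loop_cycle a (p : rpath R a a) : chain p \in @cycles R X 0.
Proof. by rewrite unfold_in /cycles boundary_chain subrr. Qed.

Definition loop_class a (p : rpath R a a) : H1 R X :=
  lmod_proj _ (Sub (chain p) (loop_cycle p) : cycle_module R X 0).

(** A projection onto the span of the edge loops, which kills boundaries because holonomy does. *)
Definition edge_part (c : C1) : C1 := \sum_j chain_hol j c *: chain (gm_e M j).

Lemma edge_part_is_linear : linear edge_part.
Proof.
move=> a c c'; rewrite /edge_part scaler_sumr -big_split /=; apply: eq_bigr => j _.
by rewrite linearP scalerDl scalerA.
Qed.
HB.instance Definition _ := GRing.isLinear.Build rat C1 C1 *:%R edge_part edge_part_is_linear.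
Lemma edge_partD c c' : edge_part (c + c') = edge_part c + edge_part c'. Proof. exact: linearD. Qed.
Lemma edge_partB c c' : edge_part (c - c') = edge_part c - edge_part c'. Proof. exact: linearB. Qed.

Definition residue a b (p : rpath R a b) : C1 := chain p - edge_part (chain p).

Lemma edge_part_boundary d : edge_part (boundary d) = 0.
Proof. by rewrite /edge_part big1 // => j _; rewrite chain_hol_boundary scale0r. Qed.

Lemma residue_boundary (c : C1) : is_boundary c -> is_boundary (c - edge_part c).
Proof. by move=> [d ->]; rewrite edge_part_boundary subr0; exists d. Qed.

Lemma residue_cat a b c (p : rpath R a b) (q : rpath R b c) :
  is_boundary (residue q - residue (pcat p q) + residue p).
Proof.
have := residue_boundary (chain_cat p q); rewrite edge_partD edge_partB /residue.
move: (chain p) (chain q) (chain (pcat p q)) (edge_part _) (edge_part _) (edge_part _) => x y z x' y' z'.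
congr is_boundary; malg_zmod.
Qed.
Lemma residue_hty a b (p q : rpath R a b) : hty p q -> is_boundary (residue p - residue q).
Proof.
move=> /chain_hty/residue_boundary; rewrite edge_partB /residue.
move: (chain p) (chain q) (edge_part _) (edge_part _) => x y x' y'.
congr is_boundary; malg_zmod.
Qed.
Lemma residue_cst a : is_boundary (residue (pcst R a)).
Proof. exact: (residue_boundary (chain_cst R a)). Qed.
Lemma residue_edge j : residue (gm_e M j) = 0.
Proof.
rewrite /residue /edge_part (bigD1 j) //= chain_hol_chain hol_edge eqxx scale1r big1 ?addr0 ?subrr //.
by move=> i ij; rewrite chain_hol_chain hol_edge eq_sym (negPf ij) scale0r.
Qed.
Lemma residue_rev a b (p : rpath R a b) : is_boundary (residue p + residue (prev p)).
Proof.
have h1 := residue_cat p (prev p); have h2 := residue_hty (pcatpV p); have h3 := residue_cst a.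
have := is_boundaryD (is_boundaryD h1 h2) h3.
move: (residue p) (residue (prev p)) (residue (pcat _ _)) (residue (pcst _ _)) => x y z w.
congr is_boundary; malg_zmod.
Qed.

Lemma residue_edge_word p : @edge_word _ _ _ M p -> is_boundary (residue p).
Proof.
elim=> {p} [|j|p q _ hp _ hq|p _ hp|p q _ hp /residue_hty hpq].
- exact: residue_cst.
- by rewrite residue_edge; exact: is_boundary0.
- have := is_boundaryB (is_boundaryD hp hq) (residue_cat p q).
  move: (residue p) (residue q) (residue (pcat p q)) => x y z.
  congr is_boundary; malg_zmod.
- have := is_boundaryB (residue_rev p) hp.
  by rewrite addrAC subrr add0r.
by have := is_boundaryB hp hpq; rewrite opprB addrC subrK.
Qed.

Definition tail x : rpath R v x := projT1 (cid (path_from_v M x)).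

(** Modulo boundaries the residue is additive under concatenation and vanishes on edge words. Tails
    close [p] up to a loop at the vertex, which is an edge word; so only the endpoints of [p]
    matter. *)
Lemma residue_tail a b (p : rpath R a b) :
  is_boundary (residue p - (residue (tail b) - residue (tail a))).
Proof.
have h0 := residue_edge_word (edge_word_all (pcat (pcat (tail a) p) (prev (tail b)))).
have h1 := residue_cat (pcat (tail a) p) (prev (tail b)).
have h2 := residue_cat (tail a) p.
have h3 := residue_rev (tail b).
have := is_boundaryB (is_boundaryD (is_boundaryD h0 h1) h2) h3.
move: (residue p) (residue (tail a)) (residue (tail b)) (residue (prev _)) (residue (pcat _ p))
  (residue (pcat _ _)).
move=> x y z u u' u''.
congr is_boundary; malg_zmod.
Qed.

Fact bary0_simplex : const_mx 1 \in @std_simplex R 0.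
Proof. by apply/mem_set; split=> [i|]; rewrite ?big_ord1 mxE. Qed.
Definition pt0 : @std_simplex R 0 := exist (fun p => p \in @std_simplex R 0) _ bary0_simplex.

Definition tail_chain : {linear C0 -> C1} :=
  free_ext (fun s : singular_simplex R X 0 => residue (tail (s pt0))).

(** [tail_chain] acts as a chain homotopy and extends [residue_tail] linearly to all chains. On
    cycles its term vanishes, so every cycle is homologous to its edge part. *)
Lemma residue_chain (c : C1) : is_boundary (c - edge_part c - tail_chain (boundary c)).
Proof.
elim/malg_basis_ind: c => [|a s x IH].
  have e0 : edge_part 0 = 0 by exact: linear0.
  have b0 : boundary (0 : C1) = 0 by exact: linear0.
  have t0 : tail_chain 0 = 0 by exact: linear0.
  by rewrite b0 t0 e0 !subr0; exact: is_boundary0.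
have hs : is_boundary (basis_elt s - edge_part (basis_elt s) - tail_chain (boundary (basis_elt s))).
  have := residue_tail (sx_rpath s).
  have -> : basis_elt s = chain (sx_rpath s) by rewrite /chain sx1_path.
  rewrite boundary_chain.
  have -> : tail_chain (basis_elt (sx0 (sx_path s 1)) - basis_elt (sx0 (sx_path s 0))) =
      residue (tail (sx_path s 1)) - residue (tail (sx_path s 0)).
    by rewrite linearB; congr (_ - _); exact: free_ext_basis.
  by [].
have tl y y' : tail_chain (a *: y + y') = a *: tail_chain y + tail_chain y' by exact: linearP.
rewrite edge_part_is_linear [boundary _]boundary_is_linear tl.
have := is_boundary_lin a hs IH.
move: (edge_part x) (tail_chain (boundary x)) (edge_part _) (tail_chain _) => x' x'' y' y''.
move: (basis_elt s : C1) => y.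
congr is_boundary; apply/malgP => k; rewrite !(mcoeffD, mcoeffN, mcoeffZ); ring.
Qed.

Lemma chain_hol_relation j (z : cycle_module R X 0) :
  (exists c, val z = boundary c) -> (chain_hol j \o val) z = 0.
Proof. by move=> [c /= ->]; exact: chain_hol_boundary. Qed.

Definition H1_coord j : {linear H1 R X -> rat^o} := quot_lift (chain_hol_relation j).

Lemma H1_coord_proj j (z : cycle_module R X 0) : H1_coord j (lmod_proj _ z) = chain_hol j (val z).
Proof. exact: (quot_liftE (@chain_hol_relation j)). Qed.

Lemma H1_coordE i j : H1_coord i (loop_class (gm_e M j)) = (i == j)%:R.
Proof.
rewrite [LHS]H1_coord_proj [LHS](chain_hol_chain i (gm_e M j)) hol_edge eq_sym //.
Qed.

Lemma H1_decomp (h : H1 R X) : h = \sum_j H1_coord j h *: loop_class (gm_e M j).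
Proof.
elim/lmod_projW: h => z.
pose z' := \sum_j chain_hol j (val z) *: (Sub (chain (gm_e M j)) (loop_cycle (gm_e M j)) : cycle_module R X 0).
have -> : \sum_j H1_coord j (lmod_proj _ z) *: loop_class (gm_e M j) = lmod_proj _ z'.
  rewrite linear_sum; apply: eq_bigr => j _; rewrite linearZ /=; congr (_ *: _).
  exact: H1_coord_proj.
have vz' : val z' = edge_part (val z).
  by rewrite /z' linear_sum; apply: eq_bigr => j _; rewrite linearZ.
apply/lmod_projP/submod_gen_mem.
have [d Hd] := residue_chain (val z); exists d; rewrite -Hd.
have -> : val (z - z') = val z - edge_part (val z) by rewrite -vz'; exact: linearB.
have /eqP -> : boundary (val z) == 0 by exact: (valP z).
have -> : tail_chain 0 = 0 by exact: linear0.
by rewrite subr0.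
Qed.
End FirstHomology.

Theorem theorem1p1 (R : realType) (g : nat) (Sigma : topologicalType)
    (hSigma : is_surface_genus_one_boundary R g Sigma) (x0 : Sigma) :
  group_isomorphic
    (K1 (completed_group_ring (pi1 R x0)))
    (nonzero rat *
     additive_group
       (seq_prod (fun n : nat => cyclic_coinvariants (H1 R Sigma) n.+1)))%type.
Proof.
have [f [f' [cf cf' fK f'K]]] := hSigma.
pose M := transport_graph (surface_graph R g) cf cf' fK f'K.
apply: (@K1_completed_free ('I_g * bool)%type _ (gen_class M x0)).
  by split=> [|K k]; [exact: graph_pi1_generated|exact: graph_pi1_extend].
exact: (K1_ncps_coinvariants (H1_coordE M) (H1_decomp M)).
Qed.
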